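(* There are at least $1410$ pairwise non-isomorphic quasi-symmetric $(56,16,6)$ designs (with block intersection numbers $x=4$, $y=6$). More precisely, there exist $1410$ pairwise non-isomorphic such designs whose full automorphism groups have orders distributed as follows: $1$ design with full automorphism group of order $168$, $876$ designs of order $48$, $1$ design of order $24$, $1$ design of order $21$, $228$ designs of order $16$, and $303$ designs of order $12$.
   Context: A block design with parameters $(v,k,\lambda)$ consists of a set of $v$ points and a family of $k$-element subsets of the point set, called blocks, such that every pair of distinct points is contained in exactly $\lambda$ blocks. A design is quasi-symmetric with intersection numbers $x<y$ if $|B_1\cap B_2|\in\{x,y\}$ for any two blocks $B_1,B_2$ and both values occur. A quasi-symmetric $(56,16,6)$ design means one with intersection numbers $x=4$, $y=6$; it has $77$ blocks and $22$ blocks through each point. An isomorphism of designs is a bijection of point sets mapping the blocks of one design onto the blocks of the other; the full automorphism group of a design is the group of all isomorphisms of the design to itself. *)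

(* Defs.v *)
From HB Require Import structures.
From mathcomp Require Import all_boot all_fingroup.

Set Implicit Arguments.
Unset Strict Implicit.
Unset Printing Implicit Defensive.

(* A design is given by its set of blocks. Repeated blocks are not represented:
   two copies of a block would meet in k points, so they cannot occur in a
   quasi-symmetric design with intersection numbers smaller than k. *)
Definition is_design (T : finType) (v k lambda : nat) (D : {set {set T}})
    : Prop :=
  [/\ #|T| = v,
      forall B, B \in D -> #|B| = k
    & forall p q : T, p != q ->
        #|[set B in D | (p \in B) && (q \in B)]| = lambda].

Definition quasi_symmetric (T : finType) (x y : nat) (D : {set {set T}})
    : Prop :=
  [/\ x < y,
      forall B1 B2, B1 \in D -> B2 \in D -> B1 != B2 ->
        #|B1 :&: B2| = x \/ #|B1 :&: B2| = y,
      exists B1 B2, [/\ B1 \in D, B2 \in D, B1 != B2 & #|B1 :&: B2| = x]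
    & exists B1 B2, [/\ B1 \in D, B2 \in D, B1 != B2 & #|B1 :&: B2| = y]].

Definition image_blocks (T1 T2 : finType) (f : T1 -> T2) (D : {set {set T1}})
    : {set {set T2}} :=
  [set f @: (B : {set T1}) | B in D].

Definition isomorphic (T1 T2 : finType) (D1 : {set {set T1}})
    (D2 : {set {set T2}}) : Prop :=
  exists2 f : T1 -> T2, bijective f & image_blocks f D1 = D2.

Definition design_aut (T : finType) (D : {set {set T}}) : {set {perm T}} :=
  [set s : {perm T} | image_blocks s D == D].

Lemma design_aut_group_set (T : finType) (D : {set {set T}}) :
  group_set (design_aut D).
Proof.
apply/group_setP; split=> [|s t]; rewrite ?inE /image_blocks.
  apply/eqP; rewrite -[RHS]imset_id; apply: eq_imset => B.
  by rewrite -[RHS]imset_id; apply: eq_imset => p; rewrite perm1.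
move=> /eqP sD /eqP tD; apply/eqP; rewrite -[RHS]tD -[in RHS]sD -imset_comp.
apply: eq_imset => B /=; rewrite -imset_comp.
by apply: eq_imset => p; rewrite permM.
Qed.

Canonical design_aut_group (T : finType) (D : {set {set T}}) :=
  Group (design_aut_group_set D).

(* Main.v *)
Require Import Defs.
From HB Require Import structures.
From mathcomp Require Import all_boot all_fingroup all_algebra.
From Stdlib Require Import PArith.
From Stdlib Require List.
Set Implicit Arguments.
Unset Strict Implicit.
Unset Printing Implicit Defensive.

(** The designs are residuals of symmetric (78,22,6) designs whose derived
    design is the Steiner system S(3,6,22).  Seen from the blocks, such a
    design is a system of 56 sets of hexads: the 77 blocks correspond to the 77
    hexads, and a point is replaced by the set of the 22 hexads through it.
    Call the set of the 21 hexads on one of the 22 points of the Steiner system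
    a star.  The system is only asked to consist of 22-sets that meet each other
    and every star in 6 hexads ([residual]).  The stars and these
    sets, with one further column, are the rows of a matrix [N] of order 78 with
    [N N^T = 16 I + 6 J]; then [N^T N] is the same matrix, and reading off its
    entries shows that two blocks meet in 6 points if their hexads are disjoint
    and in 4 otherwise ([residual_dual], [residual_design]).

    In particular the design remembers which hexads are disjoint.  So its
    automorphisms, and the isomorphisms between two such designs, are
    automorphisms of the graph of disjoint hexads that carry one system of sets
    to the other ([residual_aut], [residual_isomorphic],
    [residual_graph_aut]).  Everything that remains is a finite problem about
    this graph.

    The 1410 systems come in 22 batches.  A batch is given by generators of a
    group [G] of automorphisms of the graph, by representatives of some
    [G]-orbits of 22-sets of hexads, and by the systems, each of which is a
    union of these orbits.  Hence [G] acts on every design of the batch, and two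
    things have to be shown: there are no other automorphisms, and different
    systems give different designs.  The number of pairs of hexads in a 22-set
    without a common neighbour in the set is invariant ([unlinked]).  The sets
    of a system with a well-chosen value of this invariant form the same small
    union of orbits for all systems of the batch, its core.  An automorphism of
    the graph that carries a system of the batch to another one therefore
    preserves the core.  A backtrack search, with colour refinement by
    membership in members of the core and by adjacency, gives a short list that
    contains, up to multiplication by [G], all graph automorphisms that preserve
    the core ([searchP], [leaf]).  Those outside [G] carry no system of the
    batch to a system of the batch: if the image were a system, the preimages of
    its members would lie in orbits of one and the same system, and already for
    a few members they do not ([deadP], [spreadP]).  Systems of different batches
    are told apart by the order of [G], by the number of members with a given
    value of the invariant, or by the same search ([apartP]).

    Sets of hexads are handled as binary numbers, and [batches_verified] is the
    computation that carries out all these checks. *)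

(** * Dual designs *)

(** The points and blocks of a design are treated symmetrically, as the two
    sides of an incidence relation. *)
Definition blocks (T1 T2 : finType) (I : T1 -> T2 -> bool) : {set {set T1}} :=
  [set [set x | I x y] | y : T2].

Section Duality.
Variables T1 T2 : finType.
Implicit Types I J : T1 -> T2 -> bool.

Definition distinct_blocks I := injective (fun y => [set x | I x y]).

(** When blocks are distinct as sets, a permutation of the points that
    preserves the set of blocks moves the block names by a definite
    permutation. *)
Lemma incidence_of_image I J (s : {perm T1}) : distinct_blocks I ->
  image_blocks s (blocks I) = blocks J ->
  exists t : {perm T2}, forall x y, J (s x) (t y) = I x y.
Proof.
move=> injI sIJ; have injs := @perm_inj _ s.
have tP y : exists z, s @: [set x | I x y] == [set x | J x z].
  have : s @: [set x | I x y] \in blocks J.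
    by rewrite -sIJ; apply/imsetP; exists [set x | I x y]; rewrite ?imset_f.
  by case/imsetP=> z _ ->; exists z.
pose t y := xchoose (tP y).
have tE y : s @: [set x | I x y] = [set x | J x (t y)].
  exact/eqP/(xchooseP (tP y)).
have injt : injective t.
  by move=> y z yz; apply/injI/(imset_inj injs); rewrite /= !tE yz.
exists (perm injt) => x y; rewrite permE.
have := mem_imset [set x | I x y] x injs.
by rewrite tE !inE => <-.
Qed.

Lemma image_of_incidence I J (s : {perm T1}) (t : {perm T2}) :
  (forall x y, J (s x) (t y) = I x y) -> image_blocks s (blocks I) = blocks J.
Proof.
move=> st; have img y : s @: [set x | I x y] = [set x | J x (t y)].
  apply/setP=> x; rewrite -[x](permKV s) (mem_imset _ _ (@perm_inj _ s)).
  by rewrite !inE st.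
apply/setP=> B; apply/imsetP/imsetP=> [[_ /imsetP[y _ ->] ->]|[y _ ->]].
  by exists (t y).
exists [set x | I x (t^-1 y)%g]; first by rewrite imset_f.
by rewrite img permKV.
Qed.

(** Pairs of compatible permutations: the description of automorphisms in which
    points and blocks play the same role. *)
Definition incidence_auts I : {set {perm T1} * {perm T2}} :=
  [set st : {perm T1} * {perm T2} | [forall x, forall y, I (st.1 x) (st.2 y) == I x y]].

Lemma incidence_autsP I (s : {perm T1}) (t : {perm T2}) :
  reflect (forall x y, I (s x) (t y) = I x y) ((s, t) \in incidence_auts I).
Proof.
rewrite inE; apply: (iffP forallP) => [st x y|st x]; first exact/eqP/(forallP (st x)).
by apply/forallP=> y; rewrite /= st.
Qed.

Lemma card_design_aut_blocks I : distinct_blocks I ->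
  #|design_aut (blocks I)| = #|incidence_auts I|.
Proof.
move=> injI; rewrite -(@card_in_imset _ _ fst (incidence_auts I)) => [|u v].
  apply: eq_card => s; apply/idP/imsetP=> [|[[s' t] /incidence_autsP st /= ->]].
    rewrite inE => /eqP sI.
    by have [t /incidence_autsP st] := incidence_of_image injI sI; exists (s, t).
  by rewrite inE (image_of_incidence st).
case: u v => [s t] [s' t'] /incidence_autsP st /incidence_autsP st' /= e.
subst s'; congr pair; apply/permP=> y; apply: injI.
apply/setP=> x; rewrite !inE -[x](permKV s) st -(st' _ y) //.
Qed.
End Duality.

(** Both groups are projections of the group of compatible pairs, and the
    projections are injective because points, and blocks, are distinguished by
    their incidences. *)
Lemma card_design_aut_dual (T1 T2 : finType) (I : T1 -> T2 -> bool) :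
  distinct_blocks I -> distinct_blocks (fun y x => I x y) ->
  #|design_aut (blocks I)| = #|design_aut (blocks (fun y x => I x y))|.
Proof.
move=> injI injI'; rewrite !card_design_aut_blocks //.
pose swap (A B : Type) (u : A * B) := (u.2, u.1).
rewrite -(card_imset _ (_ : injective (@swap _ _))) => [|[? ?] [? ?] [-> ->]] //.
apply: eq_card => -[t s]; apply/imsetP/incidence_autsP=> [[[s' t']] /= |st].
  by move=> /incidence_autsP st [-> ->].
by exists (s, t) => //; apply/incidence_autsP.
Qed.

Lemma isomorphic_dual (T1 T2 : finType) (I J : T1 -> T2 -> bool) :
  distinct_blocks I -> isomorphic (blocks I) (blocks J) ->
  exists t : {perm T2}, image_blocks t (blocks (fun y x => I x y)) =
                        blocks (fun y x => J x y).
Proof.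
move=> injI [f /bij_inj injf fIJ].
have [|t ft] := @incidence_of_image _ _ I J (perm injf) injI.
  by rewrite -fIJ; apply: eq_imset => B; apply: eq_imset => x; rewrite permE.
by exists t; apply: (@image_of_incidence _ _ _ _ t (perm injf)) => y x; rewrite ft.
Qed.

(** * Completing a system of sets to a square matrix *)

Section SquareDesign.
Import GRing.Theory.
Local Open Scope ring_scope.

(** The hypotheses make [N] invertible with inverse a combination of [N^T] and
    [J]; that inverse is two-sided.  This is the classical argument that the
    dual of a symmetric design is a design. *)
Lemma square_design_dual (F : fieldType) n (N : 'M[F]_n) (a b k : F) :
  a != 0 -> k != 0 -> a + b * n%:R = k * k ->
  N *m N^T = a%:M + const_mx b -> N *m const_mx 1 = const_mx k :> 'M_n ->
  N^T *m N = a%:M + const_mx b.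
Proof.
move=> a0 k0 kk NNT.
pose J : 'M[F]_n := const_mx 1.
have constE c : const_mx c = c *: J by apply/matrixP=> i j; rewrite !mxE mulr1.
rewrite !constE scale1r in NNT * => NJ.
have JJ : J *m J = n%:R *: J.
  apply/matrixP=> i j; rewrite !mxE mulr1.
  under eq_bigr do rewrite !mxE mulr1.
  by rewrite sumr_const card_ord.
have JT : J^T = J by apply/matrixP=> i j; rewrite !mxE.
(* The candidate for the inverse of [N]. *)
pose X := a^-1 *: (N^T - (b / k) *: J).
have NX : N *m X = 1%:M.
  rewrite /X -scalemxAr mulmxBr NNT -scalemxAr NJ scalerA.
  by rewrite divfK // addrK -[a%:M]scalemx1 scalerA mulVf // scale1r.
have XN := mulmx1C NX.
have NTJ : N^T *m J = k *: J.
  have : X *m (N *m J) = J by rewrite mulmxA XN mul1mx.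
  rewrite NJ -scalemxAr => /(congr1 (fun M => (a / k) *: M)).
  rewrite scalerA divfK // /X -scalemxAl scalerA divff // scale1r.
  rewrite mulmxBl -scalemxAl JJ scalerA => /(canRL (subrK _)) ->.
  rewrite -scalerDl; congr (_ *: _).
  by apply: (mulIf k0); rewrite mulrDl divfK // mulrAC divfK // kk.
have JN : J *m N = k *: J by rewrite -[LHS]trmxK trmx_mul JT NTJ linearZ /= JT.
move: XN; rewrite /X -scalemxAl mulmxBl -scalemxAl JN scalerA divfK //.
move=> /(congr1 (fun M => a *: M)); rewrite scalerA mulfV // scale1r scalemx1.
by move=> /(canRL (subrK _)) ->.
Qed.

Lemma sum_mem2 (T : finType) (A B : {set T}) :
  \sum_x ((x \in A)%:R * (x \in B)%:R) = #|A :&: B|%:R :> rat.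
Proof.
rewrite -sum1_card natr_sum [RHS]big_mkcond /=; apply: eq_bigr => x _.
by rewrite inE; do 2 case: (x \in _); rewrite ?mul0r ?mulr0 ?mul1r.
Qed.

Lemma sum_mem (T : finType) (A : {set T}) :
  \sum_x ((x \in A)%:R) = #|A|%:R :> rat.
Proof.
rewrite -[A in RHS]setIid -sum_mem2; apply: eq_bigr => x _.
by case: (x \in A); rewrite ?mul0r ?mul1r.
Qed.
Local Open Scope nat_scope.

(** The rows of the matrix are the 22 stars, extended by an entry 1, and the 56
    sets, extended by an entry 0; two rows have inner product 6, a row with
    itself 22.  The columns then have the same inner products, which is the
    claim for the columns of two hexads. *)
Lemma residual_dual (S : 'I_22 -> {set 'I_77}) (P : 'I_56 -> {set 'I_77}) :
  (forall p, #|S p| = 21) -> (forall p q, p != q -> #|S p :&: S q| = 5) ->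
  (forall i, #|P i| = 22) -> (forall i j, i != j -> #|P i :&: P j| = 6) ->
  (forall i p, #|P i :&: S p| = 6) ->
  forall g h, #|[set i | (g \in P i) && (h \in P i)]| +
              #|[set p | (g \in S p) && (h \in S p)]| = 6 + 16 * (g == h).
Proof.
move=> S1 S2 P1 P2 PS g h.
pose MS : 'M[rat]_(22, 77) := \matrix_(p, x) ((x \in S p)%:R)%R.
pose MP : 'M[rat]_(56, 77) := \matrix_(i, x) ((x \in P i)%:R)%R.
pose N : 'M[rat]_(22 + 56, 1 + 77) := block_mx (const_mx 1%R) MS 0%R MP.
have NNT : (N *m N^T = 16%:R%:M + const_mx 6%:R :> 'M_(22 + 56))%R.
  rewrite (scalar_mx_block 22 56) -[const_mx 6%:R](@submxK _ 22 56 22 56).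
  rewrite tr_block_mx mulmx_block add_block_mx; congr block_mx.
  - apply/matrixP=> p q; rewrite !mxE big_ord1 !mxE mulr1.
    under eq_bigr do rewrite !mxE.
    rewrite sum_mem2; have [->|pq] := eqVneq p q; last first.
      by rewrite S2 // mulr0n add0r.
    by rewrite setIid S1.
  - apply/matrixP=> p i; rewrite !mxE big_ord1 !mxE mulr0 add0r add0r.
    under eq_bigr do rewrite !mxE.
    by rewrite sum_mem2 setIC PS.
  - apply/matrixP=> i p; rewrite !mxE big_ord1 !mxE mul0r add0r add0r.
    under eq_bigr do rewrite !mxE.
    by rewrite sum_mem2 PS.
  - apply/matrixP=> i j; rewrite !mxE big_ord1 !mxE mul0r add0r.
    under eq_bigr do rewrite !mxE.
    rewrite sum_mem2; have [->|ij] := eqVneq i j; last first.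
      by rewrite P2 // mulr0n add0r.
    by rewrite setIid P1.
have Nj : (N *m const_mx 1 = const_mx 22%:R :> 'M_(22 + 56, 78))%R.
  rewrite -[const_mx 1%R](@vsubmxK _ 1 77) -[RHS](@vsubmxK _ 22 56).
  rewrite mul_block_col; congr col_mx; apply/matrixP=> i j; rewrite !mxE big_ord1 !mxE.
    under eq_bigr do rewrite !mxE mulr1.
    by rewrite sum_mem S1 mulr1.
  under eq_bigr do rewrite !mxE mulr1.
  by rewrite sum_mem P1 mul0r add0r.
have : (N^T *m N = 16%:R%:M + const_mx 6%:R :> 'M_(1 + 77))%R.
  exact: (@square_design_dual _ 78 N 16%:R%R 6%:R%R 22%:R%R isT isT erefl NNT Nj).
rewrite /N tr_block_mx mulmx_block => /matrixP/(_ (rshift 1 g) (rshift 1 h)).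
rewrite (@block_mxEdr _ 1 77 1 77) !mxE.
have sumE m (F : 'I_m -> {set 'I_77}) :
    (\sum_i ((g \in F i)%:R * (h \in F i)%:R) =
     #|[set i | (g \in F i) && (h \in F i)]|%:R :> rat)%R.
  rewrite -sum1_card natr_sum [RHS]big_mkcond /=; apply: eq_bigr => x _.
  by rewrite inE; do 2 case: (_ \in _); rewrite ?mul0r ?mulr0 ?mul1r.
under eq_bigr do rewrite !mxE.
under [X in (_ + X = _)%R]eq_bigr do rewrite !mxE.
rewrite !sumE (inj_eq (@rshift_inj _ _)) -mulrnA -!natrD => /eqP.
by rewrite Num.Theory.eqr_nat addnC => /eqP ->; rewrite addnC.
Qed.

End SquareDesign.

(** * Sets and permutations of hexads as data *)

(** A positive number is a sequence of bits, least significant first, closed by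
    its leading bit.  So a set of hexads is a number between [2^77] and
    [2^78], and the leading bit marks the length. *)
Fixpoint bits (p : positive) : bitseq :=
  match p with
  | xH => [::] | xO q => false :: bits q | xI q => true :: bits q
  end.

Fixpoint of_bits (s : bitseq) : positive :=
  match s with
  | [::] => xH | true :: t => xI (of_bits t) | false :: t => xO (of_bits t)
  end.

Lemma of_bitsK : cancel of_bits bits.
Proof. by elim=> //= -[] s /= ->. Qed.

Lemma bitsK : cancel bits of_bits.
Proof. by elim=> //= p ->. Qed.

Lemma pos_eqP : Equality.axiom Pos.eqb.
Proof. by move=> p q; apply: (iffP idP) => /Pos.eqb_eq. Qed.

HB.instance Definition _ := hasDecEq.Build positive pos_eqP.

Definition pset (p : positive) : {set 'I_77} :=
  [set x : 'I_77 | nth false (bits p) x].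

Fixpoint cap (acc : nat) (p q : positive) : nat :=
  match p, q with
  | xI p', xI q' => cap acc.+1 p' q'
  | xI p', xO q' | xO p', xI q' | xO p', xO q' => cap acc p' q'
  | _, _ => acc
  end.

Lemma cap_sum n acc p q : size (bits p) <= n ->
  cap acc p q = acc + \sum_(i < n) (nth false (bits p) i && nth false (bits q) i).
Proof.
elim: p q n acc => [p IHp|p IHp|] [q|q|] [|n] //= acc; rewrite ?ltnS => pn;
  rewrite ?(IHp _ n) // ?big_ord_recl /= ?nth_nil ?add0n //.
all: try by rewrite big1 ?addn0 // => i _; rewrite ?nth_nil ?andbF.
all: try by rewrite addSnnS.
Qed.

Lemma cap_pset p q : size (bits p) = 77 -> cap 0 p q = #|pset p :&: pset q|.
Proof.
move=> p77; rewrite (@cap_sum 77) ?p77 // add0n -sum1_card [RHS]big_mkcond /=.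
by apply: eq_bigr => i _; rewrite !inE; do 2 case: nth.
Qed.

Definition is_perm (s : seq nat) :=
  [&& size s == 77, all (fun i => i < 77) s & uniq s].

(** Permutations of the hexads are listed by their values; a list that does not
    describe a permutation stands for the identity. *)
Definition to_perm (s : seq nat) : {perm 'I_77} :=
  odflt 1%g [pick g : {perm 'I_77} | [forall x, val (g x) == nth 0 s x]].

Lemma to_permE s x : is_perm s -> to_perm s x = nth 0 s x :> nat.
Proof.
case/and3P=> /eqP s77 /allP sb us; rewrite /to_perm; case: pickP => [g /forallP gs|].
  exact/eqP/gs.
have lt77 y : y < 77 -> nth 0 s y < 77 by move=> y77; rewrite sb ?mem_nth ?s77.
pose f y : 'I_77 := Ordinal (lt77 _ (ltn_ord y)).
have injf : injective f.
  move=> y z /(congr1 val) /= /eqP; rewrite nth_uniq ?s77 // => /eqP.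
  exact: val_inj.
by move=> /(_ (perm injf)) /forallP[] y; rewrite permE.
Qed.

Lemma to_perm_inj s t : is_perm s -> is_perm t -> to_perm s = to_perm t -> s = t.
Proof.
move=> sP tP st; apply: (@eq_from_nth _ 0) => [|i].
  by case/and3P: sP => /eqP->; case/and3P: tP => /eqP->.
case/and3P: (sP) => /eqP-> _ _ i77.
by have /(congr1 val) := congr1 (fun g : {perm _} => g (Ordinal i77)) st; rewrite /= !to_permE.
Qed.

Lemma is_perm_val (g : {perm 'I_77}) : is_perm [seq val (g x) | x <- enum 'I_77].
Proof.
rewrite /is_perm size_map size_enum_ord eqxx map_inj_uniq ?enum_uniq; last first.
  by apply: inj_comp; [exact: val_inj|exact: perm_inj].
by rewrite andbT /=; apply/allP=> _ /mapP[x _ ->].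
Qed.

Lemma to_perm_val (g : {perm 'I_77}) : to_perm [seq val (g x) | x <- enum 'I_77] = g.
Proof.
apply/permP=> x; apply: val_inj => /=; rewrite to_permE ?is_perm_val //.
by rewrite (nth_map x) ?size_enum_ord // nth_ord_enum.
Qed.

Definition compose (s t : seq nat) := [seq nth 0 s i | i <- t].

Lemma is_perm_compose s t : is_perm s -> is_perm t -> is_perm (compose s t).
Proof.
move=> /and3P[/eqP s77 /allP sb us] /and3P[/eqP t77 /allP tb ut].
rewrite /is_perm size_map t77 eqxx /=; apply/andP; split.
  by apply/allP=> _ /mapP[i /tb i77 ->]; rewrite sb ?mem_nth ?s77.
rewrite map_inj_in_uniq // => i j /tb i77 /tb j77 /eqP.
by rewrite nth_uniq ?s77 // => /eqP.
Qed.

Lemma to_perm_compose s t : is_perm s -> is_perm t ->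
  to_perm (compose s t) = (to_perm t * to_perm s)%g.
Proof.
move=> sP tP; apply/permP=> x; apply: val_inj => /=.
rewrite to_permE ?is_perm_compose // permM to_permE // to_permE // (nth_map 0) //.
by case/and3P: tP => /eqP->.
Qed.

Lemma is_perm_id : is_perm (iota 0 77). Proof. by []. Qed.

Lemma to_perm_id : to_perm (iota 0 77) = 1%g.
Proof.
apply/permP=> x; apply: val_inj => /=.
by rewrite (to_permE _ is_perm_id) perm1 -[77]/(0 + 77) nth_iota.
Qed.

(** A bit sequence is stored in a binary tree addressed by the binary digits of
    the position, so that a set can be permuted with logarithmic access to its
    bits. *)
Inductive tree := Leaf | Node of bool & tree & tree.

Fixpoint get (t : tree) (p : positive) : bool :=
  match t, p with
  | Leaf, _ => false
  | Node b _ _, xH => b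
  | Node _ l _, xO q => get l q
  | Node _ _ r, xI q => get r q
  end.

(** Deals the entries alternately into two sequences: the subtrees hold the
    positions of either parity. *)
Fixpoint deal (s : bitseq) : bitseq * bitseq :=
  match s with
  | [::] => ([::], [::])
  | b :: t => let: (u, v) := deal t in (b :: v, u)
  end.

Fixpoint tree_of (n : nat) (s : bitseq) : tree :=
  match n, s with
  | n'.+1, b :: t => let: (u, v) := deal t in Node b (tree_of n' u) (tree_of n' v)
  | _, _ => Leaf
  end.

Lemma nth_deal s i : nth false (deal s).1 i = nth false s i.*2
  /\ nth false (deal s).2 i = nth false s i.*2.+1.
Proof.
elim: s i => [|b s IHs] i /=; first by rewrite !nth_nil.
case: (deal s) IHs => u v /= IHs; split; last by have [] := IHs i.
by case: i => [|i] //=; have [] := IHs i.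
Qed.

Lemma get_tree_of n s p : Pos.to_nat p < 2 ^ n ->
  get (tree_of n s) p = nth false s (Pos.to_nat p).-1.
Proof.
elim: n s p => [|n IHn] [|b s] p; rewrite ?nth_nil //.
  by rewrite expn0 ltnS leqn0; have := Pos2Nat.is_pos p; case: Pos.to_nat => // /ltP.
rewrite expnS mul2n /=; have := nth_deal s; case: (deal s) => u v /= uv.
have pos q : exists k, Pos.to_nat q = k.+1.
  by have := Pos2Nat.is_pos q; case: Pos.to_nat => [/ltP|k]; last exists k.
case: p => [q|q|] //; rewrite ?Pos2Nat.inj_xI ?Pos2Nat.inj_xO.
- rewrite multE mul2n => q2; rewrite IHn; last first.
    by rewrite -ltn_double; apply: leq_ltn_trans q2.
  by have [k ->] := pos q; have [_ ->] := uv k.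
- rewrite multE mul2n => q2; rewrite IHn; last by rewrite -ltn_double.
  by have [k ->] := pos q; have [-> _] := uv k.
Qed.

(** Entry [i] of a sequence is stored at the address [i + 1]. *)
Definition paths (s : seq nat) := [seq Pos.of_succ_nat i | i <- s].

(** The preimage of a set under a permutation, which only reads bits; for
    computing orbits it is as good as the image. *)
Definition pull (ps : seq positive) (p : positive) : positive :=
  let t := tree_of 7 (bits p) in of_bits [seq get t q | q <- ps].

Lemma size_pull s p : is_perm s -> size (bits (pull (paths s) p)) = 77.
Proof. by case/and3P=> /eqP s77 _ _; rewrite of_bitsK !size_map. Qed.

Lemma pull_pset s p : is_perm s -> size (bits p) = 77 ->
  pset (pull (paths s) p) = to_perm s @^-1: pset p.
Proof.
move=> sP p77; apply/setP=> x; rewrite !inE to_permE // /pull of_bitsK.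
have x77 : x < size s by case/and3P: sP => /eqP->.
rewrite (nth_map xH) ?size_map // (nth_map 0) // get_tree_of SuccNat2Pos.id_succ //.
case/and3P: sP => _ /allP/(_ (nth 0 s x)) lt77 _.
by apply: leq_ltn_trans (lt77 _) _; rewrite ?mem_nth.
Qed.

(** * Orbits *)

(** The smallest set that contains given elements and is closed under given
    maps, by exhaustive search.  The first argument bounds the number of steps;
    the result is empty if it is too small. *)
Section Reach.
Variables (T : eqType) (fs : seq (T -> T)).

Definition push (seen todo : seq T) (y : T) :=
  if (y \in seen) || (y \in todo) then todo else y :: todo.

Fixpoint reach (n : nat) (todo seen : seq T) : seq T :=
  match n, todo with
  | _, [::] => seen
  | 0, _ => [::]
  | n'.+1, x :: todo' =>
      let seen' := x :: seen in
      reach n' (foldl (fun td f => push seen' td (f x)) todo' fs) seen'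
  end.

Lemma foldl_push seen todo x (gs : seq (T -> T)) :
  let td := foldl (fun td f => push seen td (f x)) todo gs in
  [/\ {subset todo <= td},
      (forall f, List.In f gs -> f x \in seen ++ td),
      (forall y, y \in td -> y \in todo \/ exists2 f, List.In f gs & y = f x)
    & uniq (seen ++ todo) -> uniq (seen ++ td)].
Proof.
elim: gs todo => [|f gs IHgs] todo /=; first by split=> // y; left.
have [sub fx mem un] := IHgs (push seen todo (f x)).
have sub' : {subset todo <= push seen todo (f x)}.
  by rewrite /push => y; case: ifP => // _ ytd; rewrite inE ytd orbT.
split=> [y /sub'/sub //|g [<-|/fx //]|y /mem[]|un_todo].
- have : f x \in seen ++ push seen todo (f x).
    by rewrite mem_cat /push; case: ifP => [/orP[->|->]|_]; rewrite ?orbT ?mem_head ?orbT.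
  by rewrite !mem_cat => /orP[->//|/sub ->]; rewrite orbT.
- rewrite /push; case: ifP => _; first by left.
  by rewrite inE => /predU1P[->|]; [right; exists f; [left|]|left].
- by case=> g gs_g ->; right; exists g => //; right.
apply: un; rewrite /push; case: ifP => // /norP[nseen ntodo].
by rewrite -[f x :: todo]cat1s uniq_catCA /= mem_cat negb_or nseen ntodo.
Qed.

(** Invariant: the images of all elements of [seen] are in [seen] or [todo]. *)
Lemma reachP n todo seen : reach n todo seen != [::] ->
  uniq (seen ++ todo) ->
  (forall x f, x \in seen -> List.In f fs -> f x \in seen ++ todo) ->
  [/\ uniq (reach n todo seen), {subset seen ++ todo <= reach n todo seen}
    & forall x f, x \in reach n todo seen -> List.In f fs ->
        f x \in reach n todo seen].
Proof.
elim: n todo seen => [|n IHn] [|x todo] seen //= nz un cl.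
- by rewrite cats0 in un cl *; split.
- by rewrite cats0 in un cl *; split.
have [sub fx mem un'] := foldl_push (x :: seen) todo x fs.
set td := foldl _ _ _ in sub fx mem un' nz *.
have perm_x : perm_eq (seen ++ x :: todo) (x :: seen ++ todo).
  by rewrite -cat1s perm_catCA.
have [|y f|-> sub' cl'] := IHn _ _ nz.
- by apply: un'; rewrite -(perm_uniq perm_x).
- rewrite inE => /predU1P[-> /fx //|/cl yf /yf].
  rewrite (perm_mem perm_x) inE !mem_cat inE.
  by case/or3P=> [->//|->|/sub ->]; rewrite ?orbT.
split=> // y; rewrite (perm_mem perm_x) inE mem_cat => yin; apply: sub'.
rewrite mem_cat inE; case/or3P: yin => [->//|->|/sub ->]; rewrite ?orbT //.
Qed.

Lemma reach_ind (A : T -> Prop) n todo seen :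
  (forall x f, A x -> List.In f fs -> A (f x)) ->
  (forall x, x \in seen ++ todo -> A x) ->
  forall x, x \in reach n todo seen -> A x.
Proof.
move=> Af; elim: n todo seen => [|n IHn] [|y todo] seen //= Ain.
- by rewrite cats0 in Ain.
- by rewrite cats0 in Ain.
apply: IHn => x; have [_ _ mem _] := foldl_push (y :: seen) todo y fs.
have Ay : A y by apply: Ain; rewrite mem_cat mem_head orbT.
rewrite mem_cat inE => /orP[/predU1P[->//|xs]|/mem[xt|[f fsf ->]]]; last exact: Af.
  by apply: Ain; rewrite mem_cat xs.
by apply: Ain; rewrite mem_cat inE xt !orbT.
Qed.
End Reach.

(** * Searching for automorphisms of a graph *)

Section Geometry.
Variable adj : rel 'I_77.

Definition graph_aut (g : {perm 'I_77}) := forall x y, adj (g x) (g y) = adj x y.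

(** The invariant that singles out the core of a system: the number of ordered
    pairs in [X] without a common neighbour in [X]. *)
Definition unlinked (X : {set 'I_77}) : nat :=
  \sum_(x in X) #|[set y in X | [forall z in X, ~~ (adj x z && adj y z)]]|.

Lemma unlinked_image (g : {perm 'I_77}) (X : {set 'I_77}) : graph_aut g ->
  unlinked (g @: X) = unlinked X.
Proof.
move=> gA; rewrite /unlinked big_imset /=; last by move=> x y _ _; apply: perm_inj.
apply: eq_bigr => x _; rewrite -[RHS](card_imset _ (@perm_inj _ g)).
apply: eq_card => y; apply/idP/imsetP=> [|[z]].
  case/setIdP=> /imsetP[z zX ->] /forallP al; exists z => //; apply/setIdP; split=> //.
  apply/forallP=> t; apply/implyP=> tX.
  by have := al (g t); rewrite imset_f //= !gA.
case/setIdP=> zX /forallP al ->; apply/setIdP; split; first exact: imset_f.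
apply/forallP=> t; apply/implyP=> /imsetP[u uX ->]; rewrite !gA.
by have := al u; rewrite uX.
Qed.

Variable nbr : seq positive.
Hypothesis size_nbr : size nbr = 77.
Hypothesis bits_nbr : forall x : 'I_77, size (bits (nth xH nbr x)) = 77.
Hypothesis nbrE : forall x y : 'I_77, nth false (bits (nth xH nbr x)) y = adj x y.

Fixpoint meet (u v : bitseq) : bool :=
  match u, v with
  | true :: u', true :: v' => true
  | _ :: u', _ :: v' => meet u' v'
  | _, _ => false
  end.

(** Only the 22 rows and columns of the adjacency matrix that belong to the set
    are kept, and pairs of rows are tested for a common entry. *)
Definition count_unlinked (p : positive) : nat :=
  let ns := [seq mask (bits p) (bits n) | n <- mask (bits p) nbr] in
  sumn [seq count (fun v => ~~ meet u v) ns | u <- ns].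

Lemma mask_nth (A : Type) (d : A) m (s : seq A) n : size m = n -> size s = n ->
  mask m s =
  map (fun i : 'I_n => nth d s i) (filter (fun i : 'I_n => nth false m i) (enum 'I_n)).
Proof.
move=> <- {n}; elim: m s => [|b m IHm] [|x s] //= => [_|[ss]].
  by rewrite enum_ord0.
rewrite enum_ordSl (IHm _ ss) /=; case: b => /=; rewrite filter_map -map_comp //.
Qed.

Lemma meet_mask m u v n : size m = n -> size u = n -> size v = n ->
  meet (mask m u) (mask m v) =
  [exists i : 'I_n, [&& nth false m i, nth false u i & nth false v i]].
Proof.
move=> <- {n}; elim: m u v => [|c m IHm] [|a u] [|b v] //=.
  by move=> _ _; apply/esym/existsP=> -[[]].
case=> su [sv]; have {}IHm := IHm u v su sv.
have -> : [exists i : 'I_(size m).+1,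
            [&& nth false (c :: m) i, nth false (a :: u) i & nth false (b :: v) i]] =
          [&& c, a & b] || meet (mask m u) (mask m v).
  rewrite IHm; apply/existsP/orP => [[i]|[cab|/existsP[i mi]]].
  - case: (unliftP ord0 i) => [j|] -> /=; last by left.
    by move=> mj; right; apply/existsP; exists j.
  - by exists ord0.
  - by exists (lift ord0 i).
by case: c => //=; case: a; case: b.
Qed.

Lemma count_unlinkedE p : size (bits p) = 77 -> count_unlinked p = unlinked (pset p).
Proof.
move=> p77; rewrite /count_unlinked sumnE !big_map (mask_nth xH p77 size_nbr).
rewrite big_map big_filter big_enum_cond /unlinked; apply: eq_big => [x|x px].
  by rewrite !inE.
rewrite !count_map count_filter -sum1_count -sum1_card big_enum_cond /=.
apply: eq_bigl => y /=; rewrite !inE (@meet_mask _ _ _ 77) ?bits_nbr // andbC.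
congr (_ && _); rewrite negb_exists; apply: eq_forallb => z.
by rewrite !inE !nbrE negb_and implybE.
Qed.

Definition weight (c : seq positive) (x y : 'I_77) :=
  count (fun P => (x \in pset P) && (y \in pset P)) c.

(** The initial colouring in the search; [c] will be the core. *)
Definition color (c : seq positive) (x : 'I_77) :=
  \sum_(y | adj x y) weight c x y ^ 2.

(** The incidence matrix of hexads and members of [c], by hexads: then
    [weight] is the size of an intersection of two columns. *)
Definition columns (c : seq positive) : seq bitseq :=
  foldr (fun P s => [seq u.1 :: u.2 | u <- zip (bits P) s]) (nseq 77 [::]) c.

Definition colors (c : seq positive) : seq positive :=
  let cs := map of_bits (columns c) in
  [seq Pos.of_succ_nat (sumn [seq cap 0 u.2 v ^ 2 | v <- mask (bits u.1) cs])
     | u <- zip nbr cs].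

Definition all_masks (c : seq positive) := all (fun P => size (bits P) == 77) c.

Lemma columnsE c : all_masks c -> size (columns c) = 77 /\
  forall x : 'I_77, nth [::] (columns c) x = [seq x \in pset P | P <- c].
Proof.
elim: c => [_|P c IHc /andP[/eqP P77 /IHc[sz IH]]].
  by split=> // x; rewrite nth_nseq if_same.
have szz : size (zip (bits P) (columns c)) = 77 by rewrite size_zip P77 sz.
split=> [|x] /=; first by rewrite size_map.
rewrite (nth_map (false, [::])) ?szz // nth_zip ?P77 ?sz // IH inE //.
Qed.

Lemma cap_map (T : Type) (c : seq T) (a b : T -> bool) :
  cap 0 (of_bits (map a c)) (of_bits (map b c)) = count (fun t => a t && b t) c.
Proof.
rewrite (@cap_sum (size c)) ?of_bitsK ?size_map // add0n.
elim: c => [|t c IHc] /=; first by rewrite big_ord0.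
by rewrite big_ord_recl /= IHc.
Qed.

Lemma size_colors c : all_masks c -> size (colors c) = 77.
Proof. by case/columnsE=> sz _; rewrite size_map size_zip size_map sz size_nbr. Qed.

Lemma colorsE c (x : 'I_77) : all_masks c -> nth xH (colors c) x = Pos.of_succ_nat (color c x).
Proof.
case/columnsE=> sz cE; have szm : size (map of_bits (columns c)) = 77 by rewrite size_map.
rewrite (nth_map (xH, xH)) ?size_zip ?szm ?size_nbr // nth_zip ?szm //=.
congr Pos.of_succ_nat; rewrite (mask_nth xH (bits_nbr x) szm) -map_comp sumnE big_map.
rewrite big_filter big_enum_cond /=; apply: eq_big => [y|y _]; first by rewrite nbrE.
by rewrite !(nth_map [::]) ?sz // !cE cap_map.
Qed.

(** Equality up to the order of the members, with multiplicities, which is what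
    counting members needs. *)
Definition moves (g : {perm 'I_77}) (c c' : seq positive) :=
  perm_eq [seq g @: pset P | P <- c] [seq pset P | P <- c'].

Lemma weight_moves (g : {perm 'I_77}) c c' x y : moves g c c' ->
  weight c' (g x) (g y) = weight c x y.
Proof.
move=> gcc'.
have countE (d : seq positive) u v : weight d u v =
    count (fun X : {set 'I_77} => (u \in X) && (v \in X)) (map pset d).
  by rewrite count_map.
rewrite countE -(seq.permP gcc') count_map; apply: eq_count => P /=.
by rewrite !(mem_imset _ _ (@perm_inj _ g)).
Qed.

Lemma color_moves g c c' x : graph_aut g -> moves g c c' ->
  color c' (g x) = color c x.
Proof.
move=> gA gcc'; rewrite /color (reindex_inj (@perm_inj _ g)) /=.
by apply: eq_big => [y|y _]; [apply: gA|rewrite (weight_moves _ _ gcc')].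
Qed.

(** A colouring is a list of binary numbers, one for each hexad; it is refined
    with respect to a set by appending the bit of membership. *)
Fixpoint ext (k : seq positive) (r : bitseq) : seq positive :=
  match k, r with
  | a :: k', true :: r' => xI a :: ext k' r'
  | a :: k', false :: r' => xO a :: ext k' r'
  | _, _ => [::]
  end.

Lemma size_ext k r : size r = size k -> size (ext k r) = size k.
Proof. by elim: k r => [|a k IHk] [|[] r] //= [/IHk->]. Qed.

Lemma nth_ext k r i : size r = size k -> i < size k ->
  nth xH (ext k r) i = (if nth false r i then xI else xO) (nth xH k i).
Proof. by elim: k r i => [|a k IHk] [|[] r] [|i] //= [/IHk IH] /IH. Qed.

Definition odd_half p := if p is xI q then Some q else None.
Definition even_half p := if p is xO q then Some q else None.

(** Equality of two multisets of colours, compared digit by digit as in radix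
    sorting.  When the bound [n] on the number of digits is exhausted the
    answer is positive, so that only a negative answer is informative. *)
Fixpoint balanced (n : nat) (s t : seq positive) : bool :=
  match n with
  | 0 => true
  | n'.+1 =>
      if size s == size t then
        if s is [::] then true else
        if balanced n' (pmap odd_half s) (pmap odd_half t)
        then balanced n' (pmap even_half s) (pmap even_half t) else false
      else false
  end.

Lemma balanced_perm n s t : perm_eq s t -> balanced n s t.
Proof.
elim: n s t => //= n IHn s t st; rewrite (perm_size st) eqxx.
by case: s st => // a s st; rewrite !IHn ?perm_pmap.
Qed.

Arguments balanced : simpl never.

(** A step of the search refines by a member of the core, [(true, i)], or by
    the neighbourhood of a hexad, [(false, x)]. *)
Definition picked (c : seq positive) (k : bool * nat) : positive :=
  nth xH (if k.1 then c else nbr) k.2.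

(** The colouring [kA] of the source is refined along a prescribed list of
    steps; on the target side all possible images of the set used in the step
    are tried.  When all colours are distinct, a hexad goes to the hexad of its
    colour. *)
Fixpoint search (c c' : seq positive) (ks : seq (bool * nat)) (kA kB : seq positive)
    : seq (seq nat) :=
  match ks with
  | [::] => [:: [seq index a kB | a <- kA]]
  | k :: ks' =>
      let kA' := ext kA (bits (picked c k)) in
      let a := nth xH kA k.2 in
      flatten [seq (let kB' := ext kB (bits q) in
                    if balanced 64 kA' kB' then search c c' ks' kA' kB' else [::])
              | q <- if k.1 then c' else mask [seq b == a | b <- kB] nbr]
  end.

(** The invariant of the search: the automorphism that is looked for respects
    the two colourings. *)
Definition follow (g : {perm 'I_77}) (kA kB : seq positive) :=
  [/\ size kA = 77, size kB = 77 & forall x : 'I_77, nth xH kB (g x) = nth xH kA x].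

Lemma follow_perm g kA kB : follow g kA kB -> perm_eq kA kB.
Proof.
case=> sA sB kAB.
have listE (k : seq positive) : size k = 77 -> k = [seq nth xH k x | x : 'I_77 <- enum 'I_77].
  by move=> s77; rewrite -[LHS](mkseq_nth xH) s77 /mkseq -val_enum_ord -map_comp.
rewrite (listE _ sA) (listE _ sB); under eq_map do rewrite -kAB.
rewrite (map_comp (fun x : 'I_77 => nth xH kB x) g).
apply/perm_map/uniq_perm; rewrite ?enum_uniq //.
  by rewrite (map_inj_uniq (@perm_inj _ g)) enum_uniq.
by move=> y; rewrite mem_enum -[y](permKV g) map_f ?mem_enum.
Qed.

Lemma follow_ext g kA kB p q : follow g kA kB ->
  size (bits p) = 77 -> size (bits q) = 77 -> pset q = g @: pset p ->
  follow g (ext kA (bits p)) (ext kB (bits q)).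
Proof.
case=> sA sB kAB p77 q77 pq; split; rewrite ?size_ext ?p77 ?q77 // => x.
have := mem_imset (pset p) x (@perm_inj _ g); rewrite -pq !inE => pqx.
by rewrite !nth_ext ?sA ?sB ?p77 ?q77 // kAB pqx.
Qed.

Lemma pset_nbr (x : 'I_77) : pset (nth xH nbr x) = [set y | adj x y] :> {set 'I_77}.
Proof. by apply/setP=> y; rewrite !inE nbrE. Qed.

Definition valid_key (c : seq positive) (k : bool * nat) :=
  if k.1 then k.2 < size c else k.2 < 77.

Definition final (c : seq positive) ks kA :=
  foldl (fun a k => ext a (bits (picked c k))) kA ks.

(** At each step the branch that uses the true image of the set survives, since
    equal colourings up to a permutation are balanced. *)
Lemma searchP g c c' ks kA kB : graph_aut g -> all_masks c -> all_masks c' ->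
  moves g c c' -> all (valid_key c) ks -> follow g kA kB -> uniq (final c ks kA) ->
  [seq val (g x) | x <- enum 'I_77] \in search c c' ks kA kB.
Proof.
move=> gA cwf c'all_masks gcc'; elim: ks kA kB => [|k ks IHks] kA kB /=.
  move=> _ fAB uA; rewrite inE; apply/eqP; have [sA sB kAB] := fAB.
  have uB : uniq kB by rewrite -(perm_uniq (follow_perm fAB)).
  have sz : size [seq val (g x) | x <- enum 'I_77] = 77 by rewrite size_map size_enum_ord.
  apply: (@eq_from_nth _ 0) => [|i]; rewrite sz; first by rewrite size_map sA.
  move=> i77.
  rewrite (nth_map xH) ?sA // (nth_map (Ordinal i77)) ?size_enum_ord //.
  have -> : nth (Ordinal i77) (enum 'I_77) i = Ordinal i77.
    exact: (nth_ord_enum _ (Ordinal i77)).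
  rewrite -(kAB (Ordinal i77)) index_uniq ?sB //.
case/andP=> kv ksv fAB uf.
have [q qin [p77 q77 gpq]] : exists2 q, q \in (if k.1 then c' else
    mask [seq b == nth xH kA k.2 | b <- kB] nbr) &
    [/\ size (bits (picked c k)) = 77, size (bits q) = 77 & pset q = g @: pset (picked c k)].
  rewrite /picked; move: kv; rewrite /valid_key; case: k.1 => [kc|k77].
    have Pc := mem_nth xH kc; set P := nth _ _ _ in Pc *.
    have : g @: pset P \in [seq pset P | P <- c'].
      by rewrite -(perm_mem gcc'); apply: map_f.
    case/mapP=> q qc' qE; exists q => //.
    by rewrite (eqP (allP cwf _ Pc)) (eqP (allP c'all_masks _ qc')).
  have [sA sB kAB] := fAB; pose x := Ordinal k77; exists (nth xH nbr (g x)).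
    rewrite (@mask_nth _ xH _ _ 77) ?size_map //.
    apply/mapP; exists (g x) => //; rewrite mem_filter mem_enum andbT.
    by rewrite (nth_map xH) ?sB //= (kAB x).
  have nk : pset (nth xH nbr k.2) = [set y | adj x y] := pset_nbr x.
  rewrite (bits_nbr x) bits_nbr nk pset_nbr; split=> //; apply/setP=> y.
  by rewrite -[y](permKV g) (mem_imset _ _ (@perm_inj _ g)) !inE gA.
have fe := follow_ext fAB p77 q77 gpq.
apply/flattenP; exists (search c c' ks (ext kA (bits (picked c k))) (ext kB (bits q))).
  by apply/mapP; exists q; last rewrite (balanced_perm _ (follow_perm fe)).
exact: IHks.
Qed.
End Geometry.

(** * Hexads and residual systems *)

Definition sets (s : seq positive) : {set {set 'I_77}} := [set X in map pset s].

Lemma pset_inj (p q : positive) : size (bits p) = 77 -> size (bits q) = 77 ->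
  pset p = pset q -> p = q.
Proof.
move=> p77 q77 pq; apply: (can_inj bitsK); apply: (@eq_from_nth _ false).
  by rewrite p77.
move=> i; rewrite p77 => i77.
by have /setP/(_ (Ordinal i77)) := pq; rewrite !inE.
Qed.

Lemma uniq_psets c : all_masks c -> uniq c -> uniq (map pset c).
Proof.
move=> cwf uc; rewrite map_inj_in_uniq // => p q pc qc.
by apply: pset_inj; apply/eqP; [apply: (allP cwf)|apply: (allP cwf)].
Qed.

Lemma mem_sets p c : all_masks c -> size (bits p) = 77 -> (pset p \in sets c) = (p \in c).
Proof.
move=> cwf p77; rewrite inE; apply/mapP/idP=> [[q qc pq]|pc]; last by exists p.
by rewrite (pset_inj p77 _ pq) //; apply/eqP/(allP cwf).
Qed.

Lemma moves_sets (g : {perm 'I_77}) c c' : uniq (map pset c) -> uniq (map pset c') ->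
  image_blocks g (sets c) = sets c' -> moves g c c'.
Proof.
move=> uc uc' gcc'; apply: uniq_perm => //.
  rewrite (map_comp (fun X : {set 'I_77} => g @: X)) map_inj_uniq //.
  exact/imset_inj/perm_inj.
move=> X; have -> : (X \in map pset c') = (X \in image_blocks g (sets c)).
  by rewrite gcc' inE.
apply/mapP/imsetP=> [[p pc ->]|[Y]].
  by exists (pset p); rewrite // inE map_f.
by rewrite inE => /mapP[p pc ->] ->; exists p.
Qed.

Lemma imset_permM (T : finType) (g h : {perm T}) (X : {set T}) :
  (g * h)%g @: X = h @: (g @: X).
Proof. by rewrite -imset_comp; apply: eq_imset => x; rewrite permM. Qed.

Lemma imset_perm1 (T : finType) (X : {set T}) : (1%g : {perm T}) @: X = X.
Proof. by rewrite -[RHS]imset_id; apply: eq_imset => x; rewrite perm1. Qed.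

Lemma imset_preim_perm (T : finType) (g : {perm T}) (X : {set T}) : g @: (g @^-1: X) = X.
Proof.
by apply/setP=> x; rewrite -[x](permKV g) (mem_imset _ _ (@perm_inj _ g)) inE.
Qed.

Lemma image_blocksM (T : finType) (g h : {perm T}) D :
  image_blocks (g * h)%g D = image_blocks h (image_blocks g D).
Proof.
by rewrite /image_blocks -imset_comp; apply: eq_imset => X /=; apply: imset_permM.
Qed.

Lemma image_blocks1 (T : finType) (D : {set {set T}}) :
  image_blocks (1%g : {perm T}) D = D.
Proof. by rewrite /image_blocks -[RHS]imset_id; apply: eq_imset => X; apply: imset_perm1. Qed.

Lemma image_blocksK (T : finType) (g : {perm T}) D D' :
  image_blocks g D = D' -> image_blocks g^-1%g D' = D.
Proof.
by move=> <-; rewrite -image_blocksM mulgV image_blocks1.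
Qed.

Lemma mem_image_blocks (T : finType) (g : {perm T}) (X : {set T}) D :
  (g @: X \in image_blocks g D) = (X \in D).
Proof. by rewrite (mem_imset D X (imset_inj (@perm_inj _ g))). Qed.

Lemma in_image_blocks (T : finType) (g : {perm T}) (Y : {set T}) D :
  (Y \in image_blocks g D) = (g @^-1: Y \in D).
Proof.
by rewrite -(mem_image_blocks g (g @^-1: Y) D) imset_preim_perm.
Qed.

(** Taking preimages is injective, so a finite system that is mapped into
    itself is mapped onto itself. *)
Lemma aut_of_preimage g s : is_perm g -> all_masks s ->
  all (fun p => pull (paths g) p \in s) s -> to_perm g \in design_aut (sets s).
Proof.
move=> gP swf /allP gs; rewrite inE eq_sym eqEcard.
rewrite (card_imset _ (imset_inj (@perm_inj _ (to_perm g)))) leqnn andbT.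
apply/subsetP=> X; rewrite inE => /mapP[p ps ->].
rewrite in_image_blocks -pull_pset //; last exact/eqP/(allP swf).
by rewrite inE map_f ?gs.
Qed.

Section Hexads.
Variables stars nbr : seq positive.

(** Two hexads that are joined share a point of the Steiner system, hence lie
    in a common star; otherwise they are disjoint and adjacent in the graph. *)
Definition joined (x y : nat) :=
  has (fun S => nth false (bits S) x && nth false (bits S) y) stars.

Definition disjoint_hexads (x y : 'I_77) := ~~ joined x y.

Local Notation adj := disjoint_hexads.

Definition neighbours :=
  mkseq (fun x => of_bits (mkseq (fun y => ~~ joined x y) 77)) 77.

(** The properties of the Steiner system that are used.  The hexads 0, 1 and 49
    witness that both intersection numbers of the designs occur. *)
Definition stars_ok := [&& size stars == 22, uniq stars, all_masks stars,
   all (fun S => all (fun S' => cap 0 S S' == if S == S' then 21 else 5) stars) stars,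
   ~~ joined 0 49, joined 0 1 &
   all (fun x => all (fun y =>
     count (fun S => nth false (bits S) x && nth false (bits S) y) stars ==
     (if x == y then 6 else if joined x y then 2 else 0)) (iota 0 77)) (iota 0 77)].

Hypothesis starsP : stars_ok.
Hypothesis nbrP : nbr = neighbours.

Lemma size_nbr : size nbr = 77. Proof. by rewrite nbrP size_mkseq. Qed.

Lemma bits_nbr (x : 'I_77) : size (bits (nth xH nbr x)) = 77.
Proof. by rewrite nbrP nth_mkseq // of_bitsK size_mkseq. Qed.

Lemma nbrE (x y : 'I_77) : nth false (bits (nth xH nbr x)) y = adj x y.
Proof. by rewrite nbrP nth_mkseq // of_bitsK nth_mkseq. Qed.

Lemma star_aut g : g \in design_aut (sets stars) -> graph_aut adj g.
Proof.
rewrite inE => /eqP gS x y; congr (~~ _).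
have joinedE (u v : 'I_77) : joined u v = [exists X in sets stars, (u \in X) && (v \in X)].
  apply/hasP/existsP=> [[S SS uv]|[X]].
    by exists (pset S); rewrite !inE map_f.
  by rewrite inE => /andP[/mapP[S SS ->]]; rewrite !inE => uv; exists S.
rewrite !joinedE; apply/existsP/existsP=> -[X /andP[XS xyX]]; last first.
  exists (g @: X); rewrite -gS mem_image_blocks XS /=.
  by rewrite !(mem_imset _ _ (@perm_inj _ g)).
by rewrite -gS in_image_blocks in XS; exists (g @^-1: X); rewrite XS !inE.
Qed.

(** The dual description of the residual designs. *)
Definition residual (s : seq positive) := [/\ all_masks s, uniq s, size s = 56,
  (forall P, P \in s -> #|pset P| = 22 /\ forall S, S \in stars -> #|pset P :&: pset S| = 6)
  & (forall P Q, P \in s -> Q \in s -> P != Q -> #|pset P :&: pset Q| = 6)].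

Lemma card_count (T : Type) (x0 : T) n (s : seq T) (A : pred T) : size s = n ->
  #|[set i : 'I_n | A (nth x0 s i)]| = count A s.
Proof.
move=> <-; rewrite -sum1_card -sum1_count (big_nth x0) big_mkord.
by apply: eq_bigl => i; rewrite inE.
Qed.

(** Subtracting from the entries of [N^T N] the contribution of the stars: a
    hexad has 6 points, and two hexads share 2 points or none. *)
Lemma residual_count s (x y : 'I_77) : residual s ->
  count (fun P => (x \in pset P) && (y \in pset P)) s =
  if x == y then 16 else if adj x y then 6 else 4.
Proof.
case=> swf us s56 sS sI; have /and5P[/eqP S22 uS Swf /allP SI /and3P[_ _ /allP Sxy]] := starsP.
have memS (p : 'I_22) : nth xH stars p \in stars by rewrite mem_nth ?S22.
have mems (i : 'I_56) : nth xH s i \in s by rewrite mem_nth ?s56.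
have Scap (p q : 'I_22) : #|pset (nth xH stars p) :&: pset (nth xH stars q)| = if p == q then 21 else 5.
  rewrite -cap_pset; last exact/eqP/(allP Swf).
  by have /allP/(_ _ (memS q))/eqP-> := SI _ (memS p); rewrite nth_uniq ?S22.
have := @residual_dual (fun p => pset (nth xH stars p)) (fun i => pset (nth xH s i)).
move=> /(_ _ _ _ _ _ x y); rewrite !(@card_count _ xH _ _ (fun P => (x \in pset P) && (y \in pset P))) //.
have -> : count (fun P => (x \in pset P) && (y \in pset P)) stars =
          if x == y then 6 else if adj x y then 0 else 2.
  have /Sxy/allP/(_ (val y)) : val x \in iota 0 77 by rewrite mem_iota ltn_ord.
  rewrite mem_iota ltn_ord => /(_ isT)/eqP; rewrite /disjoint_hexads if_neg => <-.
  by apply: eq_count => P; rewrite !inE.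
move=> dual; apply/eqP; rewrite -(eqn_add2r (if x == y then 6 else if adj x y then 0 else 2)).
rewrite dual; first by case: (x == y); case: (adj x y).
- by move=> p; have := Scap p p; rewrite setIid eqxx.
- by move=> p q pq; rewrite Scap (negPf pq).
- by move=> i; case: (sS _ (mems i)).
- by move=> i j ij; apply: sI => //; rewrite nth_uniq ?s56.
- by move=> i p; case: (sS _ (mems i)) => _; apply.
Qed.

End Hexads.

(** * The design of a residual system *)

Section Residual.
Variables stars : seq positive.
Hypothesis starsP : stars_ok stars.
Local Notation adj := (disjoint_hexads stars).

Definition design (s : seq positive) : {set {set 'I_56}} :=
  blocks (fun (i : 'I_56) (x : 'I_77) => x \in pset (nth xH s i)).

Lemma card_meet s x y : residual stars s ->
  #|[set i : 'I_56 | x \in pset (nth xH s i)] :&: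
    [set i : 'I_56 | y \in pset (nth xH s i)]| =
  if x == y then 16 else if adj x y then 6 else 4.
Proof.
move=> sR; rewrite -(residual_count starsP _ _ sR).
have [_ _ s56 _ _] := sR; rewrite -(card_count xH _ s56).
by apply: eq_card => i; rewrite !inE.
Qed.

Lemma distinct_points s : residual stars s ->
  distinct_blocks (fun (i : 'I_56) (x : 'I_77) => x \in pset (nth xH s i)).
Proof.
move=> sR x y /= xy; apply/eqP; have := card_meet x y sR.
rewrite -xy (card_meet x x sR) eqxx.
by case: eqP => // _; case: (adj x y).
Qed.

Lemma distinct_hexads s : residual stars s ->
  distinct_blocks (fun (x : 'I_77) (i : 'I_56) => x \in pset (nth xH s i)).
Proof.
case=> swf us s56 sS sI i j; rewrite /= => ij.
have mems (k : 'I_56) : nth xH s k \in s by rewrite mem_nth ?s56.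
have setE (k : 'I_56) : [set x | x \in pset (nth xH s k)] = pset (nth xH s k).
  by apply/setP=> x; rewrite !inE.
have lts (k : 'I_56) : k < size s by rewrite s56.
apply/val_inj/eqP; rewrite -(nth_uniq xH (lts i) (lts j) us); apply: contraT => ne.
have := sI _ _ (mems i) (mems j) ne.
have -> : pset (nth xH s i) = pset (nth xH s j) by rewrite -(setE i) -(setE j).
by rewrite setIid; have [-> _] := sS _ (mems j).
Qed.

Lemma design_dual s : residual stars s ->
  blocks (fun (x : 'I_77) (i : 'I_56) => x \in pset (nth xH s i)) = sets s.
Proof.
case=> swf us s56 sS sI; have setE (p : positive) : [set x | x \in pset p] = pset p.
  by apply/setP=> x; rewrite !inE.
apply/setP=> X; rewrite inE; apply/imsetP/mapP=> [[i _ ->]|[p ps ->]].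
  by exists (nth xH s i); rewrite ?setE // mem_nth ?s56.
have i56 : index p s < 56 by rewrite -s56 index_mem.
by exists (Ordinal i56) => //; rewrite setE nth_index.
Qed.

Lemma residual_design s : residual stars s ->
  is_design 56 16 6 (design s) /\ quasi_symmetric 4 6 (design s).
Proof.
move=> sR; have injB := distinct_points sR; have card_eq := card_meet _ _ sR.
have [_ us s56 sS sI] := sR.
pose B (x : 'I_77) := [set i : 'I_56 | x \in pset (nth xH s i)].
have BP x : B x \in design s by apply: imset_f.
have injBB : injective B := injB.
split; split=> //.
- by rewrite card_ord.
- by move=> _ /imsetP[x _ ->]; have := card_eq x x; rewrite setIid eqxx.
- move=> i j ij; have mems (k : 'I_56) : nth xH s k \in s by rewrite mem_nth ?s56.
  have lts (k : 'I_56) : k < size s by rewrite s56.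
  apply: etrans (sI _ _ (mems i) (mems j) _); last by rewrite (nth_uniq xH (lts i) (lts j) us).
  rewrite -(card_imset _ injBB); apply: eq_card => Y; rewrite inE.
  apply/andP/imsetP=> [[/imsetP[x _ ->]]|[x]]; first by rewrite !inE => xij; exists x; rewrite ?inE.
  rewrite inE => /andP[xi xj] ->; rewrite BP !inE; split=> //.
  by move: xi xj; rewrite !inE => -> ->.
- move=> _ _ /imsetP[x _ ->] /imsetP[y _ ->]; have [-> /eqP//|xy _] := eqVneq x y.
  by rewrite (card_eq x y) (negPf xy); case: (adj x y); [right|left].
- have /and5P[_ _ _ _ /and3P[_ j _]] := starsP.
  have ne : inord 0 != inord 1 :> 'I_77 by rewrite -(inj_eq val_inj) /= !inordK.
  have a : adj (inord 0) (inord 1) = false by rewrite /disjoint_hexads !inordK // j.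
  by exists (B (inord 0)), (B (inord 1)); rewrite !BP (inj_eq injBB) ne card_eq (negPf ne) a.
have /and5P[_ _ _ _ /and3P[j _ _]] := starsP.
have ne : inord 0 != inord 49 :> 'I_77 by rewrite -(inj_eq val_inj) /= !inordK.
have a : adj (inord 0) (inord 49) by rewrite /disjoint_hexads !inordK // j.
by exists (B (inord 0)), (B (inord 49)); rewrite !BP (inj_eq injBB) ne card_eq (negPf ne) a.
Qed.

Lemma residual_aut s : residual stars s ->
  #|design_aut (design s)| = #|design_aut (sets s)|.
Proof.
move=> sR; rewrite -(design_dual sR) card_design_aut_dual //.
  exact: distinct_points.
exact: distinct_hexads.
Qed.

Lemma residual_isomorphic s s' : residual stars s -> residual stars s' ->
  isomorphic (design s) (design s') ->
  exists g : {perm 'I_77}, image_blocks g (sets s) = sets s'.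
Proof.
move=> sR s'R /(isomorphic_dual (distinct_points sR))[g].
by rewrite !design_dual //; exists g.
Qed.

Lemma residual_moves (g : {perm 'I_77}) s s' : residual stars s -> residual stars s' ->
  image_blocks g (sets s) = sets s' -> moves g s s'.
Proof.
by case=> ? ? _ _ _ [? ? _ _ _]; apply: moves_sets; apply: uniq_psets.
Qed.

(** By [residual_count] two hexads are adjacent if and only if 6 members of the
    system contain both. *)
Lemma residual_graph_aut (g : {perm 'I_77}) s s' : residual stars s -> residual stars s' ->
  image_blocks g (sets s) = sets s' -> graph_aut adj g.
Proof.
move=> sR s'R gss' x y; have [->|xy] := eqVneq x y.
  have diag (z : 'I_77) : adj z z = false.
    apply: contraTF isT => nz; have := residual_count starsP z z sR.
    have /and5P[_ _ _ _ /and3P[_ _ /allP/(_ (val z))]] := starsP.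
    rewrite mem_iota ltn_ord => /(_ isT)/allP/(_ (val z)); rewrite mem_iota ltn_ord => /(_ isT).
    rewrite eqxx; case E: (count _ _) => [|n] // _ _; move: nz; rewrite /disjoint_hexads /joined => /hasPn nz.
    by move: E; rewrite (eq_in_count (a2 := pred0)) ?count_pred0 // => S /nz/negPf.
  by rewrite !diag.
have := weight_moves x y (residual_moves sR s'R gss').
have gxy : g x != g y by rewrite (inj_eq perm_inj).
rewrite /weight (residual_count starsP _ _ s'R) (residual_count starsP _ _ sR).
by rewrite (negPf xy) (negPf gxy); do 2 case: adj.
Qed.
End Residual.

(** * Batches of systems *)

(** A finite map from sets to labels of orbits.  No property of [insert] is ever
    needed: the checks compare the values of [lookup] with what they should
    be. *)
Inductive trie := Tip | Fork of option nat & trie & trie.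

Fixpoint lookup (t : trie) (p : positive) : option nat :=
  match t, p with
  | Tip, _ => None
  | Fork o _ _, xH => o
  | Fork _ l _, xO q => lookup l q
  | Fork _ _ r, xI q => lookup r q
  end.

Fixpoint insert (p : positive) (a : nat) (t : trie) : trie :=
  let: (o, l, r) := if t is Fork o l r then (o, l, r) else (None, Tip, Tip) in
  match p with
  | xH => Fork (Some a) l r
  | xO q => Fork o (insert q a l) r
  | xI q => Fork o l (insert q a r)
  end.

(** Evaluates no more of the composite of [t] and [g] than is needed to find a
    difference. *)
Fixpoint agree (l t g : seq nat) : bool :=
  match l, g with
  | x :: l', y :: g' => if x == nth 0 t y then agree l' t g' else false
  | [::], [::] => true
  | _, _ => false
  end.

Lemma agreeE l t g : agree l t g = (l == compose t g).
Proof. by elim: l g => [|x l IHl] [|y g] //=; rewrite eqseq_cons IHl; case: eqP. Qed.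

Definition covered (ws ts : seq (seq nat)) l := has (fun t => has (agree l t) ws) ts.

(** Extends [ts] to a list of representatives of the cosets that meet [ls],
    where [ws] lists the group. *)
Fixpoint cosets (ws ts ls : seq (seq nat)) :=
  if ls is l :: ls' then cosets ws (if covered ws ts l then ts else l :: ts) ls'
  else ts.

Lemma cosets_sub ws ts ls : {subset ts <= cosets ws ts ls}.
Proof.
elim: ls ts => [|l ls IHls] ts t tts //=; apply: IHls.
by case: ifP => // _; rewrite inE tts orbT.
Qed.

Lemma covered_sub ws ts ts' l : {subset ts <= ts'} -> covered ws ts l -> covered ws ts' l.
Proof. by move=> sub /hasP[t /sub tts' tl]; apply/hasP; exists t. Qed.

Lemma cosetsP ws ts ls l : iota 0 77 \in ws -> size l = 77 -> l \in ls ->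
  covered ws (cosets ws ts ls) l.
Proof.
move=> id_ws l77; elim: ls ts => //= l' ls IHls ts; rewrite inE => /predU1P[<-|/IHls//].
apply: (@covered_sub _ (if covered ws ts l then ts else l :: ts)).
  exact: cosets_sub.
case: ifP => // _; apply/hasP; exists l; rewrite ?mem_head //; apply/hasP; exists (iota 0 77) => //.
rewrite agreeE; apply/eqP; rewrite -l77; exact/esym/(mkseq_nth 0 l).
Qed.

(** In a finite group every element of a generated subgroup is a product of
    generators, without inverses. *)
Lemma gen_sub (gT : finGroupType) (A S : {set gT}) : (1 \in S)%g ->
  (forall x a, x \in S -> a \in A -> (x * a)%g \in S) -> <<A>>%g \subset S.
Proof.
move=> S1 SA; apply/subsetP=> _ /gen_prodgP[n [c Ac ->]].
elim: n c Ac => [|n IHn] c Ac; first by rewrite big_ord0.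
by rewrite big_ord_recr /=; apply: SA => //; apply: IHn.
Qed.

(** The orbits are numbered by the position of their representatives; the first
    [ncore] of them form the core, and [tau] is the value of [unlinked] on it.
    A system is listed by its orbits outside the core.  The search uses the
    steps [keys], and refuting an automorphism uses the first [depth] members
    of an orbit. *)
Record batch := Batch {
  aut_order : nat; generators : seq (seq nat); ncore : nat; tau : nat;
  keys : seq (bool * nat); depth : nat; reps : seq positive;
  systems : seq (seq nat) }.

(** What is computed from a batch once and used in many checks.  Entry [(a, b)]
    of the matrix tells whether orbits [a] and [b] can occur together in a
    residual system. *)
Record table := Table {
  base :> batch; orbits : seq (seq positive); words : seq (seq nat);
  unlinked_counts : seq nat; index_trie : trie; matrix : seq (seq bool) }.

Section Families.
Variables stars nbr : seq positive.
Hypothesis starsP : stars_ok stars.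
Hypothesis nbrP : nbr = neighbours stars.
Local Notation adj := (disjoint_hexads stars).

(** The bound 200 on the steps exceeds the orders of all groups that occur, of
    which the largest is 168. *)
Definition tabulate f :=
  let ps := map paths (generators f) in
  let os := [seq reach (map pull ps) 200 [:: r] [::] | r <- reps f] in
  Table f os
    (reach (map compose (generators f)) 200 [:: iota 0 77] [::])
    [seq count_unlinked nbr r | r <- reps f]
    (foldl (fun t a => foldl (fun t p => insert p a t) t (nth [::] os a)) Tip
       (iota 0 (size os)))
    [seq [seq all (fun q => (q == r) || (cap 0 r q == 6)) o | o <- os] | r <- reps f].

Definition orb (t : table) a := nth [::] (orbits t) a.
Definition labels (f : batch) c := iota 0 (ncore f) ++ c.
Definition members (t : table) c := flatten (map (orb t) c).
Definition core (t : table) := members t (iota 0 (ncore t)).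

Definition first_key (t : table) := ext (colors nbr (core t)) (bits (nth xH (reps t) 0)).

(** The first step of the search uses a representative of the core.  Its image
    can be moved to a representative by the group of the target, so only the
    representatives have to be tried. *)
Definition leaves (t t' : table) :=
  let c := core t in let c' := core t' in
  let kA := first_key t in let kB := colors nbr c' in
  flatten [seq let kB' := ext kB (bits q) in
               if balanced 64 kA kB' then search nbr c c' (keys t) kA kB' else [::]
          | q <- take (ncore t') (reps t')].

(** [need] lists the labels of the orbits that are hit by the preimages of some
    members of a system of [t'].  A preimage in no orbit of [t], or in an orbit
    that does not belong to the system, shows that [g] does not carry the one
    system to the other. *)
Definition dead (t t' : table) g :=
  let ps := paths g in let d := maxn (depth t) (depth t') in
  let nd := [seq [seq lookup (index_trie t) (pull ps p) | p <- take d o] | o <- orbits t'] in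
  all (fun c' =>
    let need := flatten [seq nth [::] nd b | b <- c'] in
    if has (fun v => ~~ isSome v) need then true else
    all (fun c => has (fun v => if v is Some a then (ncore t <= a) && (a \notin c) else true) need)
      (systems t)) (systems t').

(** Every automorphism found by the search is in a coset of a member of [ts] or
    is refuted.  For one batch [ts] consists of the identity, for two different
    batches it is empty. *)
Definition spread ts (t t' : table) :=
  all (fun g => if g \in ts then true else is_perm g && dead t t' g)
    (cosets (words t) ts (leaves t t')).

(** The checks on a single batch: the group permutes the stars, the orbits
    consist of 22-sets meeting all stars in 6 hexads, they are disjoint, the
    core is where [unlinked] is [tau], the systems are residual, the group has
    the stated order, and the search finds nothing outside the group. *)
Definition good (t : table) :=
  [&& [&& all is_perm (generators t),
      all (fun g => all (fun S => pull (paths g) S \in stars) stars) (generators t),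
      all (fun o => o != [::]) (orbits t) &
      all (fun r => [&& size (bits r) == 77, cap 0 r r == 22 &
                     all (fun S => cap 0 r S == 6) stars]) (reps t)],
      [&& all (fun a => all (fun p => lookup (index_trie t) p == Some a) (orb t a))
          (iota 0 (size (reps t))),
      all (fun a => (nth 0 (unlinked_counts t) a == tau t) == (a < ncore t)) (iota 0 (size (reps t))),
      words t != [::] & size (words t) == aut_order t],
      [&& all (fun c => let l := labels t c in
             [&& sorted ltn l, all (fun a => a < size (reps t)) l,
                 sumn [seq size (orb t a) | a <- l] == 56 &
                 all (fun a => all (fun b => nth false (nth [::] (matrix t) a) b) l) l])
          (systems t), uniq (systems t),
          0 < ncore t <= size (reps t), all (valid_key (core t)) (keys t) &
          uniq (final nbr (core t) (keys t) (first_key t))] &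
      spread [:: iota 0 77] t t].

Definition unlinked_tally tau (t : table) c :=
  sumn [seq if nth 0 (unlinked_counts t) a == tau then size (orb t a) else 0 | a <- labels t c].

(** The number of members on which [unlinked] has the value [tau t]
    distinguishes the systems of [t] from those of [t']. *)
Definition differ (t t' : table) :=
  all (fun c => unlinked_tally (tau t) t' c != size (core t)) (systems t').

Definition apart (t t' : table) :=
  if aut_order t != aut_order t' then true else
  if differ t t' then true else if differ t' t then true else
  if tau t == tau t' then spread [::] t t' else false.

Section Good.
Variable f : batch.
Notation t := (tabulate f).
Hypothesis tP : good t.

Definition span : {group {perm 'I_77}} :=
  <<[set g in map to_perm (generators f)]>>%G.

Let gensP : all is_perm (generators f).
Proof. by case/and4P: tP => /and4P[]. Qed.

Let starsG : all (fun g => all (fun S => pull (paths g) S \in stars) stars) (generators f).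
Proof. by case/and4P: tP => /and4P[]. Qed.

Let repsP a : a < size (reps f) -> let r := nth xH (reps f) a in
  [/\ size (bits r) = 77, #|pset r| = 22 & forall S, S \in stars -> #|pset r :&: pset S| = 6].
Proof.
case/and4P: tP => /and4P[_ _ _ /allP ok] _ _ _ ar /=.
have /ok/and3P[/eqP r77 /eqP r22 /allP rS] := mem_nth xH ar.
rewrite cap_pset // setIid in r22; split=> // S /rS/eqP.
by rewrite cap_pset.
Qed.

Lemma span_gen g : g \in generators f -> to_perm g \in span.
Proof. by move=> gf; rewrite mem_gen // inE map_f. Qed.

Lemma span_aut D : (forall g, g \in generators f -> to_perm g \in design_aut D) ->
  span \subset design_aut D.
Proof.
by move=> gD; rewrite gen_subG; apply/subsetP=> _ /[!inE] /mapP[g /gD gd ->]; rewrite inE in gd.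
Qed.

Lemma span_graph_aut g : g \in span -> graph_aut adj g.
Proof.
move=> gG; apply: star_aut; apply: (subsetP (span_aut _)) gG => h hf.
have /and5P[_ _ swf _ _] := starsP.
by apply: aut_of_preimage => //; [apply: (allP gensP)|apply: (allP starsG)].
Qed.

Lemma orbE a : a < size (reps f) ->
  orb t a = reach (map pull (map paths (generators f))) 200 [:: nth xH (reps f) a] [::].
Proof. by move=> ar; rewrite /orb (nth_map xH). Qed.

Lemma orb_small a : size (reps f) <= a -> orb t a = [::].
Proof. by move=> ra; rewrite /orb nth_default ?size_map. Qed.

Lemma pull_gen h : List.In h (map pull (map paths (generators f))) ->
  exists2 g, g \in generators f & h = pull (paths g).
Proof.
elim: (generators f) => //= g gs IHgs [<-|/IHgs[g' g'gs ->]]; first by exists g; rewrite ?mem_head.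
by exists g'; rewrite // inE g'gs orbT.
Qed.

Lemma gen_pull g : g \in generators f ->
  List.In (pull (paths g)) (map pull (map paths (generators f))).
Proof.
elim: (generators f) => //= g' gs IHgs; rewrite inE => /predU1P[->|/IHgs]; first by left.
by right.
Qed.

(** Orbits are computed by taking preimages under generators, so a member is
    carried back to the representative by an element of the group. *)
Lemma orb_move a p : a < size (reps f) -> p \in orb t a ->
  size (bits p) = 77 /\ exists2 w, w \in span & w @: pset p = pset (nth xH (reps f) a).
Proof.
move=> ar; rewrite orbE //; move: p; apply: reach_ind.
  move=> p _ [p77 [w wG wp]] /pull_gen[g gf ->].
  have gP := allP gensP _ gf; rewrite size_pull //; split=> //.
  exists (to_perm g * w)%g; first by rewrite groupM ?span_gen.
  by rewrite pull_pset // imset_permM imset_preim_perm.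
move=> p; rewrite inE => /eqP ->; have [r77 _ _] := repsP ar; split=> //.
by exists 1%g; rewrite ?group1 ?imset_perm1.
Qed.

Lemma masks_orb a : all_masks (orb t a).
Proof.
apply/allP=> p; have [ar /(orb_move ar)[->]//|ra] := ltnP a (size (reps f)).
by rewrite orb_small.
Qed.

Lemma reach_orb a : a < size (reps f) -> [/\ uniq (orb t a), nth xH (reps f) a \in orb t a &
  forall p g, p \in orb t a -> g \in generators f -> pull (paths g) p \in orb t a].
Proof.
move=> ar; have /and4P[/and4P[_ _ /allP nz _] _ _ _] := tP.
have {nz} : orb t a != [::] by apply: nz; rewrite mem_nth ?size_map.
rewrite orbE // => /reachP[] // uo so co; split=> // [|p g po gf].
  by apply: so; rewrite mem_head.
by apply: co => //; apply: gen_pull.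
Qed.

Lemma span_orb a g : g \in span -> image_blocks g (sets (orb t a)) = sets (orb t a).
Proof.
move=> gG; apply/eqP; have [ar|ra] := ltnP a (size (reps f)); last first.
  have e : sets [::] = set0 by apply/setP=> X; rewrite !inE.
  by rewrite orb_small // e /image_blocks imset0.
suff /subsetP/(_ g gG) : span \subset design_aut (sets (orb t a)) by rewrite inE.
apply: span_aut => h hf; apply: aut_of_preimage; rewrite ?masks_orb //.
  exact: (allP gensP).
by apply/allP=> p po; have [_ _] := reach_orb ar; apply.
Qed.

(** The sizes are checked for representatives only; the group permutes the
    stars. *)
Lemma orb_meets a p : p \in orb t a -> #|pset p| = 22 /\
  forall S, S \in stars -> #|pset p :&: pset S| = 6.
Proof.
have [ar|/orb_small->//] := ltnP a (size (reps f)).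
move=> /(orb_move ar)[p77 [w wG wp]]; have [r77 r22 rS] := repsP ar.
have cardw (X : {set 'I_77}) : #|w @: X| = #|X| by apply/card_imset/perm_inj.
split=> [|S SS]; first by rewrite -cardw wp.
have : w @: pset S \in sets stars.
  have /subsetP/(_ w wG) : span \subset design_aut (sets stars).
    apply: span_aut => h hf; have /and5P[_ _ swf _ _] := starsP.
    by apply: aut_of_preimage => //; [apply: (allP gensP)|apply: (allP starsG)].
  by rewrite inE => /eqP {1}<-; rewrite mem_image_blocks inE map_f.
rewrite inE => /mapP[S' S'S wS]; apply: etrans (rS S' S'S); rewrite -wS -wp -cardw.
by rewrite imsetI // => x y _ _; apply: perm_inj.
Qed.

Lemma lookup_orb a p : p \in orb t a -> lookup (index_trie t) p = Some a.
Proof.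
have [ar po|/orb_small->//] := ltnP a (size (reps f)).
have /and4P[_ /and4P[/allP/(_ a) ok _ _ _] _ _] := tP.
by move: ok; rewrite mem_iota => /(_ ar)/allP/(_ p po)/eqP.
Qed.

Lemma orb_unlinked a p : p \in orb t a -> unlinked adj (pset p) = nth 0 (unlinked_counts t) a.
Proof.
have [ar|/orb_small->//] := ltnP a (size (reps f)).
move=> /(orb_move ar)[_ [w wG wp]]; have [r77 _ _] := repsP ar.
rewrite (nth_map xH) // (count_unlinkedE (size_nbr nbrP) (bits_nbr nbrP) (nbrE nbrP)) //.
by rewrite -wp unlinked_image //; apply: span_graph_aut.
Qed.

Lemma orb_in_core a p : p \in orb t a -> (unlinked adj (pset p) == tau f) = (a < ncore f).
Proof.
have [ar po|/orb_small->//] := ltnP a (size (reps f)).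
have /and4P[_ /and4P[_ /allP/(_ a) ok _ _] _ _] := tP.
by move: ok; rewrite mem_iota (orb_unlinked po) => /(_ ar)/eqP <-.
Qed.

Lemma mem_members l p : reflect (exists2 a, a \in l & p \in orb t a) (p \in members t l).
Proof. exact: flatten_mapP. Qed.

Lemma mem_sets_members l X : reflect (exists2 a, a \in l & X \in sets (orb t a))
  (X \in sets (members t l)).
Proof.
rewrite inE; apply: (iffP mapP) => [[p /mem_members[a al po] ->]|[a al]].
  by exists a; rewrite // inE map_f.
by rewrite inE => /mapP[p po ->]; exists p => //; apply/mem_members; exists a.
Qed.

Lemma span_members l g : g \in span ->
  image_blocks g (sets (members t l)) = sets (members t l).
Proof.
move=> gG; apply/setP=> X; rewrite in_image_blocks.
have orbX a : (g @^-1: X \in sets (orb t a)) = (X \in sets (orb t a)).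
  by rewrite -in_image_blocks span_orb.
by apply/mem_sets_members/mem_sets_members=> -[a al Xa]; exists a; rewrite // ?orbX // -orbX.
Qed.

Lemma masks_members l : all_masks (members t l).
Proof. by apply/allP=> p /mem_members[a _]; apply: (allP (masks_orb a)). Qed.

Lemma system_labels c : c \in systems f -> let l := labels f c in
  [/\ sorted ltn l, {in l, forall a, a < size (reps f)},
      sumn [seq size (orb t a) | a <- l] = 56 &
      {in l &, forall a b, nth false (nth [::] (matrix t) a) b}].
Proof.
move=> cf; have /and4P[_ _ /and5P[/allP/(_ c cf)/and4P[sl /allP lr /eqP l56 /allP lm] _ _ _ _] _] := tP.
by split=> // a b al bl; apply: (allP (lm a al)).
Qed.

Definition system c := members t (labels f c).

Lemma mem_system c p : size (bits p) = 77 -> (pset p \in sets (system c)) = (p \in system c).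
Proof. exact/mem_sets/masks_members. Qed.

Lemma uniq_members l : uniq l -> {in l, forall a, a < size (reps f)} -> uniq (members t l).
Proof.
elim: l => //= a l IHl /andP[al ul] lr; rewrite cat_uniq IHl // ?andbT; last first.
  by move=> b bl; apply: lr; rewrite inE bl orbT.
have [-> _ _] := reach_orb (lr a (mem_head _ _)); apply/hasPn=> p /mem_members[b bl pb].
apply/negP=> pa; have := lookup_orb pa; rewrite (lookup_orb pb) => -[ba].
by rewrite -ba bl in al.
Qed.

(** The first of two members can be moved to the representative of its orbit,
    where the compatibility matrix applies. *)
Lemma system_residual c : c \in systems f -> residual stars (system c).
Proof.
move=> cf; have [sl lr l56 lm] := system_labels cf; split.
- exact: masks_members.
- by apply: uniq_members => //; apply: sorted_uniq sl; [apply: ltn_trans|apply: ltnn].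
- by rewrite size_flatten /shape -map_comp.
- by move=> p /mem_members[a _ /orb_meets].
move=> p q /mem_members[a al pa] /mem_members[b bl qb] pq.
have ar := lr a al; have br := lr b bl.
have [p77 [w wG wp]] := orb_move ar pa; have [r77 _ _] := repsP ar.
have : w @: pset q \in sets (orb t b).
  by rewrite -(span_orb b wG) mem_image_blocks inE map_f.
rewrite inE => /mapP[q' q'b wq].
have := lm a b al bl; rewrite (nth_map xH) // (nth_map [::]) ?size_map // => /allP/(_ q' q'b).
case/orP=> [/eqP q'r|].
  have [q77 _] := orb_move br qb.
  move: wq; rewrite q'r -wp => /(imset_inj (@perm_inj _ w))/(pset_inj q77 p77) qp.
  by rewrite qp eqxx in pq.
rewrite cap_pset // -wp -wq => /eqP; apply: etrans; rewrite -imsetI.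
  by rewrite card_imset //; apply: perm_inj.
by move=> x y _ _; apply: perm_inj.
Qed.

(** This is how the core can be recognised in a system. *)
Lemma core_filter c : c \in systems f ->
  [seq p <- system c | unlinked adj (pset p) == tau f] = core t.
Proof.
move=> cf; have [sl _ _ _] := system_labels cf.
rewrite /system /members /labels map_cat flatten_cat filter_cat.
rewrite (eq_in_filter (a2 := predT)) ?filter_predT => [|p /mem_members[a]]; last first.
  by rewrite mem_iota => /andP[_ ac] /orb_in_core->; rewrite ac.
rewrite (eq_in_filter (a2 := pred0)) ?filter_pred0 ?cats0 // => p /mem_members[a ac] /orb_in_core->.
apply/negbTE; rewrite -leqNgt leqNgt; apply/negP=> an.
have : uniq (labels f c) by apply: sorted_uniq sl; [apply: ltn_trans|apply: ltnn].
by rewrite cat_uniq => /and3P[_ /hasPn/(_ a ac)]; rewrite mem_iota an.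
Qed.

Lemma system_inj c c' : c \in systems f -> c' \in systems f ->
  sets (system c) = sets (system c') -> c = c'.
Proof.
move=> cf c'f cc'; have [sl lr _ _] := system_labels cf; have [sl' lr' _ _] := system_labels c'f.
have sub d d' : {in labels f d, forall a, a < size (reps f)} ->
    sets (system d) = sets (system d') -> {subset labels f d <= labels f d'}.
  move=> dr dd' a ad; have [_ ra _] := reach_orb (dr a ad).
  have : pset (nth xH (reps f) a) \in sets (system d).
    by apply/mem_sets_members; exists a; rewrite // inE map_f.
  have [r77 _ _] := repsP (dr a ad).
  rewrite dd' mem_system // => /mem_members[b bd rb].
  by have := lookup_orb ra; rewrite (lookup_orb rb) => -[<-].
have : labels f c = labels f c'.
  apply: (irr_sorted_eq ltn_trans ltnn) => // a.
  by apply/idP/idP; apply: sub.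
by move=> /(congr1 (drop (ncore f))); rewrite !drop_size_cat ?size_iota.
Qed.

Lemma words_props : [/\ uniq (words t), iota 0 77 \in words t,
  {in words t, forall w, is_perm w /\ to_perm w \in span} &
  {in words t & generators f, forall w g, compose g w \in words t}].
Proof.
have /and4P[_ /and4P[_ _ wz _] _ _] := tP.
have [uw sw cw] := reachP wz isT (fun x g (xn : x \in [::]) => ltac:(by [])).
have inw g : g \in generators f -> List.In (compose g) (map compose (generators f)).
  elim: (generators f) => //= g' gs IHgs; rewrite inE => /predU1P[->|/IHgs]; first by left.
  by right.
have win h : List.In h (map compose (generators f)) -> exists2 g, g \in generators f & h = compose g.
  elim: (generators f) => //= g gs IHgs [<-|/IHgs[g' g'gs ->]].
    by exists g; rewrite ?mem_head.
  by exists g'; rewrite // inE g'gs orbT.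
split=> // [|w|w g wt gf]; first by apply: sw; rewrite mem_head.
  apply: (@reach_ind _ (map compose (generators f)) (fun w => is_perm w /\ to_perm w \in span)
    200 [:: iota 0 77] [::]) w => [w h [wP wG] /win[g gf ->]|w].
    have gP := allP gensP _ gf; rewrite is_perm_compose // to_perm_compose //.
    by split=> //; apply: groupM => //; apply: span_gen.
  by rewrite inE => /eqP->; rewrite is_perm_id to_perm_id group1.
by apply: cw => //; apply: inw.
Qed.

(** The listed words contain 1 and are closed under multiplication by
    generators. *)
Lemma words_span : span = [set g in map to_perm (words t)] :> {set _}.
Proof.
have [uw w1 wP wM] := words_props; apply/eqP; rewrite eqEsubset; apply/andP; split; last first.
  by apply/subsetP=> g; rewrite inE => /mapP[w /wP[_ wG] ->].
apply: gen_sub => [|x a]; first by rewrite inE -to_perm_id map_f.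
rewrite !inE => /mapP[w ww ->] /mapP[g gf ->]; have [wp _] := wP w ww.
by rewrite -to_perm_compose ?map_f ?wM //; apply: (allP gensP).
Qed.

Lemma card_span : #|span| = aut_order f.
Proof.
have /and4P[_ /and4P[_ _ _ /eqP <-] _ _] := tP.
have [uw _ wP _] := words_props; rewrite words_span cardsE.
have /card_uniqP -> : uniq (map to_perm (words t)).
  rewrite map_inj_in_uniq // => v w /wP[vp _] /wP[wp _]; exact: to_perm_inj.
by rewrite size_map.
Qed.

Lemma mem_core c X : c \in systems f ->
  (X \in sets (core t)) = (X \in sets (system c)) && (unlinked adj X == tau f).
Proof.
move=> cf; rewrite -(core_filter cf) !inE; apply/mapP/andP=> [[p]|[/mapP[p ps ->] pt]].
  by rewrite mem_filter => /andP[pt ps] ->; rewrite map_f.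
by exists p => //; rewrite mem_filter pt.
Qed.

Lemma ncore_bounds : 0 < ncore f <= size (reps f).
Proof. by have /and4P[_ _ /and5P[_ _ ok _ _] _] := tP. Qed.

Lemma masks_core : all_masks (core t). Proof. exact: masks_members. Qed.

Lemma uniq_core : uniq (map pset (core t)).
Proof.
apply: uniq_psets; first exact: masks_core.
apply: uniq_members; first exact: iota_uniq.
move=> a; rewrite mem_iota => /andP[_]; move/leq_trans; apply.
by case/andP: ncore_bounds.
Qed.

Lemma span_core g : g \in span -> image_blocks g (sets (core t)) = sets (core t).
Proof. exact: span_members. Qed.

Lemma span_system c g : g \in span -> image_blocks g (sets (system c)) = sets (system c).
Proof. exact: span_members. Qed.

Lemma mem_core_rep a : a < ncore f -> nth xH (reps f) a \in core t.
Proof.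
move=> an; apply/mem_members; exists a; first by rewrite mem_iota.
have [] // := @reach_orb a; case/andP: ncore_bounds => _; exact: leq_trans.
Qed.

Lemma size_rep a : a < size (reps f) -> size (bits (nth xH (reps f) a)) = 77.
Proof. by case/repsP. Qed.

Lemma core_orb p : p \in core t -> exists a w, [/\ a < ncore f, w \in span &
  w @: pset p = pset (nth xH (reps f) a)].
Proof.
case/mem_members=> a; rewrite mem_iota => /andP[_ an] po.
have ar : a < size (reps f) by case/andP: ncore_bounds => _; exact: leq_trans.
by have [_ [w wG wp]] := orb_move ar po; exists a, w.
Qed.
End Good.

Section Pair.
Variables f f' : batch.
Notation t := (tabulate f).
Notation t' := (tabulate f').
Hypotheses (tP : good t) (t'P : good t').

Lemma core_image g c c' : graph_aut adj g -> c \in systems f -> c' \in systems f' ->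
  tau f = tau f' -> image_blocks g (sets (system f c)) = sets (system f' c') ->
  image_blocks g (sets (core t)) = sets (core t').
Proof.
move=> gA cf c'f' ff' gcc'; apply/setP=> X.
rewrite in_image_blocks (mem_core tP _ cf) (mem_core t'P _ c'f') -gcc' in_image_blocks -ff'.
by congr (_ && (_ == _)); rewrite -(unlinked_image (g @^-1: X) gA) imset_preim_perm.
Qed.

(** Up to an element [w] of the group of the target, the representative of the
    first core orbit goes to the representative of a core orbit. *)
Lemma leaf g : graph_aut adj g -> image_blocks g (sets (core t)) = sets (core t') ->
  exists2 w, w \in span f' & [seq val ((g * w)%g x) | x <- enum 'I_77] \in leaves t t'.
Proof.
move=> gA gcc'; have [n0 nr] := andP (ncore_bounds tP).
have r77 := size_rep tP (leq_trans n0 nr).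
have : g @: pset (nth xH (reps f) 0) \in sets (core t').
  by rewrite -gcc' mem_image_blocks inE map_f ?mem_core_rep.
rewrite inE => /mapP[p pc gp]; have [b [w [bn wG wp]]] := core_orb t'P pc.
exists w => //; have [_ nr'] := andP (ncore_bounds t'P).
have b77 := size_rep t'P (leq_trans bn nr').
have gwA : graph_aut adj (g * w)%g.
  by move=> x y; rewrite !permM (span_graph_aut t'P wG) gA.
have mv : moves (g * w)%g (core t) (core t').
  by apply: moves_sets; rewrite ?uniq_core // image_blocksM gcc' span_core.
have [wfc wfc'] := (masks_core tP, masks_core t'P).
have fw : follow (g * w)%g (first_key t) (ext (colors nbr (core t')) (bits (nth xH (reps f') b))).
  apply: follow_ext => //; last by rewrite imset_permM gp wp.
  split; rewrite ?(size_colors (size_nbr nbrP)) // => x.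
  rewrite !(colorsE (size_nbr nbrP) (bits_nbr nbrP) (nbrE nbrP)) //.
  by congr Pos.of_succ_nat; apply: color_moves.
have /and4P[_ _ /and5P[_ _ _ kv uf] _] := tP.
(* The search is run for [g * w], which starts with representatives. *)
have lf := searchP (size_nbr nbrP) (bits_nbr nbrP) (nbrE nbrP) gwA wfc wfc' mv kv fw uf.
apply/flattenP; exists (search nbr (core t) (core t') (keys f) (first_key t)
  (ext (colors nbr (core t')) (bits (nth xH (reps f') b)))); last exact: lf.
apply/mapP; exists (nth xH (reps f') b).
  by rewrite -(nth_take _ bn) mem_nth // size_take_min (minn_idPl nr').
by cbv beta zeta; rewrite (balanced_perm _ (follow_perm fw)).
Qed.

(** A label belongs to at most one orbit, so the labels of the preimages are
    those of orbits of the source system. *)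
Lemma deadP g c c' : is_perm g -> dead t t' g -> c \in systems f -> c' \in systems f' ->
  image_blocks (to_perm g) (sets (system f c)) <> sets (system f' c').
Proof.
move=> gP /allP dead_g cf c'f' gcc'; move: (dead_g c' c'f') => /=.
set d := maxn _ _; set nd := map _ (orbits t'); set need := flatten _.
have needP v : v \in need -> exists2 a, a \in labels f c & v = Some a.
  case/flatten_mapP=> b bc'; have [br|rb] := ltnP b (size (orbits t')); last first.
    by rewrite nth_default // size_map.
  rewrite (nth_map [::]) // => /mapP[p /mem_take po ->].
  have p77 : size (bits p) = 77 by apply/eqP/(allP (masks_orb t'P b)).
  have : pset p \in sets (system f' c').
    by apply/mem_sets_members; exists b; [rewrite mem_cat bc' orbT|rewrite inE map_f].
  rewrite -gcc' in_image_blocks -pull_pset // mem_system ?size_pull //.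
  by case/mem_members=> a ac /(lookup_orb tP) ->; exists a.
case: hasP => [[v /needP[a _ ->]] //|_ /allP/(_ c cf)/hasP[v /needP[a ac ->]]].
move: ac; rewrite mem_cat mem_iota leq0n add0n /= => /orP[an|->]; last by rewrite andbF.
by rewrite leqNgt an.
Qed.

(** An automorphism that is not refuted lies in a double coset of a member of
    [ts]. *)
Lemma spreadP ts g c c' : all is_perm ts -> spread ts t t' ->
  graph_aut adj g -> tau f = tau f' -> c \in systems f -> c' \in systems f' ->
  image_blocks g (sets (system f c)) = sets (system f' c') ->
  exists k v w, [/\ k \in ts, v \in span f, w \in span f' & to_perm k = (v * g * w)%g].
Proof.
move=> tsP /allP sp gA ff' cf c'f' gcc'.
have [w wG lf] := leaf gA (core_image gA cf c'f' ff' gcc').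
have [_ w1 wordP _] := words_props tP.
set l := [seq _ | _ <- _] in lf.
have l77 : size l = 77 by rewrite size_map size_enum_ord.
have /hasP[k kT /hasP[v vw]] := cosetsP ts w1 l77 lf.
rewrite agreeE => /eqP lE; have [vP vG] := wordP v vw.
(* The leaf of [g * w] is [k] after the word [v]. *)
have kE : is_perm k -> to_perm k = ((to_perm v)^-1 * g * w)%g.
  move=> kP; rewrite -mulgA -[(g * w)%g]to_perm_val -/l lE to_perm_compose //.
  by rewrite mulKg.
have := sp k kT; case: ifP => [kts _|_ /andP[kP dk]].
  by exists k, (to_perm v)^-1%g, w; rewrite groupV kE ?(allP tsP).
(* Otherwise [k] would be refuted although it carries one system to the other. *)
case: (deadP kP dk cf c'f'); rewrite kE // !image_blocksM.
by rewrite (span_system tP) ?groupV // gcc' span_system.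
Qed.
End Pair.

Lemma card_design_aut_image (T : finType) (g : {perm T}) (D : {set {set T}}) :
  #|design_aut (image_blocks g D)| = #|design_aut D|.
Proof.
rewrite -[RHS](cardJg (design_aut D) g); apply: eq_card => s.
rewrite mem_conjg !inE conjgE invgK mulgA !image_blocksM.
apply/eqP/eqP=> [->|/(congr1 (image_blocks g))]; first exact: image_blocksK.
by rewrite -[LHS]image_blocksM mulVg image_blocks1.
Qed.

Section Conclusion.
Variable f : batch.
Notation t := (tabulate f).
Hypothesis tP : good t.

(** With the identity as the only representative, the double coset is the group
    itself, and the group fixes every system. *)
Lemma system_move (g : {perm 'I_77}) c c' : c \in systems f -> c' \in systems f ->
  image_blocks g (sets (system f c)) = sets (system f c') -> g \in span f /\ c = c'.
Proof.
move=> cf c'f gcc'; have /and4P[_ _ _ sp] := tP.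
have gA := residual_graph_aut starsP (system_residual tP cf) (system_residual tP c'f) gcc'.
have [|k [v [w []]]] := spreadP tP tP _ sp gA erefl cf c'f gcc'; first by [].
rewrite inE => /eqP-> vG wG; rewrite to_perm_id => e.
have gG : g \in span f.
  have -> : g = (v^-1 * w^-1)%g by apply: (mulgI v); apply: (mulIg w); rewrite -e mulKVg mulVg.
  by rewrite groupM ?groupV.
by split=> //; apply: (system_inj tP) => //; rewrite -gcc' span_system.
Qed.

Lemma card_system_aut c : c \in systems f ->
  #|design_aut (sets (system f c))| = aut_order f.
Proof.
move=> cf; rewrite -(card_span tP); apply: eq_card => g; apply/idP/idP.
  by rewrite inE => /eqP /(system_move cf cf)[].
by rewrite inE => gG; rewrite span_system.
Qed.

Lemma count_tally tau0 c : count (fun p => unlinked adj (pset p) == tau0) (system f c) =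
  unlinked_tally tau0 t c.
Proof.
rewrite /system /members count_flatten -map_comp /unlinked_tally; congr sumn; apply: eq_map => a /=.
case: ifP => ta; last first.
  by apply/eqP; rewrite -leqn0 leqNgt -has_count; apply/hasPn=> p /(orb_unlinked tP)->; rewrite ta.
by apply/eqP; rewrite -all_count; apply/allP=> p /(orb_unlinked tP)->; rewrite ta.
Qed.

Lemma count_core c : c \in systems f ->
  count (fun p => unlinked adj (pset p) == tau f) (system f c) = size (core t).
Proof. by move=> cf; rewrite -(core_filter tP cf) size_filter. Qed.
End Conclusion.

Section Apart.
Variables f f' : batch.
Notation t := (tabulate f).
Notation t' := (tabulate f').
Hypotheses (tP : good t) (t'P : good t').

Lemma differP (g : {perm 'I_77}) c c' : differ t t' -> c \in systems f -> c' \in systems f' ->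
  image_blocks g (sets (system f c)) <> sets (system f' c').
Proof.
move=> /allP/(_ c') df cf c'f' gcc'; case/negP: (df c'f').
have sR := system_residual tP cf; have s'R := system_residual t'P c'f'.
have gA := residual_graph_aut starsP sR s'R gcc'.
rewrite -(count_tally t'P) -(count_core tP cf).
have := residual_moves sR s'R gcc'; move/seq.permP => /(_ (fun X => unlinked adj X == tau f)).
rewrite !count_map => <-; apply/eqP/eq_count => p /=; by rewrite unlinked_image.
Qed.
End Apart.

Lemma apartP f f' (g : {perm 'I_77}) c c' : good (tabulate f) -> good (tabulate f') ->
  apart (tabulate f) (tabulate f') -> c \in systems f -> c' \in systems f' ->
  image_blocks g (sets (system f c)) <> sets (system f' c').
Proof.
move=> tP t'P; rewrite /apart; case: ifP => [oo _|_].
  move=> cf c'f' gcc'; case/eqP: oo => /=.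
  by rewrite -(card_system_aut tP cf) -(card_system_aut t'P c'f') -gcc' card_design_aut_image.
case: ifP => [df _|_]; first exact: differP.
case: ifP => [df _|_].
  by move=> cf c'f' gcc'; apply: (differP t'P tP df c'f' cf (g := g^-1%g)); apply: image_blocksK.
case: ifP => // /eqP ff' sp cf c'f' gcc'.
have gA := residual_graph_aut starsP (system_residual tP cf) (system_residual t'P c'f') gcc'.
by have [] // := spreadP tP t'P _ sp gA ff' cf c'f' gcc' => k [v [w []]].
Qed.
End Families.

(** * The catalogue of systems *)

Section Catalogue.
Variables stars nbr : seq positive.
Hypothesis starsP : stars_ok stars.
Hypothesis nbrP : nbr = neighbours stars.
Variables (f0 : batch) (fs : seq batch).

(** Stated with a shared list of tables, because a table takes part in many
    checks. *)
Definition verified :=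
  let ts := map (tabulate nbr) fs in all (good stars nbr) ts && pairwise (apart nbr) ts.

Hypothesis fsP : verified.

Let tablesP : all (good stars nbr) (map (tabulate nbr) fs) /\
  pairwise (apart nbr) (map (tabulate nbr) fs).
Proof. exact/andP. Qed.

(** A system is identified by its batch and its list of orbits. *)
Definition catalogue := [seq (k, c) | k <- iota 0 (size fs), c <- systems (nth f0 fs k)].

Definition catalogued (kc : nat * seq nat) := system nbr (nth f0 fs kc.1) kc.2.

Lemma nth_good k : k < size fs -> good stars nbr (tabulate nbr (nth f0 fs k)).
Proof.
move=> kf; have [/(all_nthP (tabulate nbr f0))/(_ k) ok _] := tablesP.
by rewrite size_map (nth_map f0) // in ok; apply: ok.
Qed.

Lemma nth_apart k l : k < l < size fs ->
  apart nbr (tabulate nbr (nth f0 fs k)) (tabulate nbr (nth f0 fs l)).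
Proof.
case/andP=> kl lf; have kf := ltn_trans kl lf; have [_] := tablesP.
move/(pairwiseP (tabulate nbr f0))/(_ k l); rewrite !inE size_map => /(_ kf lf kl).
by rewrite !(nth_map f0).
Qed.

Lemma mem_catalogue kc : kc \in catalogue ->
  kc.1 < size fs /\ kc.2 \in systems (nth f0 fs kc.1).
Proof. by case/allpairsPdep=> k [c [+ cf ->]]; rewrite mem_iota. Qed.

Lemma uniq_catalogue : uniq catalogue.
Proof.
apply: allpairs_uniq_dep => [||[k c] [l d] _ _ /= [-> ->]//]; first exact: iota_uniq.
move=> k; rewrite mem_iota => kf; have /and4P[_ _ + _] := nth_good kf.
by case/and5P.
Qed.

Lemma catalogued_residual kc : kc \in catalogue -> residual stars (catalogued kc).
Proof.
by case/mem_catalogue=> kf; apply: system_residual => //; apply: nth_good.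
Qed.

Lemma catalogued_aut kc : kc \in catalogue ->
  #|design_aut (design (catalogued kc))| = aut_order (nth f0 fs kc.1).
Proof.
move=> kcP; rewrite (residual_aut starsP (catalogued_residual kcP)).
have [kf cf] := mem_catalogue kcP.
by apply: (card_system_aut starsP nbrP) => //; apply: nth_good.
Qed.

Lemma catalogued_isomorphic kc ld : kc \in catalogue -> ld \in catalogue ->
  isomorphic (design (catalogued kc)) (design (catalogued ld)) -> kc = ld.
Proof.
move=> kcP ldP; have [kR lR] := (catalogued_residual kcP, catalogued_residual ldP).
case/(residual_isomorphic starsP kR lR) => g.
case: kc kcP {kR} => k c /mem_catalogue[/= kf cf]; case: ld ldP {lR} => l d /mem_catalogue[/= lf df].
rewrite /catalogued /= => gcd; have [tkP tlP] := (nth_good kf, nth_good lf).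
have [kl|lk|kl] := ltngtP k l.
- have kl' : k < l < size fs by rewrite kl.
  by case: (apartP starsP nbrP tkP tlP (nth_apart kl') cf df gcd).
- have lk' : l < k < size fs by rewrite lk.
  by case: (apartP starsP nbrP tlP tkP (nth_apart lk') df cf (image_blocksK gcd)).
by subst l; have [_ ->] := system_move starsP nbrP tkP cf df gcd.
Qed.
End Catalogue.

(** * The Steiner system and the batches *)
(** The hexads of S(3,6,22) are numbered from 0 to 76; bit [h] of a number tells
    whether hexad [h] contains the point of the star, and bit 77 is the leading
    bit. *)
Definition stars : seq positive := [::
  0x200000000000001fffff; 0x20000000001fffe0001f; 0x20000001ffe001e001e1; 0x200003fe00e00e200e22;
  0x2000fc0e070070203244; 0x201f043209219040d082; 0x20e30854320222431028; 0x236111824c00a4846030;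
  0x24ac20889424c20c1401; 0x29466202824902850884; 0x2450d0e0a80700301910; 0x352480190a8a1402a801;
  0x3c811640422145048308; 0x24502f11501880302488; 0x2ac48425045404424504; 0x23821a29810289188024;
  0x38323105202418884848; 0x320a4548184c21160042; 0x32154284119240892102; 0x2d0949202490130a0290;
  0x3188a090615128114201; 0x2a388842c08848418450]%positive.

Definition batch0 := {|
  aut_order := 48; ncore := 1; tau := 242; depth := 1;
  generators := [::
    [::
      15; 9; 18; 3; 8; 5; 2; 20; 19; 11; 10; 1; 16; 7; 0; 14; 17; 12; 6; 4; 13; 57; 71; 24; 60; 54;
      37; 26; 32; 41; 75; 46; 76; 64; 30; 58; 74; 27; 51; 53; 72; 65; 47; 40; 59; 33; 48; 73; 31;
      38; 25; 49; 52; 55; 50; 39; 21; 56; 61; 70; 23; 35; 62; 66; 45; 29; 67; 63; 36; 22; 44; 69;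
      43; 42; 68; 34; 28];
    [::
      28; 27; 23; 3; 34; 25; 4; 36; 24; 26; 21; 1; 29; 31; 0; 32; 33; 22; 30; 2; 35; 56; 45; 19; 75;
      50; 37; 11; 14; 69; 60; 61; 76; 65; 6; 68; 48; 9; 39; 53; 72; 64; 42; 67; 59; 17; 74; 62; 7;
      55; 5; 49; 52; 38; 54; 51; 10; 57; 46; 70; 18; 13; 73; 43; 71; 16; 40; 63; 20; 12; 44; 41; 66;
      47; 58; 8; 15];
    [::
      28; 27; 23; 3; 34; 29; 2; 21; 30; 32; 36; 0; 25; 35; 1; 26; 22; 33; 24; 4; 31; 61; 50; 6; 60;
      45; 76; 14; 11; 65; 75; 56; 37; 69; 19; 48; 68; 9; 40; 63; 49; 41; 62; 51; 59; 12; 58; 42; 13;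
      38; 16; 72; 52; 55; 71; 67; 20; 46; 57; 70; 18; 7; 47; 66; 54; 5; 39; 53; 10; 17; 44; 64; 43;
      73; 74; 8; 15]];
  keys := [::
    (false, 3); (true, 0); (false, 8); (false, 51); (false, 34); (false, 67); (false, 6);
    (false, 32); (false, 5); (false, 68); (false, 2)];
  reps := [::
    0x2008b27028c0c0ce200c; 0x204529000b8649544e00; 0x2000c15392148589d200; 0x204d29080a0249d04f00;
    0x205428c8029199064160; 0x20021e948c3841034811; 0x20161914846145132011; 0x204c0a0c68145125c820;
    0x204529000b870c5c0640; 0x2011c03116012e9c8440; 0x2008482be2360405600a; 0x2005520934c92800d418;
    0x20021e948c39040b0051; 0x20460c8860807c5c0980; 0x200a5180d2d21400d40c; 0x200d520135482c009c18;
    0x21b8ca08802024a2418a; 0x221c1004d34096120a18; 0x201c500457408e128818; 0x2002c412f0021f0c6500;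
    0x2032c031140155950620; 0x20438382847250128049; 0x202c5241154b10004638; 0x20051e50847a20084851;
    0x20138c2884b024950809; 0x200114a8c23c284b2880; 0x2022c230540d94090360; 0x2191603090085c264160;
    0x2000c15392109d0d5100; 0x20492988024251d0cd00; 0x204c0a0c6815142d8060; 0x202691484611882b0182;
    0x208b91010e1248250c82; 0x202571680218485041a1; 0x2022c230540cd1014b20; 0x208274881c900c418898;
    0x204483468c3031198009; 0x204783028c3248120249; 0x2002c113b012c604c340; 0x200e5100da920c00560c;
    0x205c28c003109d060960; 0x203320a9e00864020386; 0x200560692230a4918450; 0x2003d00140fa222cd400;
    0x20169348440036590181; 0x20460c88608464d88a80; 0x213060349008256cc300; 0x2041298003c7145c8440;
    0x20490a884256106cc840; 0x20442904298555158420; 0x200b8b20852c24012909; 0x20045148f9101601c40c;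
    0x2024744814d30800c0b8; 0x2081220fe80454130092; 0x201a90050c3a461502a0; 0x20a1670a204a0068c111;
    0x2015b041c10c260a02a2; 0x201130a9c20c244b0282; 0x2001c1c1232ca4098484; 0x209873820216044280e1;
    0x2091f3080814064180e1; 0x2003e20140e62300f410; 0x2007624361040d023411; 0x200a52866216840284c1;
    0x2001644f604a8208c111; 0x2021e1c0033c045880a4; 0x202471282038645181a0; 0x20059440c13c2a0a28a0;
    0x2023a4414552022c8812; 0x2001c230560caa08c940; 0x205628882090a5448b40; 0x205c28c0031485828a60;
    0x20243823307a20048312; 0x220411487d1112018c0c; 0x20038b2884ad20016109; 0x2022e13014054d01a1a0;
    0x2180615214070c48a1c0; 0x2091e01290081d2e4120; 0x204d0a084a16086c4a40; 0x200ba285c204541200b2;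
    0x2022f1800138465281a0; 0x2180615214064940e980; 0x2091e012900c05aac220; 0x20492988024314d88540;
    0x200b87858205480220b1; 0x2023aba0524410008117; 0x2027ab205a0408000317; 0x21e0c5000c624829808a;
    0x2093112006ca50354401; 0x202185048ab3281c0484; 0x20163242449e01025221; 0x2015a44181302b062830]%positive;
  systems := [::
    [:: 1; 5; 14; 66]; [:: 1; 5; 43; 73]; [:: 1; 5; 51; 55]; [:: 1; 5; 51; 68]; [:: 1; 9; 21; 66];
    [:: 1; 9; 22; 79]; [:: 1; 9; 22; 80]; [:: 1; 9; 35; 67]; [:: 1; 10; 20; 56]; [:: 1; 10; 34; 55];
    [:: 1; 10; 34; 68]; [:: 1; 10; 67; 76]; [:: 1; 11; 20; 57]; [:: 1; 11; 20; 60];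
    [:: 1; 11; 25; 76]; [:: 1; 11; 34; 53]; [:: 1; 11; 76; 84]; [:: 1; 14; 23; 57];
    [:: 1; 14; 23; 60]; [:: 1; 14; 25; 82]; [:: 1; 14; 82; 84]; [:: 1; 19; 24; 79];
    [:: 1; 19; 24; 80]; [:: 1; 19; 53; 74]; [:: 1; 19; 54; 73]; [:: 1; 21; 42; 75];
    [:: 1; 22; 59; 69]; [:: 1; 23; 51; 59]; [:: 1; 24; 38; 56]; [:: 1; 34; 35; 43];
    [:: 1; 42; 46; 74]; [:: 1; 51; 54; 82]; [:: 2; 3; 24; 79]; [:: 2; 3; 24; 80]; [:: 2; 3; 53; 74];
    [:: 2; 3; 54; 73]; [:: 2; 4; 21; 66]; [:: 2; 4; 22; 79]; [:: 2; 4; 22; 80]; [:: 2; 4; 35; 67];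
    [:: 2; 21; 33; 70]; [:: 2; 22; 32; 85]; [:: 2; 24; 33; 48]; [:: 2; 25; 40; 52];
    [:: 2; 29; 50; 53]; [:: 2; 30; 50; 55]; [:: 2; 30; 50; 68]; [:: 2; 30; 67; 87];
    [:: 2; 32; 72; 74]; [:: 2; 35; 86; 91]; [:: 2; 37; 40; 66]; [:: 2; 37; 45; 55];
    [:: 2; 37; 45; 68]; [:: 2; 45; 52; 54]; [:: 2; 73; 78; 91]; [:: 3; 5; 14; 41];
    [:: 3; 6; 14; 57]; [:: 3; 6; 14; 60]; [:: 3; 6; 51; 59]; [:: 3; 9; 17; 25]; [:: 3; 9; 17; 84];
    [:: 3; 9; 21; 41]; [:: 3; 9; 36; 79]; [:: 3; 9; 36; 80]; [:: 3; 10; 20; 65]; [:: 3; 14; 44; 46];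
    [:: 3; 18; 20; 57]; [:: 3; 18; 20; 60]; [:: 3; 18; 25; 76]; [:: 3; 18; 34; 53];
    [:: 3; 18; 76; 84]; [:: 3; 24; 38; 65]; [:: 3; 36; 59; 69]; [:: 4; 5; 11; 41];
    [:: 4; 5; 18; 66]; [:: 4; 6; 10; 56]; [:: 4; 6; 11; 57]; [:: 4; 6; 11; 60]; [:: 4; 10; 23; 65];
    [:: 4; 11; 44; 46]; [:: 4; 17; 19; 25]; [:: 4; 18; 23; 57]; [:: 4; 18; 23; 60];
    [:: 4; 18; 25; 82]; [:: 4; 19; 21; 41]; [:: 4; 19; 36; 79]; [:: 4; 19; 36; 80];
    [:: 4; 22; 38; 65]; [:: 4; 36; 38; 56]; [:: 5; 11; 31; 70]; [:: 5; 14; 31; 72];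
    [:: 5; 14; 33; 49]; [:: 5; 15; 40; 41]; [:: 5; 16; 43; 45]; [:: 5; 16; 61; 70];
    [:: 5; 17; 45; 62]; [:: 5; 17; 45; 64]; [:: 5; 18; 33; 70]; [:: 5; 29; 39; 41];
    [:: 5; 49; 61; 87]; [:: 6; 7; 14; 33]; [:: 6; 7; 61; 87]; [:: 6; 10; 33; 71];
    [:: 6; 11; 13; 32]; [:: 6; 13; 52; 63]; [:: 6; 15; 40; 57]; [:: 6; 15; 40; 60];
    [:: 6; 15; 45; 59]; [:: 6; 29; 39; 57]; [:: 6; 29; 39; 60]; [:: 6; 30; 39; 56];
    [:: 6; 32; 51; 83]; [:: 7; 11; 20; 31]; [:: 7; 14; 23; 31]; [:: 7; 15; 75; 88];
    [:: 7; 16; 20; 61]; [:: 7; 16; 26; 43]; [:: 7; 17; 26; 62]; [:: 7; 17; 26; 64];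
    [:: 7; 18; 20; 33]; [:: 7; 27; 39; 67]; [:: 7; 27; 43; 50]; [:: 7; 27; 62; 74];
    [:: 7; 27; 64; 74]; [:: 7; 28; 50; 55]; [:: 7; 28; 50; 68]; [:: 7; 28; 67; 87];
    [:: 7; 52; 69; 88]; [:: 8; 10; 26; 55]; [:: 8; 10; 26; 68]; [:: 8; 10; 67; 81];
    [:: 8; 10; 75; 91]; [:: 8; 11; 25; 81]; [:: 8; 11; 26; 53]; [:: 8; 12; 14; 66];
    [:: 8; 12; 43; 73]; [:: 8; 12; 51; 55]; [:: 8; 12; 51; 68]; [:: 8; 14; 25; 77];
    [:: 8; 20; 35; 61]; [:: 8; 22; 63; 75]; [:: 8; 23; 63; 73]; [:: 8; 24; 46; 61];
    [:: 8; 26; 35; 43]; [:: 8; 35; 69; 91]; [:: 8; 51; 54; 77]; [:: 9; 16; 25; 29];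
    [:: 9; 16; 29; 84]; [:: 9; 16; 30; 67]; [:: 9; 21; 31; 72]; [:: 9; 21; 33; 49];
    [:: 9; 22; 31; 48]; [:: 9; 29; 37; 41]; [:: 9; 33; 36; 48]; [:: 10; 20; 31; 83];
    [:: 10; 20; 33; 47]; [:: 10; 23; 31; 71]; [:: 10; 29; 75; 89]; [:: 10; 77; 85; 89];
    [:: 11; 30; 75; 89]; [:: 11; 32; 34; 49]; [:: 11; 44; 78; 81]; [:: 12; 13; 16; 43];
    [:: 12; 13; 17; 62]; [:: 12; 13; 17; 64]; [:: 12; 15; 41; 71]; [:: 12; 15; 65; 70];
    [:: 12; 16; 42; 85]; [:: 12; 17; 42; 86]; [:: 12; 39; 41; 83]; [:: 12; 39; 47; 66];
    [:: 12; 39; 49; 56]; [:: 12; 39; 65; 72]; [:: 12; 47; 62; 73]; [:: 12; 47; 64; 73];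
    [:: 13; 15; 27; 54]; [:: 13; 15; 46; 88]; [:: 13; 16; 23; 63]; [:: 13; 18; 23; 32];
    [:: 13; 21; 27; 62]; [:: 13; 21; 27; 64]; [:: 13; 27; 37; 43]; [:: 13; 28; 37; 55];
    [:: 13; 28; 37; 68]; [:: 13; 28; 52; 54]; [:: 13; 38; 52; 88]; [:: 14; 44; 77; 78];
    [:: 15; 20; 30; 65]; [:: 15; 25; 27; 71]; [:: 15; 26; 47; 53]; [:: 15; 26; 49; 59];
    [:: 15; 40; 44; 46]; [:: 15; 44; 48; 81]; [:: 16; 19; 25; 40]; [:: 16; 19; 45; 54];
    [:: 16; 26; 42; 48]; [:: 16; 30; 34; 43]; [:: 16; 34; 63; 72]; [:: 17; 26; 42; 78];
    [:: 17; 30; 34; 62]; [:: 17; 30; 34; 64]; [:: 17; 30; 69; 90]; [:: 17; 38; 45; 90];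
    [:: 18; 30; 75; 90]; [:: 18; 32; 34; 72]; [:: 18; 45; 46; 90]; [:: 19; 21; 31; 70];
    [:: 19; 24; 31; 48]; [:: 19; 32; 36; 85]; [:: 19; 32; 49; 74]; [:: 19; 37; 40; 41];
    [:: 20; 29; 35; 58]; [:: 21; 27; 42; 86]; [:: 21; 58; 70; 77]; [:: 21; 58; 72; 81];
    [:: 22; 28; 59; 86]; [:: 22; 31; 38; 71]; [:: 22; 32; 47; 69]; [:: 22; 40; 46; 58];
    [:: 22; 48; 58; 81]; [:: 23; 30; 39; 65]; [:: 23; 32; 47; 51]; [:: 23; 35; 40; 58];
    [:: 24; 28; 56; 78]; [:: 24; 29; 46; 58]; [:: 24; 31; 38; 83]; [:: 24; 33; 38; 47];
    [:: 24; 48; 58; 77]; [:: 25; 28; 52; 71]; [:: 26; 35; 47; 62]; [:: 26; 35; 47; 64];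
    [:: 27; 37; 42; 85]; [:: 27; 42; 48; 50]; [:: 27; 42; 74; 78]; [:: 28; 37; 56; 70];
    [:: 28; 37; 66; 71]; [:: 28; 50; 53; 83]; [:: 28; 50; 59; 72]; [:: 29; 35; 69; 89];
    [:: 29; 38; 44; 87]; [:: 29; 39; 44; 46]; [:: 32; 36; 69; 83]; [:: 33; 36; 38; 71];
    [:: 34; 49; 52; 63]; [:: 36; 61; 76; 78]; [:: 36; 63; 82; 86]; [:: 37; 49; 61; 76];
    [:: 38; 40; 44; 52]; [:: 39; 44; 48; 77]; [:: 49; 50; 63; 82]] |}.

Definition batch1 := {|
  aut_order := 48; ncore := 1; tau := 132; depth := 1;
  generators := [::
    [::
      15; 9; 8; 3; 18; 41; 76; 74; 26; 30; 58; 60; 64; 57; 75; 24; 54; 71; 32; 37; 46; 13; 17; 11;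
      0; 12; 2; 6; 19; 16; 1; 7; 4; 5; 14; 20; 10; 28; 63; 51; 39; 33; 66; 72; 52; 69; 35; 43; 48;
      62; 50; 40; 59; 42; 29; 49; 61; 21; 36; 44; 23; 68; 55; 73; 25; 45; 53; 67; 56; 65; 70; 22;
      47; 38; 31; 34; 27];
    [::
      27; 28; 34; 3; 23; 25; 1; 21; 26; 24; 36; 4; 29; 35; 2; 30; 33; 22; 32; 0; 31; 56; 50; 11; 37;
      45; 75; 19; 6; 65; 76; 61; 60; 69; 14; 68; 48; 9; 53; 39; 51; 54; 38; 49; 52; 5; 57; 55; 10;
      62; 17; 67; 59; 42; 64; 72; 7; 74; 58; 44; 18; 20; 43; 73; 41; 12; 63; 40; 13; 16; 70; 71; 47;
      66; 46; 8; 15];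
    [::
      0; 76; 63; 52; 72; 16; 9; 20; 14; 40; 36; 55; 29; 61; 38; 67; 45; 71; 32; 27; 46; 13; 17; 11;
      15; 33; 66; 39; 51; 41; 28; 35; 43; 69; 26; 74; 48; 1; 8; 19; 6; 12; 2; 18; 3; 5; 7; 4; 10;
      62; 50; 30; 44; 73; 64; 23; 57; 68; 58; 59; 49; 21; 60; 42; 65; 54; 34; 24; 56; 25; 70; 22;
      47; 75; 31; 53; 37]];
  keys := [::
    (true, 1); (false, 33); (false, 38); (false, 13); (false, 75); (false, 25); (false, 48);
    (false, 29); (false, 8); (false, 1); (false, 0); (false, 5); (false, 9)];
  reps := [::
    0x222b8200606816383104; 0x207802649a1019046205; 0x205828c80251948a8160; 0x204d298003021d540d40;
    0x205224e0d080348a8205; 0x20450a0869144a26c840; 0x204c2c0428850d2da020; 0x2058920826c1a08a840a;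
    0x204440e7442831198009; 0x20068df16200408c0017; 0x2028423ba012640441c8; 0x200bc6854204c80208b1;
    0x228c22542c818100285c; 0x2020c612a186250c4488; 0x2001e412a18e050c4428; 0x20018e70843a208c4841;
    0x202054a8423d084b20a0; 0x200150a9422d284b2480; 0x200c7390c0820542504c; 0x20845250544a90484a50;
    0x2001b104893d0303a420; 0x2001e485412c83038830; 0x204e9340059050540829; 0x200452147448c902d810;
    0x200974254808ca030921; 0x2003a184833d0102a430; 0x20846b44f8001400c017; 0x2044006d45a9301d0018;
    0x205828400b50dc0e0920; 0x2015501116412e188450; 0x200c946138808a85220c; 0x200c1b44856b00026019;
    0x2084531034484940f810; 0x2003e084433c81028c30; 0x208c5194c08a050050cc; 0x200451d8e108444a408c;
    0x208c50d4a088850060cc; 0x204d29080a030cd80740; 0x200c1d1148860a851304; 0x2001e053819c050c5028;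
    0x2004916879101285840c; 0x200699706a10408c0407; 0x2001a585812d0303a030; 0x2001a7088a30a84b0910;
    0x2001ca71042b208c4441; 0x208c6314c8820500505c; 0x208459c4f0081400c087; 0x200c72d0a0808542604c;
    0x200e90603a908884260c; 0x2009282b301b44044960; 0x200b64a54208c8020931; 0x20012628ca34284b2810;
    0x2098c12017000ed4a808; 0x2084415ce9084408409c; 0x220c32d024818142284c; 0x200c952158820a85120c;
    0x20041958691412858504; 0x20041314b4494902f010; 0x20844ac04c4a90484a48; 0x200c5a44456a80024819;
    0x20183283261206568042; 0x200bd2044a14c8020ca1; 0x200b93048a15480224a1; 0x202224a5c289a00a0312;
    0x200195888238a84b0980; 0x200336a0c0942242a841; 0x202066284a35084b2030; 0x200162294a25284b2410;
    0x200932a1c20431432c02; 0x200495123242990d0510; 0x2018091487050e96a100; 0x208c2a44388185006854;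
    0x200e91205a920884160c; 0x200e0cd1228488842314; 0x20840bc08c4b10486248; 0x2009970588054a0320a1;
    0x2009d6054804ca0308a1; 0x2020e7080a31884b0130; 0x20098261950a30844e08; 0x200c182b62760005201a;
    0x208c18c43089850068c4; 0x200609d8631410848514; 0x228c7940016204402899; 0x20040b84ac494902f008;
    0x20229204ca95a00a0682; 0x200b25a5820948022131; 0x200b31248a1948022521; 0x20209605c885a20b0282;
    0x2003b7808090a2428941; 0x20042b487901444a4814; 0x2195b80001ec0026003a; 0x2001a843119d050c5820;
    0x20041254d44b900a4250; 0x2190c90092209c274102; 0x2003b004ca9d800a0622; 0x2003a485c28d800a0232;
    0x20123682248215570401; 0x20048d822a42990d0508; 0x2001c22934892884d408; 0x20040ca26a46190d2408;
    0x200491531250990d1110; 0x2020c62834990884d028; 0x20010e18a49c2884d900; 0x2018c02457008e968808;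
    0x200419c87109444a4884; 0x200e85a152820884121c; 0x20844b802c484940f808; 0x200372a140852242a441;
    0x20018628b4982884d808; 0x200408e34a54190d3008; 0x200689832852c2048348; 0x200c3b80508305425844;
    0x2012081cc48594970300; 0x2009b3818200b1430d02]%positive;
  systems := [::
    [:: 1; 9; 24; 106]; [:: 1; 9; 77; 111]; [:: 1; 11; 13; 106]; [:: 1; 11; 18; 97];
    [:: 1; 11; 32; 38]; [:: 1; 11; 69; 111]; [:: 1; 13; 43; 112]; [:: 1; 13; 65; 89];
    [:: 1; 18; 43; 81]; [:: 1; 18; 56; 77]; [:: 1; 18; 76; 102]; [:: 1; 23; 38; 63];
    [:: 1; 23; 49; 96]; [:: 1; 23; 56; 87]; [:: 1; 23; 60; 81]; [:: 1; 24; 32; 56];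
    [:: 1; 24; 53; 102]; [:: 1; 32; 49; 76]; [:: 1; 32; 50; 81]; [:: 1; 34; 56; 113];
    [:: 1; 34; 63; 97]; [:: 1; 34; 65; 81]; [:: 1; 34; 96; 102]; [:: 1; 38; 43; 53];
    [:: 1; 49; 53; 77]; [:: 1; 50; 53; 97]; [:: 1; 50; 69; 112]; [:: 1; 60; 69; 89];
    [:: 2; 9; 12; 67]; [:: 2; 9; 17; 90]; [:: 2; 9; 21; 31]; [:: 2; 9; 42; 59]; [:: 2; 10; 17; 46];
    [:: 2; 10; 26; 67]; [:: 2; 10; 31; 61]; [:: 2; 10; 59; 62]; [:: 2; 11; 12; 44];
    [:: 2; 11; 19; 48]; [:: 2; 11; 31; 39]; [:: 2; 12; 15; 61]; [:: 2; 12; 41; 51];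
    [:: 2; 15; 21; 26]; [:: 2; 15; 42; 46]; [:: 2; 15; 62; 90]; [:: 2; 17; 36; 40];
    [:: 2; 19; 21; 40]; [:: 2; 20; 41; 59]; [:: 2; 20; 44; 46]; [:: 2; 21; 35; 79];
    [:: 2; 26; 39; 51]; [:: 2; 35; 48; 51]; [:: 2; 36; 62; 79]; [:: 3; 9; 12; 67];
    [:: 3; 9; 17; 90]; [:: 3; 9; 21; 31]; [:: 3; 9; 42; 59]; [:: 3; 10; 17; 46]; [:: 3; 10; 26; 67];
    [:: 3; 10; 31; 61]; [:: 3; 10; 59; 62]; [:: 3; 11; 12; 44]; [:: 3; 11; 19; 48];
    [:: 3; 11; 31; 39]; [:: 3; 12; 15; 61]; [:: 3; 12; 41; 51]; [:: 3; 15; 21; 26];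
    [:: 3; 15; 42; 46]; [:: 3; 15; 62; 90]; [:: 3; 17; 36; 40]; [:: 3; 19; 21; 40];
    [:: 3; 20; 41; 59]; [:: 3; 20; 44; 46]; [:: 3; 21; 35; 79]; [:: 3; 26; 39; 51];
    [:: 3; 35; 48; 51]; [:: 3; 36; 62; 79]; [:: 4; 13; 17; 80]; [:: 4; 13; 21; 58];
    [:: 4; 13; 42; 74]; [:: 4; 13; 67; 71]; [:: 4; 14; 67; 70]; [:: 4; 14; 74; 86];
    [:: 4; 16; 29; 80]; [:: 4; 16; 34; 91]; [:: 4; 17; 36; 38]; [:: 4; 19; 21; 38];
    [:: 4; 19; 24; 91]; [:: 4; 21; 45; 99]; [:: 4; 24; 39; 58]; [:: 4; 24; 44; 71];
    [:: 4; 25; 29; 74]; [:: 4; 25; 34; 109]; [:: 4; 29; 33; 58]; [:: 4; 29; 66; 71];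
    [:: 4; 33; 44; 70]; [:: 4; 33; 45; 109]; [:: 4; 34; 42; 99]; [:: 4; 36; 86; 99];
    [:: 4; 39; 66; 70]; [:: 4; 45; 66; 91]; [:: 5; 12; 29; 68]; [:: 5; 12; 44; 87];
    [:: 5; 13; 17; 54]; [:: 5; 13; 31; 94]; [:: 5; 14; 17; 52]; [:: 5; 14; 31; 84];
    [:: 5; 16; 18; 48]; [:: 5; 16; 29; 54]; [:: 5; 16; 39; 52]; [:: 5; 16; 47; 72];
    [:: 5; 17; 18; 30]; [:: 5; 17; 47; 55]; [:: 5; 18; 42; 78]; [:: 5; 19; 30; 84];
    [:: 5; 19; 48; 87]; [:: 5; 19; 55; 94]; [:: 5; 25; 44; 52]; [:: 5; 25; 72; 92];
    [:: 5; 30; 86; 92]; [:: 5; 31; 39; 87]; [:: 5; 42; 55; 92]; [:: 5; 45; 48; 68];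
    [:: 5; 45; 78; 94]; [:: 5; 47; 78; 86]; [:: 6; 9; 84; 93]; [:: 6; 9; 103; 107];
    [:: 6; 11; 18; 98]; [:: 6; 11; 29; 82]; [:: 6; 11; 32; 72]; [:: 6; 11; 52; 100];
    [:: 6; 18; 61; 108]; [:: 6; 23; 40; 84]; [:: 6; 23; 63; 72]; [:: 6; 29; 46; 65];
    [:: 6; 29; 63; 93]; [:: 6; 32; 61; 105]; [:: 6; 34; 40; 107]; [:: 6; 34; 63; 98];
    [:: 6; 41; 43; 52]; [:: 6; 41; 50; 82]; [:: 6; 41; 60; 93]; [:: 6; 41; 65; 103];
    [:: 6; 43; 53; 72]; [:: 6; 46; 60; 100]; [:: 6; 50; 53; 98]; [:: 6; 63; 100; 103];
    [:: 7; 9; 16; 80]; [:: 7; 9; 25; 74]; [:: 7; 9; 33; 58]; [:: 7; 9; 66; 71]; [:: 7; 10; 16; 89];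
    [:: 7; 10; 58; 76]; [:: 7; 10; 66; 104]; [:: 7; 10; 74; 75]; [:: 7; 11; 14; 58];
    [:: 7; 14; 51; 104]; [:: 7; 15; 25; 89]; [:: 7; 15; 33; 104]; [:: 7; 15; 71; 76];
    [:: 7; 15; 75; 80]; [:: 7; 16; 36; 56]; [:: 7; 19; 33; 56]; [:: 7; 19; 73; 76];
    [:: 7; 33; 35; 110]; [:: 7; 35; 66; 73]; [:: 7; 36; 75; 110]; [:: 8; 12; 13; 65];
    [:: 8; 12; 60; 69]; [:: 8; 13; 20; 82]; [:: 8; 13; 54; 64]; [:: 8; 14; 52; 64];
    [:: 8; 14; 82; 85]; [:: 8; 18; 20; 101]; [:: 8; 18; 25; 108]; [:: 8; 18; 30; 64];
    [:: 8; 20; 32; 55]; [:: 8; 20; 52; 69]; [:: 8; 25; 32; 105]; [:: 8; 30; 32; 85];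
    [:: 8; 30; 45; 65]; [:: 8; 30; 57; 60]; [:: 8; 45; 95; 101]; [:: 8; 47; 55; 64];
    [:: 8; 47; 85; 101]; [:: 8; 54; 69; 85]; [:: 8; 55; 57; 95]; [:: 9; 12; 28; 68];
    [:: 9; 12; 37; 68]; [:: 9; 16; 28; 54]; [:: 9; 16; 37; 54]; [:: 10; 22; 24; 83];
    [:: 10; 22; 70; 77]; [:: 10; 24; 27; 83]; [:: 10; 26; 28; 68]; [:: 10; 26; 37; 68];
    [:: 12; 15; 37; 96]; [:: 13; 22; 43; 71]; [:: 13; 22; 64; 80]; [:: 14; 22; 43; 70];
    [:: 14; 22; 50; 83]; [:: 14; 26; 28; 88]; [:: 14; 26; 37; 88]; [:: 14; 27; 43; 70];
    [:: 14; 27; 50; 83]; [:: 15; 28; 54; 75]; [:: 16; 28; 40; 47]; [:: 16; 37; 40; 47];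
    [:: 20; 22; 23; 38]; [:: 20; 23; 27; 38]; [:: 20; 28; 53; 78]; [:: 22; 23; 25; 49];
    [:: 22; 24; 57; 73]; [:: 22; 33; 49; 57]; [:: 23; 25; 27; 49]; [:: 24; 27; 57; 73];
    [:: 27; 33; 49; 57]; [:: 27; 36; 38; 64]; [:: 27; 45; 73; 77]; [:: 28; 30; 35; 88];
    [:: 28; 47; 75; 79]; [:: 30; 35; 37; 88]; [:: 35; 37; 78; 95]] |}.

Definition batch2 := {|
  aut_order := 48; ncore := 1; tau := 158; depth := 1;
  generators := [::
    [::
      15; 9; 8; 3; 18; 41; 76; 74; 26; 30; 58; 60; 64; 57; 75; 24; 54; 71; 32; 37; 46; 13; 17; 11;
      0; 12; 2; 6; 19; 16; 1; 7; 4; 5; 14; 20; 10; 28; 63; 51; 39; 33; 66; 72; 52; 69; 35; 43; 48;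
      62; 50; 40; 59; 42; 29; 49; 61; 21; 36; 44; 23; 68; 55; 73; 25; 45; 53; 67; 56; 65; 70; 22;
      47; 38; 31; 34; 27];
    [::
      27; 28; 34; 3; 23; 25; 1; 21; 26; 24; 36; 4; 29; 35; 2; 30; 33; 22; 32; 0; 31; 56; 50; 11; 37;
      45; 75; 19; 6; 65; 76; 61; 60; 69; 14; 68; 48; 9; 53; 39; 51; 54; 38; 49; 52; 5; 57; 55; 10;
      62; 17; 67; 59; 42; 64; 72; 7; 74; 58; 44; 18; 20; 43; 73; 41; 12; 63; 40; 13; 16; 70; 71; 47;
      66; 46; 8; 15];
    [::
      0; 76; 63; 52; 72; 16; 9; 20; 14; 40; 36; 55; 29; 61; 38; 67; 45; 71; 32; 27; 46; 13; 17; 11;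
      15; 33; 66; 39; 51; 41; 28; 35; 43; 69; 26; 74; 48; 1; 8; 19; 6; 12; 2; 18; 3; 5; 7; 4; 10;
      62; 50; 30; 44; 73; 64; 23; 57; 68; 58; 59; 49; 21; 60; 42; 65; 54; 34; 24; 56; 25; 70; 22;
      47; 75; 31; 53; 37]];
  keys := [::
    (false, 31); (false, 39); (false, 23); (false, 42); (false, 19); (false, 12); (false, 74);
    (false, 60); (false, 8); (false, 35); (false, 3)];
  reps := [::
    0x2058920826c1a08a840a; 0x222b8200606816383104; 0x2215a04022ac83106224; 0x24338340054a82004345;
    0x201783486404541100a5; 0x2001ac02318f050c4c20; 0x20049d716800428d0007; 0x20841350944b10486250;
    0x2004315494434902e090; 0x200b87858205480220b1; 0x2001f004493c83038c20; 0x200114a8c23c284b2880;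
    0x2003a608c8302a4a2910; 0x200414327246190d2410; 0x20068c8268421b0c2508; 0x20046358e900444a401c;
    0x208c6254a8808500605c; 0x200609d8631410848514; 0x20040ca26a46190d2408; 0x2001b104893d0303a420;
    0x200bc6854204c80208b1; 0x20039488c0382a4a2980; 0x20012628ca34284b2810; 0x2001e412a18e050c4428;
    0x200e0cd1228488842314; 0x20041958691412858504; 0x20845250544a90484a50; 0x200468c44c42c902c888;
    0x20012c5884962884c980; 0x200689832852c2048348; 0x2006941270421b0c2510; 0x200451d8e108444a408c;
    0x208c18c43089850068c4; 0x20840bc08c4b10486248; 0x200429c48c434902e088; 0x20844ac04c4a90484a48;
    0x200470545442c902c890; 0x2003a184833d0102a430; 0x2009d6054804ca0308a1; 0x202066284a35084b2030;
    0x2022d48840390a4a21a0; 0x20042b487901444a4814; 0x200419c87109444a4884; 0x208c50d4a088850060cc;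
    0x208c2a44388185006854; 0x2003e084433c81028c30; 0x2009970588054a0320a1; 0x2022e60848310a4a2130;
    0x202054a8423d084b20a0]%positive;
  systems := [::
    [:: 1; 5; 7; 9]; [:: 1; 5; 11; 15]; [:: 1; 5; 20; 26]; [:: 1; 5; 22; 31]; [:: 1; 6; 10; 35];
    [:: 1; 6; 11; 32]; [:: 1; 6; 19; 33]; [:: 1; 6; 22; 44]; [:: 1; 7; 17; 19]; [:: 1; 7; 24; 46];
    [:: 1; 7; 25; 37]; [:: 1; 9; 13; 32]; [:: 1; 9; 18; 43]; [:: 1; 9; 23; 33]; [:: 1; 10; 13; 42];
    [:: 1; 10; 17; 26]; [:: 1; 10; 18; 31]; [:: 1; 11; 17; 43]; [:: 1; 11; 23; 41];
    [:: 1; 13; 19; 41]; [:: 1; 13; 20; 44]; [:: 1; 15; 18; 19]; [:: 1; 15; 24; 48];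
    [:: 1; 15; 29; 37]; [:: 1; 16; 17; 22]; [:: 1; 16; 18; 20]; [:: 1; 16; 25; 39];
    [:: 1; 16; 29; 38]; [:: 2; 6; 11; 27]; [:: 2; 6; 12; 35]; [:: 2; 6; 21; 33]; [:: 2; 6; 22; 34];
    [:: 2; 7; 9; 14]; [:: 2; 7; 17; 21]; [:: 2; 7; 25; 40]; [:: 2; 7; 28; 46]; [:: 2; 8; 17; 22];
    [:: 2; 8; 18; 20]; [:: 2; 8; 25; 39]; [:: 2; 8; 29; 38]; [:: 2; 9; 13; 27]; [:: 2; 9; 18; 36];
    [:: 2; 9; 30; 33]; [:: 2; 11; 14; 15]; [:: 2; 11; 17; 36]; [:: 2; 11; 30; 41];
    [:: 2; 12; 13; 42]; [:: 2; 12; 17; 26]; [:: 2; 12; 18; 31]; [:: 2; 13; 20; 34];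
    [:: 2; 13; 21; 41]; [:: 2; 14; 20; 26]; [:: 2; 14; 22; 31]; [:: 2; 15; 18; 21];
    [:: 2; 15; 28; 48]; [:: 2; 15; 29; 40]; [:: 3; 5; 8; 20]; [:: 3; 5; 9; 36]; [:: 3; 5; 12; 31];
    [:: 3; 5; 15; 21]; [:: 3; 6; 10; 34]; [:: 3; 6; 12; 44]; [:: 3; 6; 19; 27]; [:: 3; 6; 21; 32];
    [:: 3; 8; 10; 17]; [:: 3; 8; 24; 38]; [:: 3; 8; 25; 45]; [:: 3; 9; 14; 43]; [:: 3; 9; 23; 27];
    [:: 3; 9; 30; 32]; [:: 3; 10; 14; 31]; [:: 3; 10; 30; 42]; [:: 3; 12; 16; 17];
    [:: 3; 12; 23; 42]; [:: 3; 14; 15; 19]; [:: 3; 14; 16; 20]; [:: 3; 15; 24; 40];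
    [:: 3; 15; 28; 37]; [:: 3; 16; 25; 47]; [:: 3; 16; 28; 38]; [:: 4; 5; 7; 21]; [:: 4; 5; 8; 22];
    [:: 4; 5; 11; 36]; [:: 4; 5; 12; 26]; [:: 4; 7; 14; 19]; [:: 4; 7; 24; 40]; [:: 4; 7; 28; 37];
    [:: 4; 8; 10; 18]; [:: 4; 8; 24; 39]; [:: 4; 8; 29; 45]; [:: 4; 10; 13; 34]; [:: 4; 10; 14; 26];
    [:: 4; 10; 30; 35]; [:: 4; 11; 14; 43]; [:: 4; 11; 23; 27]; [:: 4; 11; 30; 32];
    [:: 4; 12; 13; 44]; [:: 4; 12; 16; 18]; [:: 4; 12; 23; 35]; [:: 4; 13; 19; 27];
    [:: 4; 13; 21; 32]; [:: 4; 14; 16; 22]; [:: 4; 16; 28; 39]; [:: 4; 16; 29; 47]] |}.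

Definition batch3 := {|
  aut_order := 48; ncore := 1; tau := 150; depth := 1;
  generators := [::
    [::
      15; 9; 8; 3; 18; 41; 76; 74; 26; 30; 58; 60; 64; 57; 75; 24; 54; 71; 32; 37; 46; 13; 17; 11;
      0; 12; 2; 6; 19; 16; 1; 7; 4; 5; 14; 20; 10; 28; 63; 51; 39; 33; 66; 72; 52; 69; 35; 43; 48;
      62; 50; 40; 59; 42; 29; 49; 61; 21; 36; 44; 23; 68; 55; 73; 25; 45; 53; 67; 56; 65; 70; 22;
      47; 38; 31; 34; 27];
    [::
      27; 28; 34; 3; 23; 25; 1; 21; 26; 24; 36; 4; 29; 35; 2; 30; 33; 22; 32; 0; 31; 56; 50; 11; 37;
      45; 75; 19; 6; 65; 76; 61; 60; 69; 14; 68; 48; 9; 53; 39; 51; 54; 38; 49; 52; 5; 57; 55; 10;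
      62; 17; 67; 59; 42; 64; 72; 7; 74; 58; 44; 18; 20; 43; 73; 41; 12; 63; 40; 13; 16; 70; 71; 47;
      66; 46; 8; 15];
    [::
      0; 76; 63; 52; 72; 16; 9; 20; 14; 40; 36; 55; 29; 61; 38; 67; 45; 71; 32; 27; 46; 13; 17; 11;
      15; 33; 66; 39; 51; 41; 28; 35; 43; 69; 26; 74; 48; 1; 8; 19; 6; 12; 2; 18; 3; 5; 7; 4; 10;
      62; 50; 30; 44; 73; 64; 23; 57; 68; 58; 59; 49; 21; 60; 42; 65; 54; 34; 24; 56; 25; 70; 22;
      47; 75; 31; 53; 37]];
  keys := [::
    (false, 2); (false, 67); (false, 41); (false, 27); (false, 18); (false, 21); (false, 37);
    (false, 56); (false, 14); (false, 0); (false, 9); (false, 22)];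
  reps := [::
    0x207802649a1019046205; 0x201783486404541100a5; 0x2618a1400262b40901a4; 0x2626830040a621215284;
    0x222b8200606816383104; 0x2009603ba01a44044168; 0x20049d716800428d0007; 0x20044a846c48c902d808;
    0x20293a9000c410f68104; 0x200bb281c00033422d02; 0x2003a608c8302a4a2910; 0x20068c8268421b0c2508;
    0x2006103370564204a250; 0x2018481447048e968900; 0x20046358e900444a401c; 0x2020c612a186250c4488;
    0x20068df16200408c0017; 0x200468c44c42c902c888; 0x20183283261206568042; 0x20209605c885a20b0282;
    0x20123682248215570401; 0x202224a5c289a00a0312; 0x2009b3818200b1430d02; 0x200336a0c0942242a841;
    0x200137a08294a0438841; 0x200495123242990d0510; 0x2012081cc48594970300; 0x20844b802c484940f808;
    0x200b64a54208c8020931; 0x2001a7088a30a84b0910; 0x200c3b80508305425844; 0x200c1d1148860a851304;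
    0x200452147448c902d810; 0x2084531034484940f810; 0x200bc6854204c80208b1; 0x2009d6054804ca0308a1;
    0x2022e60848310a4a2130; 0x20048d822a42990d0508; 0x200411333256c0058250; 0x2006941270421b0c2510;
    0x208c5194c08a050050cc; 0x200c7390c0820542504c; 0x2084415ce9084408409c; 0x20042b487901444a4814;
    0x2009282b301b44044960; 0x200974254808ca030921; 0x2020e7080a31884b0130; 0x20010e18a49c2884d900;
    0x200609d8631410848514; 0x20041958691412858504; 0x20012c5884962884c980]%positive;
  systems := [::
    [:: 1; 5; 7; 9]; [:: 1; 5; 8; 46]; [:: 1; 5; 17; 22]; [:: 1; 5; 27; 36]; [:: 1; 7; 15; 24];
    [:: 1; 7; 18; 39]; [:: 1; 7; 19; 38]; [:: 1; 8; 12; 45]; [:: 1; 8; 15; 29]; [:: 1; 8; 25; 28];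
    [:: 1; 9; 12; 13]; [:: 1; 9; 32; 44]; [:: 1; 9; 40; 47]; [:: 1; 10; 15; 27]; [:: 1; 10; 25; 30];
    [:: 1; 10; 31; 33]; [:: 1; 10; 37; 41]; [:: 1; 11; 18; 32]; [:: 1; 11; 23; 40];
    [:: 1; 11; 28; 33]; [:: 1; 11; 29; 41]; [:: 1; 12; 17; 19]; [:: 1; 12; 30; 36];
    [:: 1; 13; 22; 38]; [:: 1; 13; 23; 39]; [:: 1; 13; 24; 25]; [:: 2; 5; 8; 35]; [:: 2; 5; 9; 43];
    [:: 2; 5; 17; 20]; [:: 2; 5; 26; 36]; [:: 2; 6; 8; 28]; [:: 2; 6; 10; 30]; [:: 2; 6; 13; 24];
    [:: 2; 6; 17; 18]; [:: 2; 8; 15; 34]; [:: 2; 8; 16; 45]; [:: 2; 9; 13; 16]; [:: 2; 9; 14; 44];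
    [:: 2; 9; 40; 49]; [:: 2; 10; 15; 26]; [:: 2; 10; 31; 42]; [:: 2; 10; 41; 48];
    [:: 2; 11; 14; 18]; [:: 2; 11; 21; 40]; [:: 2; 11; 28; 42]; [:: 2; 11; 34; 41];
    [:: 2; 13; 20; 38]; [:: 2; 13; 21; 39]; [:: 2; 14; 19; 50]; [:: 2; 14; 24; 31];
    [:: 3; 6; 7; 24]; [:: 3; 6; 8; 29]; [:: 3; 6; 10; 27]; [:: 3; 6; 17; 23]; [:: 3; 7; 9; 16];
    [:: 3; 7; 20; 38]; [:: 3; 7; 21; 39]; [:: 3; 8; 12; 35]; [:: 3; 8; 16; 46]; [:: 3; 8; 25; 34];
    [:: 3; 9; 12; 43]; [:: 3; 9; 14; 47]; [:: 3; 9; 32; 49]; [:: 3; 10; 25; 26]; [:: 3; 10; 33; 48];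
    [:: 3; 10; 37; 42]; [:: 3; 11; 14; 23]; [:: 3; 11; 21; 32]; [:: 3; 11; 29; 42];
    [:: 3; 11; 33; 34]; [:: 3; 12; 17; 20]; [:: 3; 12; 26; 36]; [:: 3; 14; 22; 50];
    [:: 3; 14; 24; 37]; [:: 4; 5; 7; 20]; [:: 4; 5; 22; 43]; [:: 4; 5; 26; 46]; [:: 4; 5; 27; 35];
    [:: 4; 6; 7; 18]; [:: 4; 6; 13; 23]; [:: 4; 6; 27; 28]; [:: 4; 6; 29; 30]; [:: 4; 7; 15; 21];
    [:: 4; 7; 16; 19]; [:: 4; 12; 13; 20]; [:: 4; 12; 19; 43]; [:: 4; 12; 26; 45];
    [:: 4; 12; 30; 35]; [:: 4; 13; 16; 22]; [:: 4; 13; 21; 25]; [:: 4; 14; 18; 37];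
    [:: 4; 14; 19; 47]; [:: 4; 14; 22; 44]; [:: 4; 14; 23; 31]] |}.

Definition batch4 := {|
  aut_order := 48; ncore := 1; tau := 242; depth := 5;
  generators := [::
    [::
      15; 9; 8; 3; 18; 41; 76; 74; 26; 30; 58; 60; 64; 57; 75; 24; 54; 71; 32; 37; 46; 13; 17; 11;
      0; 12; 2; 6; 19; 16; 1; 7; 4; 5; 14; 20; 10; 28; 63; 51; 39; 33; 66; 72; 52; 69; 35; 43; 48;
      62; 50; 40; 59; 42; 29; 49; 61; 21; 36; 44; 23; 68; 55; 73; 25; 45; 53; 67; 56; 65; 70; 22;
      47; 38; 31; 34; 27];
    [::
      27; 28; 34; 3; 23; 25; 1; 21; 26; 24; 36; 4; 29; 35; 2; 30; 33; 22; 32; 0; 31; 56; 50; 11; 37;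
      45; 75; 19; 6; 65; 76; 61; 60; 69; 14; 68; 48; 9; 53; 39; 51; 54; 38; 49; 52; 5; 57; 55; 10;
      62; 17; 67; 59; 42; 64; 72; 7; 74; 58; 44; 18; 20; 43; 73; 41; 12; 63; 40; 13; 16; 70; 71; 47;
      66; 46; 8; 15];
    [::
      0; 76; 63; 52; 72; 16; 9; 20; 14; 40; 36; 55; 29; 61; 38; 67; 45; 71; 32; 27; 46; 13; 17; 11;
      15; 33; 66; 39; 51; 41; 28; 35; 43; 69; 26; 74; 48; 1; 8; 19; 6; 12; 2; 18; 3; 5; 7; 4; 10;
      62; 50; 30; 44; 73; 64; 23; 57; 68; 58; 59; 49; 21; 60; 42; 65; 54; 34; 24; 56; 25; 70; 22;
      47; 75; 31; 53; 37]];
  keys := [::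
    (false, 3); (false, 51); (false, 0); (false, 59); (false, 38); (false, 4); (false, 60);
    (false, 5); (false, 22); (false, 57); (false, 21); (false, 8)];
  reps := [::
    0x204e9340059050540829; 0x2618a1400262b40901a4; 0x2626830040a621215284; 0x2215a04022ac83106224;
    0x222b8200606816383104; 0x20044a846c48c902d808; 0x2001ac02318f050c4c20; 0x2009603ba01a44044168;
    0x2004315494434902e090; 0x2003a608c8302a4a2910; 0x2020c612a186250c4488; 0x2001e412a18e050c4428;
    0x200c1d1148860a851304; 0x200429c48c434902e088; 0x2009352588094a032121; 0x2001f004493c83038c20;
    0x200e0cd1228488842314; 0x20040b84ac494902f008; 0x200470545442c902c890; 0x2028423ba012640441c8;
    0x200452147448c902d810; 0x20041314b4494902f010; 0x200468c44c42c902c888; 0x200b25a5820948022131;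
    0x2003e084433c81028c30; 0x2001a7088a30a84b0910; 0x2020d5880239884b01a0; 0x2020e7080a31884b0130;
    0x20039488c0382a4a2980; 0x2009282b301b44044960; 0x2003a184833d0102a430; 0x200b64a54208c8020931;
    0x208c2a44388185006854; 0x2001b104893d0303a420; 0x200974254808ca030921; 0x200195888238a84b0980;
    0x2022e60848310a4a2130; 0x2022d48840390a4a21a0; 0x20048d822a42990d0508; 0x200411333256c0058250;
    0x2006941270421b0c2510; 0x2006103370564204a250; 0x208c6314c8820500505c; 0x2018481447048e968900;
    0x208c6254a8808500605c; 0x200495123242990d0510; 0x20012c5884962884c980; 0x2018091487050e96a100]%positive;
  systems := [::
    [:: 1; 6; 8; 31]; [:: 1; 6; 9; 42]; [:: 1; 6; 18; 23]; [:: 1; 7; 13; 24]; [:: 1; 7; 22; 30];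
    [:: 1; 7; 32; 36]; [:: 1; 8; 12; 15]; [:: 1; 8; 16; 34]; [:: 1; 8; 24; 29]; [:: 1; 9; 10; 32];
    [:: 1; 9; 11; 47]; [:: 1; 9; 12; 44]; [:: 1; 10; 13; 15]; [:: 1; 11; 28; 43];
    [:: 1; 14; 16; 18]; [:: 1; 14; 19; 22]; [:: 2; 5; 11; 28]; [:: 2; 5; 19; 37]; [:: 2; 5; 30; 39];
    [:: 2; 5; 33; 40]; [:: 2; 6; 8; 25]; [:: 2; 6; 9; 21]; [:: 2; 6; 18; 35]; [:: 2; 6; 20; 28];
    [:: 2; 8; 15; 38]; [:: 2; 8; 16; 27]; [:: 2; 9; 11; 17]; [:: 2; 13; 15; 45]; [:: 2; 13; 24; 41];
    [:: 2; 16; 18; 26]; [:: 2; 19; 22; 26]; [:: 3; 5; 7; 37]; [:: 3; 5; 10; 28]; [:: 3; 5; 14; 39];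
    [:: 3; 5; 23; 40]; [:: 3; 7; 13; 27]; [:: 3; 7; 17; 36]; [:: 3; 7; 22; 26]; [:: 3; 8; 12; 25];
    [:: 3; 8; 27; 29]; [:: 3; 8; 31; 38]; [:: 3; 9; 10; 17]; [:: 3; 9; 12; 21]; [:: 3; 13; 34; 41];
    [:: 3; 14; 20; 46]; [:: 3; 18; 26; 29]; [:: 4; 5; 7; 30]; [:: 4; 5; 10; 33]; [:: 4; 5; 11; 23];
    [:: 4; 5; 14; 19]; [:: 4; 6; 20; 23]; [:: 4; 6; 21; 31]; [:: 4; 6; 25; 42]; [:: 4; 7; 17; 24];
    [:: 4; 7; 27; 32]; [:: 4; 10; 15; 17]; [:: 4; 11; 35; 43]; [:: 4; 12; 15; 21];
    [:: 4; 12; 25; 44]; [:: 4; 14; 16; 20]] |}.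

Definition batch5 := {|
  aut_order := 48; ncore := 2; tau := 242; depth := 1;
  generators := [::
    [::
      15; 9; 18; 3; 8; 5; 2; 20; 19; 11; 10; 1; 16; 7; 0; 14; 17; 12; 6; 4; 13; 57; 71; 24; 60; 54;
      37; 26; 32; 41; 75; 46; 76; 64; 30; 58; 74; 27; 51; 53; 72; 65; 47; 40; 59; 33; 48; 73; 31;
      38; 25; 49; 52; 55; 50; 39; 21; 56; 61; 70; 23; 35; 62; 66; 45; 29; 67; 63; 36; 22; 44; 69;
      43; 42; 68; 34; 28];
    [::
      28; 27; 23; 3; 34; 25; 4; 36; 24; 26; 21; 1; 29; 31; 0; 32; 33; 22; 30; 2; 35; 56; 45; 19; 75;
      50; 37; 11; 14; 69; 60; 61; 76; 65; 6; 68; 48; 9; 39; 53; 72; 64; 42; 67; 59; 17; 74; 62; 7;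
      55; 5; 49; 52; 38; 54; 51; 10; 57; 46; 70; 18; 13; 73; 43; 71; 16; 40; 63; 20; 12; 44; 41; 66;
      47; 58; 8; 15];
    [::
      28; 27; 23; 3; 34; 29; 2; 21; 30; 32; 36; 0; 25; 35; 1; 26; 22; 33; 24; 4; 31; 61; 50; 6; 60;
      45; 76; 14; 11; 65; 75; 56; 37; 69; 19; 48; 68; 9; 40; 63; 49; 41; 62; 51; 59; 12; 58; 42; 13;
      38; 16; 72; 52; 55; 71; 67; 20; 46; 57; 70; 18; 7; 47; 66; 54; 5; 39; 53; 10; 17; 44; 64; 43;
      73; 74; 8; 15]];
  keys := [::
    (false, 53); (false, 24); (false, 6); (false, 63); (false, 9); (false, 31); (false, 69);
    (false, 0); (false, 21); (false, 1)];
  reps := [::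
    0x2011c03116006b94cc00; 0x2008b27028c0c0ce200c; 0x202c5241154b10004638; 0x204783028c3248120249;
    0x20492988024314d88540; 0x204529000b870c5c0640; 0x2024744814d30800c0b8; 0x21b8ca08802024a2418a;
    0x2041298003c7145c8440; 0x200b87858205480220b1; 0x2015b041c10c260a02a2; 0x20aec30002202c782190;
    0x2021e1c0033c045880a4; 0x202471282038645181a0; 0x20059440c13c2a0a28a0; 0x200114a8c23c284b2880;
    0x208274881c900c418898; 0x20438382847250128049; 0x20243823307a20048312; 0x20490a884256106cc840;
    0x204d0a084a16086c4a40; 0x203320a9e00864020386; 0x200ba285c204541200b2; 0x20072524c28548122031;
    0x20169348440036590181; 0x2022f1800138465281a0; 0x204483468c3031198009; 0x204c0a0c68145125c820;
    0x20442904298555158420]%positive;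
  systems := [::
    [:: 2; 5; 22]; [:: 2; 5; 25]; [:: 2; 11; 19]; [:: 2; 12; 20]; [:: 3; 4; 21]; [:: 3; 8; 13];
    [:: 3; 10; 28]; [:: 3; 12; 18]; [:: 4; 7; 9]; [:: 4; 7; 15]; [:: 4; 16; 23]; [:: 5; 13; 17];
    [:: 5; 14; 16]; [:: 6; 8; 9]; [:: 6; 8; 15]; [:: 6; 19; 24]; [:: 7; 14; 27]; [:: 10; 20; 26];
    [:: 11; 17; 18]] |}.

Definition batch6 := {|
  aut_order := 48; ncore := 2; tau := 242; depth := 1;
  generators := [::
    [::
      15; 9; 18; 3; 8; 5; 2; 20; 19; 11; 10; 1; 16; 7; 0; 14; 17; 12; 6; 4; 13; 57; 71; 24; 60; 54;
      37; 26; 32; 41; 75; 46; 76; 64; 30; 58; 74; 27; 51; 53; 72; 65; 47; 40; 59; 33; 48; 73; 31;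
      38; 25; 49; 52; 55; 50; 39; 21; 56; 61; 70; 23; 35; 62; 66; 45; 29; 67; 63; 36; 22; 44; 69;
      43; 42; 68; 34; 28];
    [::
      28; 27; 23; 3; 34; 25; 4; 36; 24; 26; 21; 1; 29; 31; 0; 32; 33; 22; 30; 2; 35; 56; 45; 19; 75;
      50; 37; 11; 14; 69; 60; 61; 76; 65; 6; 68; 48; 9; 39; 53; 72; 64; 42; 67; 59; 17; 74; 62; 7;
      55; 5; 49; 52; 38; 54; 51; 10; 57; 46; 70; 18; 13; 73; 43; 71; 16; 40; 63; 20; 12; 44; 41; 66;
      47; 58; 8; 15];
    [::
      28; 27; 23; 3; 34; 29; 2; 21; 30; 32; 36; 0; 25; 35; 1; 26; 22; 33; 24; 4; 31; 61; 50; 6; 60;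
      45; 76; 14; 11; 65; 75; 56; 37; 69; 19; 48; 68; 9; 40; 63; 49; 41; 62; 51; 59; 12; 58; 42; 13;
      38; 16; 72; 52; 55; 71; 67; 20; 46; 57; 70; 18; 7; 47; 66; 54; 5; 39; 53; 10; 17; 44; 64; 43;
      73; 74; 8; 15]];
  keys := [::
    (false, 53); (false, 24); (false, 63); (false, 6); (false, 1); (false, 13); (false, 27);
    (false, 64); (false, 11); (false, 5)];
  reps := [::
    0x2011c03116006b94cc00; 0x219e1038404042a22158; 0x202c5241154b10004638; 0x205028480ad5c08ac220;
    0x20492988024314d88540; 0x2024744814d30800c0b8; 0x2023aba0524410008117; 0x205828400b54c48a8a20;
    0x202d720098800c72420c; 0x200b87858205480220b1; 0x2080b5c10483828380c2; 0x2015b041c10c260a02a2;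
    0x2009b285c002165600c2; 0x202471282038645181a0; 0x20059440c13c2a0a28a0; 0x200d3361040a04d11241;
    0x200114a8c23c284b2880; 0x208274881c900c418898; 0x204783028c3248120249; 0x20243823307a20048312;
    0x200b8b20852c24012909; 0x220411487d1112018c0c; 0x200ba285c204541200b2; 0x2009978580030a4620c1;
    0x202c216564030125a006; 0x2012226c4e1a004c4211; 0x2022f1800138465281a0; 0x20438382847250128049;
    0x2052280828d0e44c8b00; 0x2027ab205a0408000317; 0x20490a884256106cc840; 0x204c0a0c68145125c820;
    0x204d0a084a16086c4a40; 0x20038b2884ad20016109; 0x20088b64852b00866009]%positive;
  systems := [::
    [:: 2; 3; 22]; [:: 2; 3; 26]; [:: 2; 6; 10]; [:: 2; 12; 29]; [:: 3; 13; 27]; [:: 3; 14; 17];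
    [:: 4; 8; 9]; [:: 4; 8; 16]; [:: 4; 20; 24]; [:: 4; 21; 25]; [:: 5; 6; 23]; [:: 5; 7; 9];
    [:: 5; 7; 16]; [:: 6; 15; 17]; [:: 7; 13; 18]; [:: 8; 14; 31]; [:: 10; 19; 33]; [:: 11; 18; 28];
    [:: 11; 32; 34]; [:: 12; 19; 20]; [:: 15; 21; 30]] |}.

Definition batch7 := {|
  aut_order := 48; ncore := 2; tau := 242; depth := 5;
  generators := [::
    [::
      15; 9; 18; 3; 8; 5; 2; 20; 19; 11; 10; 1; 16; 7; 0; 14; 17; 12; 6; 4; 13; 57; 71; 24; 60; 54;
      37; 26; 32; 41; 75; 46; 76; 64; 30; 58; 74; 27; 51; 53; 72; 65; 47; 40; 59; 33; 48; 73; 31;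
      38; 25; 49; 52; 55; 50; 39; 21; 56; 61; 70; 23; 35; 62; 66; 45; 29; 67; 63; 36; 22; 44; 69;
      43; 42; 68; 34; 28];
    [::
      28; 27; 23; 3; 34; 25; 4; 36; 24; 26; 21; 1; 29; 31; 0; 32; 33; 22; 30; 2; 35; 56; 45; 19; 75;
      50; 37; 11; 14; 69; 60; 61; 76; 65; 6; 68; 48; 9; 39; 53; 72; 64; 42; 67; 59; 17; 74; 62; 7;
      55; 5; 49; 52; 38; 54; 51; 10; 57; 46; 70; 18; 13; 73; 43; 71; 16; 40; 63; 20; 12; 44; 41; 66;
      47; 58; 8; 15];
    [::
      28; 27; 23; 3; 34; 29; 2; 21; 30; 32; 36; 0; 25; 35; 1; 26; 22; 33; 24; 4; 31; 61; 50; 6; 60;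
      45; 76; 14; 11; 65; 75; 56; 37; 69; 19; 48; 68; 9; 40; 63; 49; 41; 62; 51; 59; 12; 58; 42; 13;
      38; 16; 72; 52; 55; 71; 67; 20; 46; 57; 70; 18; 7; 47; 66; 54; 5; 39; 53; 10; 17; 44; 64; 43;
      73; 74; 8; 15]];
  keys := [::
    (false, 10); (false, 60); (false, 18); (false, 21); (false, 64); (false, 1); (false, 27);
    (false, 74); (false, 23); (false, 54); (false, 0); (false, 2); (false, 3)];
  reps := [::
    0x2011c03116006b94cc00; 0x200db41a204a01880538; 0x204783028c3248120249; 0x200b8b20852c24012909;
    0x20438382847250128049; 0x2023aba0524410008117; 0x205028480ad5c08ac220; 0x20490a884256106cc840;
    0x204529000b870c5c0640; 0x20038b2884ad20016109; 0x200b87858205480220b1; 0x20a86260283840a2e024;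
    0x208c3161440302a3a042; 0x200114a8c23c284b2880; 0x221c1004d34096120a18; 0x204483468c3031198009;
    0x20460c8860807c5c0980; 0x205828400b54c48a8a20; 0x2027ab205a0408000317; 0x2041298003c7145c8440;
    0x204c0a0c68145125c820; 0x204d0a084a16086c4a40; 0x20088b64852b00866009; 0x2029728090c01472c00c;
    0x21b8ca08802024a2418a; 0x202d720098800c72420c; 0x203320a9e00864020386; 0x200ba285c204541200b2;
    0x2080b5c10483828380c2; 0x20072524c28548122031; 0x20b8666028004c8220a5; 0x2009b285c002165600c2;
    0x2009978580030a4620c1; 0x20aec30002202c782190; 0x2029a2c5c00015921086; 0x20053524c0830a562041;
    0x2021e1c0033c045880a4; 0x20169348440036590181; 0x202c216564030125a006; 0x2012226c4e1a004c4211;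
    0x2022f1800138465281a0; 0x2020a5c5248381058086; 0x208274881c900c418898; 0x2052280828d0e44c8b00;
    0x20442904298555158420; 0x220411487d1112018c0c]%positive;
  systems := [::
    [:: 2; 5; 11]; [:: 2; 5; 12]; [:: 2; 16; 30]; [:: 2; 16; 34]; [:: 2; 17; 26]; [:: 2; 36; 43];
    [:: 3; 7; 11]; [:: 3; 7; 12]; [:: 3; 19; 38]; [:: 3; 20; 30]; [:: 3; 20; 34]; [:: 3; 31; 44];
    [:: 4; 6; 26]; [:: 4; 11; 18]; [:: 4; 12; 18]; [:: 4; 16; 41]; [:: 4; 33; 43]; [:: 5; 15; 28];
    [:: 5; 24; 32]; [:: 5; 35; 42]; [:: 6; 10; 14]; [:: 6; 13; 14]; [:: 6; 15; 27]; [:: 6; 15; 40];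
    [:: 7; 22; 33]; [:: 7; 25; 37]; [:: 7; 35; 45]; [:: 8; 9; 38]; [:: 8; 10; 23]; [:: 8; 13; 23];
    [:: 8; 22; 27]; [:: 8; 22; 40]; [:: 9; 11; 21]; [:: 9; 12; 21]; [:: 9; 20; 41]; [:: 9; 28; 44];
    [:: 10; 17; 24]; [:: 10; 19; 25]; [:: 13; 17; 24]; [:: 13; 19; 25]; [:: 14; 16; 39];
    [:: 14; 18; 32]; [:: 15; 18; 31]; [:: 17; 29; 42]; [:: 19; 39; 45]; [:: 20; 23; 29];
    [:: 21; 22; 36]; [:: 21; 23; 37]] |}.

Definition batch8 := {|
  aut_order := 48; ncore := 2; tau := 242; depth := 1;
  generators := [::
    [::
      15; 9; 18; 3; 8; 5; 2; 20; 19; 11; 10; 1; 16; 7; 0; 14; 17; 12; 6; 4; 13; 57; 71; 24; 60; 54;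
      37; 26; 32; 41; 75; 46; 76; 64; 30; 58; 74; 27; 51; 53; 72; 65; 47; 40; 59; 33; 48; 73; 31;
      38; 25; 49; 52; 55; 50; 39; 21; 56; 61; 70; 23; 35; 62; 66; 45; 29; 67; 63; 36; 22; 44; 69;
      43; 42; 68; 34; 28];
    [::
      28; 27; 23; 3; 34; 25; 4; 36; 24; 26; 21; 1; 29; 31; 0; 32; 33; 22; 30; 2; 35; 56; 45; 19; 75;
      50; 37; 11; 14; 69; 60; 61; 76; 65; 6; 68; 48; 9; 39; 53; 72; 64; 42; 67; 59; 17; 74; 62; 7;
      55; 5; 49; 52; 38; 54; 51; 10; 57; 46; 70; 18; 13; 73; 43; 71; 16; 40; 63; 20; 12; 44; 41; 66;
      47; 58; 8; 15];
    [::
      28; 27; 23; 3; 34; 29; 2; 21; 30; 32; 36; 0; 25; 35; 1; 26; 22; 33; 24; 4; 31; 61; 50; 6; 60;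
      45; 76; 14; 11; 65; 75; 56; 37; 69; 19; 48; 68; 9; 40; 63; 49; 41; 62; 51; 59; 12; 58; 42; 13;
      38; 16; 72; 52; 55; 71; 67; 20; 46; 57; 70; 18; 7; 47; 66; 54; 5; 39; 53; 10; 17; 44; 64; 43;
      73; 74; 8; 15]];
  keys := [::
    (false, 44); (false, 59); (false, 9); (false, 55); (false, 15); (false, 38); (false, 5);
    (false, 32); (false, 35); (false, 6); (false, 8); (false, 41); (false, 1)];
  reps := [::
    0x205428c802958182c260; 0x2008b27028c0c0ce200c; 0x2000c15392109d0d5100; 0x2003e20140e62300f410;
    0x202471282038645181a0; 0x20059440c13c2a0a28a0; 0x200114a8c23c284b2880; 0x208274881c900c418898;
    0x201c500457408e128818; 0x2005520934c92800d418; 0x202c5241154b10004638; 0x2191603090085c264160;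
    0x20021e948c39040b0051; 0x203320a9e00864020386; 0x200ba285c204541200b2; 0x2022f1800138465281a0;
    0x2008482be2360405600a; 0x20438382847250128049; 0x204483468c3031198009; 0x2091e01290081d2e4120;
    0x213060349008256cc300; 0x20161914846145132011]%positive;
  systems := [::
    [:: 2; 4; 17]; [:: 2; 5; 7]; [:: 2; 10; 14]; [:: 2; 10; 15]; [:: 3; 7; 21]; [:: 3; 18; 20];
    [:: 4; 8; 12]; [:: 5; 11; 16]; [:: 6; 8; 19]; [:: 6; 9; 11]; [:: 9; 12; 13]] |}.

Definition batch9 := {|
  aut_order := 48; ncore := 2; tau := 242; depth := 1;
  generators := [::
    [::
      15; 9; 18; 3; 8; 5; 2; 20; 19; 11; 10; 1; 16; 7; 0; 14; 17; 12; 6; 4; 13; 57; 71; 24; 60; 54;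
      37; 26; 32; 41; 75; 46; 76; 64; 30; 58; 74; 27; 51; 53; 72; 65; 47; 40; 59; 33; 48; 73; 31;
      38; 25; 49; 52; 55; 50; 39; 21; 56; 61; 70; 23; 35; 62; 66; 45; 29; 67; 63; 36; 22; 44; 69;
      43; 42; 68; 34; 28];
    [::
      28; 27; 23; 3; 34; 25; 4; 36; 24; 26; 21; 1; 29; 31; 0; 32; 33; 22; 30; 2; 35; 56; 45; 19; 75;
      50; 37; 11; 14; 69; 60; 61; 76; 65; 6; 68; 48; 9; 39; 53; 72; 64; 42; 67; 59; 17; 74; 62; 7;
      55; 5; 49; 52; 38; 54; 51; 10; 57; 46; 70; 18; 13; 73; 43; 71; 16; 40; 63; 20; 12; 44; 41; 66;
      47; 58; 8; 15];
    [::
      28; 27; 23; 3; 34; 29; 2; 21; 30; 32; 36; 0; 25; 35; 1; 26; 22; 33; 24; 4; 31; 61; 50; 6; 60;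
      45; 76; 14; 11; 65; 75; 56; 37; 69; 19; 48; 68; 9; 40; 63; 49; 41; 62; 51; 59; 12; 58; 42; 13;
      38; 16; 72; 52; 55; 71; 67; 20; 46; 57; 70; 18; 7; 47; 66; 54; 5; 39; 53; 10; 17; 44; 64; 43;
      73; 74; 8; 15]];
  keys := [::
    (true, 0); (false, 14); (false, 30); (false, 65); (false, 0); (false, 39); (false, 57);
    (false, 60); (false, 41)];
  reps := [::
    0x205428c802958182c260; 0x219e1038404042a22158; 0x2000c23474098c8e9040; 0x200c5441b8808e01620c;
    0x2003e20140e62300f410; 0x2009a584c02203d2a804; 0x202471282038645181a0; 0x20059440c13c2a0a28a0;
    0x208274881c900c418898; 0x202c5241154b10004638; 0x2091e01290081d2e4120; 0x213060349008256cc300;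
    0x200ba285c204541200b2; 0x200b87858205480220b1; 0x202c216564030125a006; 0x2022f1800138465281a0;
    0x200114a8c23c284b2880; 0x2022c230540d94090360; 0x2049165084a418932005; 0x2080e170140249c4e880;
    0x2008482be2360405600a; 0x20438382847250128049; 0x2005520934c92800d418; 0x20021e948c39040b0051;
    0x2002c113b012c604c340; 0x20045148f9101601c40c; 0x220411487d1112018c0c; 0x20088b64852b00866009]%positive;
  systems := [::
    [:: 2; 6; 21]; [:: 2; 7; 8]; [:: 2; 9; 12]; [:: 2; 9; 15]; [:: 3; 6; 23]; [:: 3; 10; 13];
    [:: 3; 10; 16]; [:: 4; 8; 18]; [:: 4; 11; 27]; [:: 5; 11; 25]; [:: 5; 24; 26]; [:: 7; 19; 20];
    [:: 14; 17; 22]] |}.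

Definition batch10 := {|
  aut_order := 48; ncore := 2; tau := 242; depth := 1;
  generators := [::
    [::
      15; 9; 18; 3; 8; 5; 2; 20; 19; 11; 10; 1; 16; 7; 0; 14; 17; 12; 6; 4; 13; 57; 71; 24; 60; 54;
      37; 26; 32; 41; 75; 46; 76; 64; 30; 58; 74; 27; 51; 53; 72; 65; 47; 40; 59; 33; 48; 73; 31;
      38; 25; 49; 52; 55; 50; 39; 21; 56; 61; 70; 23; 35; 62; 66; 45; 29; 67; 63; 36; 22; 44; 69;
      43; 42; 68; 34; 28];
    [::
      28; 27; 23; 3; 34; 25; 4; 36; 24; 26; 21; 1; 29; 31; 0; 32; 33; 22; 30; 2; 35; 56; 45; 19; 75;
      50; 37; 11; 14; 69; 60; 61; 76; 65; 6; 68; 48; 9; 39; 53; 72; 64; 42; 67; 59; 17; 74; 62; 7;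
      55; 5; 49; 52; 38; 54; 51; 10; 57; 46; 70; 18; 13; 73; 43; 71; 16; 40; 63; 20; 12; 44; 41; 66;
      47; 58; 8; 15];
    [::
      28; 27; 23; 3; 34; 29; 2; 21; 30; 32; 36; 0; 25; 35; 1; 26; 22; 33; 24; 4; 31; 61; 50; 6; 60;
      45; 76; 14; 11; 65; 75; 56; 37; 69; 19; 48; 68; 9; 40; 63; 49; 41; 62; 51; 59; 12; 58; 42; 13;
      38; 16; 72; 52; 55; 71; 67; 20; 46; 57; 70; 18; 7; 47; 66; 54; 5; 39; 53; 10; 17; 44; 64; 43;
      73; 74; 8; 15]];
  keys := [::
    (true, 0); (false, 14); (false, 30); (false, 65); (false, 0); (false, 39); (false, 57);
    (false, 60); (false, 41)];
  reps := [::
    0x205428c802958182c260; 0x200db41a204a01880538; 0x200b87858205480220b1; 0x2000c23474098c8e9040;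
    0x2000c15392109d0d5100; 0x20438382847250128049; 0x213060349008256cc300; 0x20038b2884ad20016109;
    0x203320a9e00864020386; 0x200ba285c204541200b2; 0x200164a160aa8c071044; 0x200cd04540208f933080;
    0x202c216564030125a006; 0x2008626168226282e404; 0x2022f1800138465281a0; 0x2001a3c104aa11555004;
    0x2022e13014054d01a1a0; 0x2022c230540d94090360; 0x204483468c3031198009; 0x201c500457408e128818;
    0x20021e948c39040b0051; 0x220411487d1112018c0c; 0x20088b64852b00866009; 0x200c5441b8808e01620c;
    0x2080e170140249c4e880; 0x208274881c900c418898; 0x221c1004d34096120a18; 0x2191603090085c264160;
    0x2002c113b012c604c340; 0x20045148f9101601c40c; 0x2029728090c01472c00c]%positive;
  systems := [::
    [:: 2; 3; 26]; [:: 2; 4; 30]; [:: 2; 19; 24]; [:: 2; 23; 27]; [:: 3; 5; 8]; [:: 3; 9; 18];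
    [:: 3; 14; 18]; [:: 4; 7; 12]; [:: 4; 9; 22]; [:: 4; 14; 22]; [:: 5; 10; 16]; [:: 5; 13; 16];
    [:: 6; 7; 10]; [:: 6; 7; 13]; [:: 6; 15; 29]; [:: 8; 20; 23]; [:: 11; 17; 25]; [:: 11; 20; 21];
    [:: 12; 17; 19]; [:: 15; 21; 28]] |}.

Definition batch11 := {|
  aut_order := 48; ncore := 1; tau := 134; depth := 1;
  generators := [::
    [::
      15; 9; 18; 3; 8; 5; 2; 20; 19; 11; 10; 1; 16; 7; 0; 14; 17; 12; 6; 4; 13; 57; 71; 24; 60; 54;
      37; 26; 32; 41; 75; 46; 76; 64; 30; 58; 74; 27; 51; 53; 72; 65; 47; 40; 59; 33; 48; 73; 31;
      38; 25; 49; 52; 55; 50; 39; 21; 56; 61; 70; 23; 35; 62; 66; 45; 29; 67; 63; 36; 22; 44; 69;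
      43; 42; 68; 34; 28];
    [::
      28; 27; 23; 3; 34; 25; 4; 36; 24; 26; 21; 1; 29; 31; 0; 32; 33; 22; 30; 2; 35; 56; 45; 19; 75;
      50; 37; 11; 14; 69; 60; 61; 76; 65; 6; 68; 48; 9; 39; 53; 72; 64; 42; 67; 59; 17; 74; 62; 7;
      55; 5; 49; 52; 38; 54; 51; 10; 57; 46; 70; 18; 13; 73; 43; 71; 16; 40; 63; 20; 12; 44; 41; 66;
      47; 58; 8; 15];
    [::
      28; 27; 23; 3; 34; 29; 2; 21; 30; 32; 36; 0; 25; 35; 1; 26; 22; 33; 24; 4; 31; 61; 50; 6; 60;
      45; 76; 14; 11; 65; 75; 56; 37; 69; 19; 48; 68; 9; 40; 63; 49; 41; 62; 51; 59; 12; 58; 42; 13;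
      38; 16; 72; 52; 55; 71; 67; 20; 46; 57; 70; 18; 7; 47; 66; 54; 5; 39; 53; 10; 17; 44; 64; 43;
      73; 74; 8; 15]];
  keys := [::
    (false, 53); (false, 30); (false, 63); (false, 19); (false, 13); (false, 25); (false, 8);
    (false, 9); (false, 48); (false, 0); (false, 1); (false, 5)];
  reps := [::
    0x2022c230540cd1014b20; 0x2081220fe80454130092; 0x200db41a204a01880538; 0x2014500c56c18a12c018;
    0x205828400b50dc0e0920; 0x2041298003c65154cc00; 0x200854c1b0c09601e00c]%positive;
  systems := [::
    [:: 1; 2; 3; 4]; [:: 1; 2; 5; 6]] |}.

Definition batch12 := {|
  aut_order := 48; ncore := 1; tau := 134; depth := 1;
  generators := [::
    [::
      15; 9; 18; 3; 8; 5; 2; 20; 19; 11; 10; 1; 16; 7; 0; 14; 17; 12; 6; 4; 13; 57; 71; 24; 60; 54;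
      37; 26; 32; 41; 75; 46; 76; 64; 30; 58; 74; 27; 51; 53; 72; 65; 47; 40; 59; 33; 48; 73; 31;
      38; 25; 49; 52; 55; 50; 39; 21; 56; 61; 70; 23; 35; 62; 66; 45; 29; 67; 63; 36; 22; 44; 69;
      43; 42; 68; 34; 28];
    [::
      28; 27; 23; 3; 34; 25; 4; 36; 24; 26; 21; 1; 29; 31; 0; 32; 33; 22; 30; 2; 35; 56; 45; 19; 75;
      50; 37; 11; 14; 69; 60; 61; 76; 65; 6; 68; 48; 9; 39; 53; 72; 64; 42; 67; 59; 17; 74; 62; 7;
      55; 5; 49; 52; 38; 54; 51; 10; 57; 46; 70; 18; 13; 73; 43; 71; 16; 40; 63; 20; 12; 44; 41; 66;
      47; 58; 8; 15];
    [::
      28; 27; 23; 3; 34; 29; 2; 21; 30; 32; 36; 0; 25; 35; 1; 26; 22; 33; 24; 4; 31; 61; 50; 6; 60;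
      45; 76; 14; 11; 65; 75; 56; 37; 69; 19; 48; 68; 9; 40; 63; 49; 41; 62; 51; 59; 12; 58; 42; 13;
      38; 16; 72; 52; 55; 71; 67; 20; 46; 57; 70; 18; 7; 47; 66; 54; 5; 39; 53; 10; 17; 44; 64; 43;
      73; 74; 8; 15]];
  keys := [::
    (false, 52); (false, 44); (false, 42); (false, 14); (false, 59); (false, 5); (false, 1);
    (false, 60); (false, 58); (false, 11); (false, 0)];
  reps := [::
    0x2032c031140155950620; 0x200db41a204a01880538; 0x201130a9c20c244b0282; 0x2091f3080814064180e1;
    0x2014500c56c18a12c018; 0x205828400b50dc0e0920; 0x2041298003c65154cc00; 0x200854c1b0c09601e00c]%positive;
  systems := [::
    [:: 1; 2; 4; 5]; [:: 1; 2; 6; 7]; [:: 1; 3; 4; 5]; [:: 1; 3; 6; 7]] |}.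

Definition batch13 := {|
  aut_order := 48; ncore := 1; tau := 134; depth := 1;
  generators := [::
    [::
      15; 9; 18; 3; 8; 5; 2; 20; 19; 11; 10; 1; 16; 7; 0; 14; 17; 12; 6; 4; 13; 57; 71; 24; 60; 54;
      37; 26; 32; 41; 75; 46; 76; 64; 30; 58; 74; 27; 51; 53; 72; 65; 47; 40; 59; 33; 48; 73; 31;
      38; 25; 49; 52; 55; 50; 39; 21; 56; 61; 70; 23; 35; 62; 66; 45; 29; 67; 63; 36; 22; 44; 69;
      43; 42; 68; 34; 28];
    [::
      28; 27; 23; 3; 34; 25; 4; 36; 24; 26; 21; 1; 29; 31; 0; 32; 33; 22; 30; 2; 35; 56; 45; 19; 75;
      50; 37; 11; 14; 69; 60; 61; 76; 65; 6; 68; 48; 9; 39; 53; 72; 64; 42; 67; 59; 17; 74; 62; 7;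
      55; 5; 49; 52; 38; 54; 51; 10; 57; 46; 70; 18; 13; 73; 43; 71; 16; 40; 63; 20; 12; 44; 41; 66;
      47; 58; 8; 15];
    [::
      28; 27; 23; 3; 34; 29; 2; 21; 30; 32; 36; 0; 25; 35; 1; 26; 22; 33; 24; 4; 31; 61; 50; 6; 60;
      45; 76; 14; 11; 65; 75; 56; 37; 69; 19; 48; 68; 9; 40; 63; 49; 41; 62; 51; 59; 12; 58; 42; 13;
      38; 16; 72; 52; 55; 71; 67; 20; 46; 57; 70; 18; 7; 47; 66; 54; 5; 39; 53; 10; 17; 44; 64; 43;
      73; 74; 8; 15]];
  keys := [::
    (false, 70); (false, 44); (false, 2); (false, 38); (false, 45); (false, 57); (false, 8);
    (false, 13); (false, 0); (false, 1); (false, 6); (false, 14); (false, 21); (false, 22);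
    (false, 26)];
  reps := [::
    0x2023aba0524410008117; 0x201124a9823029472810; 0x200db41a204a01880538; 0x2080e17014030ccca0c0;
    0x2014500c56c18a12c018; 0x21916030900c44a2c260; 0x200854c1b0c09601e00c]%positive;
  systems := [::
    [:: 1; 2; 3; 4]; [:: 1; 2; 5; 6]] |}.

Definition batch14 := {|
  aut_order := 48; ncore := 1; tau := 170; depth := 1;
  generators := [::
    [::
      15; 9; 18; 3; 8; 5; 2; 20; 19; 11; 10; 1; 16; 7; 0; 14; 17; 12; 6; 4; 13; 57; 71; 24; 60; 54;
      37; 26; 32; 41; 75; 46; 76; 64; 30; 58; 74; 27; 51; 53; 72; 65; 47; 40; 59; 33; 48; 73; 31;
      38; 25; 49; 52; 55; 50; 39; 21; 56; 61; 70; 23; 35; 62; 66; 45; 29; 67; 63; 36; 22; 44; 69;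
      43; 42; 68; 34; 28];
    [::
      28; 27; 23; 3; 34; 25; 4; 36; 24; 26; 21; 1; 29; 31; 0; 32; 33; 22; 30; 2; 35; 56; 45; 19; 75;
      50; 37; 11; 14; 69; 60; 61; 76; 65; 6; 68; 48; 9; 39; 53; 72; 64; 42; 67; 59; 17; 74; 62; 7;
      55; 5; 49; 52; 38; 54; 51; 10; 57; 46; 70; 18; 13; 73; 43; 71; 16; 40; 63; 20; 12; 44; 41; 66;
      47; 58; 8; 15];
    [::
      28; 27; 23; 3; 34; 29; 2; 21; 30; 32; 36; 0; 25; 35; 1; 26; 22; 33; 24; 4; 31; 61; 50; 6; 60;
      45; 76; 14; 11; 65; 75; 56; 37; 69; 19; 48; 68; 9; 40; 63; 49; 41; 62; 51; 59; 12; 58; 42; 13;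
      38; 16; 72; 52; 55; 71; 67; 20; 46; 57; 70; 18; 7; 47; 66; 54; 5; 39; 53; 10; 17; 44; 64; 43;
      73; 74; 8; 15]];
  keys := [::
    (false, 44); (false, 42); (false, 26); (false, 59); (false, 7); (false, 71); (false, 21);
    (false, 2); (false, 53); (false, 0); (false, 1); (false, 6); (false, 40); (false, 5)];
  reps := [::
    0x2180615214070c48a1c0; 0x200db41a204a01880538; 0x200b87858205480220b1; 0x200114a8c23c284b2880;
    0x2014500c56c18a12c018; 0x205828400b50dc0e0920; 0x2041298003c65154cc00; 0x200854c1b0c09601e00c]%positive;
  systems := [::
    [:: 1; 2; 4; 5]; [:: 1; 2; 6; 7]; [:: 1; 3; 4; 5]; [:: 1; 3; 6; 7]] |}.

Definition batch15 := {|
  aut_order := 48; ncore := 1; tau := 170; depth := 1;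
  generators := [::
    [::
      15; 9; 18; 3; 8; 5; 2; 20; 19; 11; 10; 1; 16; 7; 0; 14; 17; 12; 6; 4; 13; 57; 71; 24; 60; 54;
      37; 26; 32; 41; 75; 46; 76; 64; 30; 58; 74; 27; 51; 53; 72; 65; 47; 40; 59; 33; 48; 73; 31;
      38; 25; 49; 52; 55; 50; 39; 21; 56; 61; 70; 23; 35; 62; 66; 45; 29; 67; 63; 36; 22; 44; 69;
      43; 42; 68; 34; 28];
    [::
      28; 27; 23; 3; 34; 25; 4; 36; 24; 26; 21; 1; 29; 31; 0; 32; 33; 22; 30; 2; 35; 56; 45; 19; 75;
      50; 37; 11; 14; 69; 60; 61; 76; 65; 6; 68; 48; 9; 39; 53; 72; 64; 42; 67; 59; 17; 74; 62; 7;
      55; 5; 49; 52; 38; 54; 51; 10; 57; 46; 70; 18; 13; 73; 43; 71; 16; 40; 63; 20; 12; 44; 41; 66;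
      47; 58; 8; 15];
    [::
      28; 27; 23; 3; 34; 29; 2; 21; 30; 32; 36; 0; 25; 35; 1; 26; 22; 33; 24; 4; 31; 61; 50; 6; 60;
      45; 76; 14; 11; 65; 75; 56; 37; 69; 19; 48; 68; 9; 40; 63; 49; 41; 62; 51; 59; 12; 58; 42; 13;
      38; 16; 72; 52; 55; 71; 67; 20; 46; 57; 70; 18; 7; 47; 66; 54; 5; 39; 53; 10; 17; 44; 64; 43;
      73; 74; 8; 15]];
  keys := [::
    (false, 44); (false, 59); (false, 9); (false, 38); (false, 3); (false, 31); (false, 2);
    (false, 37); (false, 41); (false, 1); (false, 0); (false, 6); (false, 14)];
  reps := [::
    0x205c28c003109d060960; 0x200b87858205480220b1; 0x200db41a204a01880538; 0x2080e17014030ccca0c0;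
    0x2014500c56c18a12c018; 0x21916030900c44a2c260; 0x200854c1b0c09601e00c]%positive;
  systems := [::
    [:: 1; 2; 3; 4]; [:: 1; 2; 5; 6]] |}.

Definition batch16 := {|
  aut_order := 16; ncore := 1; tau := 140; depth := 1;
  generators := [::
    [::
      1; 0; 4; 3; 2; 16; 19; 13; 8; 9; 20; 14; 17; 7; 11; 15; 5; 12; 18; 6; 10; 36; 33; 23; 30; 29;
      32; 27; 28; 25; 24; 35; 26; 22; 34; 31; 21; 76; 55; 40; 39; 64; 62; 66; 44; 50; 57; 73; 68;
      72; 45; 67; 52; 63; 71; 38; 61; 46; 74; 59; 75; 56; 42; 53; 41; 69; 43; 51; 48; 65; 70; 54;
      49; 47; 58; 60; 37];
    [::
      76; 37; 75; 3; 60; 64; 30; 57; 8; 15; 58; 32; 54; 46; 26; 9; 41; 71; 18; 24; 74; 68; 50; 23;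
      19; 65; 14; 28; 27; 69; 6; 56; 11; 45; 34; 61; 48; 1; 66; 40; 39; 16; 73; 55; 44; 33; 13; 62;
      36; 49; 22; 67; 52; 53; 12; 43; 31; 7; 10; 59; 4; 35; 47; 63; 5; 25; 38; 51; 21; 29; 70; 17;
      72; 42; 20; 2; 0];
    [::
      76; 37; 60; 3; 75; 65; 6; 56; 34; 28; 68; 14; 50; 61; 11; 27; 69; 45; 23; 19; 48; 58; 54; 18;
      24; 64; 32; 15; 9; 41; 30; 57; 26; 71; 8; 46; 74; 1; 43; 67; 51; 29; 62; 38; 44; 17; 35; 73;
      20; 49; 12; 40; 52; 53; 22; 66; 7; 31; 21; 59; 2; 13; 42; 63; 25; 5; 55; 39; 10; 16; 70; 33;
      72; 47; 36; 4; 0];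
    [::
      37; 76; 60; 3; 75; 71; 30; 74; 18; 9; 46; 32; 41; 58; 26; 15; 54; 64; 8; 24; 57; 61; 69; 34;
      19; 45; 14; 27; 28; 50; 6; 48; 11; 65; 23; 68; 56; 0; 55; 67; 51; 12; 42; 66; 44; 25; 10; 47;
      31; 63; 29; 40; 52; 72; 16; 38; 36; 20; 13; 59; 2; 21; 62; 49; 17; 33; 43; 39; 35; 22; 70; 5;
      53; 73; 7; 4; 1]];
  keys := [::
    (false, 9); (false, 63); (false, 40); (false, 1); (false, 22); (false, 25); (false, 57);
    (false, 28); (false, 17)];
  reps := [::
    0x20039200c93c224a2e00; 0x29503428508025491803; 0x21f0c2000c629101064a; 0x29583420510246020863;
    0x204c0a0c68145125c820; 0x204c0a0c6815142d8060; 0x20243823307a20048312; 0x24841822526418932012;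
    0x28415014278c88148403; 0x204440a36628681a800a; 0x21b8ca08802024a2418a; 0x2100cd00a3a68405440a;
    0x2029943108c042bd000c; 0x200cb2f0208081c6204c; 0x200a5180d2d21400d40c; 0x220a118056d310009c0c;
    0x2088913448ca408c108c; 0x28e25050058890900703; 0x20460c8860807c5c0980; 0x2029728090c01472c00c;
    0x200c5441b8808e01620c; 0x2096500854c094510a18; 0x202c5241154b10004638; 0x282398a0125010b48403;
    0x28849864380888842283; 0x2188111648ce4008118c; 0x264a501440a238040585; 0x22d8511002bc00809225;
    0x2268561020a01a542105; 0x2249705100a480a38205; 0x213060349008256cc300; 0x2002c113b012c604c340;
    0x21916030900c44a2c260; 0x2000c15392148589d200; 0x202c925b005021881198; 0x219e1038404042a22158;
    0x280658d0a21085006443; 0x28a15814884844384083; 0x23086846412684020989; 0x2238cc20033006940829;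
    0x2208e864412284860889; 0x2280cb2820a900c47009; 0x2011c03116012e9c8440; 0x2011c03116006b94cc00;
    0x2000c23474098c8e9040; 0x2000c2347408c986d800; 0x22945910026043506811; 0x22945910026106582051;
    0x23446064482031298409; 0x260658144061842b0051; 0x22057851006261004c91; 0x22245e10207904081071;
    0x220578510063240804d1; 0x22245e10207841005831; 0x260658144060c1234811; 0x22c4c302283052108069]%positive;
  systems := [::
    [:: 1; 2; 4; 6; 8; 12; 14; 32; 40; 46]; [:: 1; 2; 4; 6; 8; 12; 14; 32; 41; 49];
    [:: 1; 2; 4; 6; 8; 12; 15; 33; 40; 46]; [:: 1; 2; 4; 6; 8; 12; 15; 33; 41; 49];
    [:: 1; 2; 4; 6; 8; 13; 14; 32; 38; 46]; [:: 1; 2; 4; 6; 8; 13; 14; 32; 39; 49];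
    [:: 1; 2; 4; 6; 8; 13; 15; 33; 38; 46]; [:: 1; 2; 4; 6; 8; 13; 15; 33; 39; 49];
    [:: 1; 2; 4; 6; 8; 16; 19; 33; 38; 46]; [:: 1; 2; 4; 6; 8; 16; 19; 33; 39; 49];
    [:: 1; 2; 4; 6; 8; 16; 20; 32; 38; 46]; [:: 1; 2; 4; 6; 8; 16; 20; 32; 39; 49];
    [:: 1; 2; 4; 6; 8; 19; 25; 33; 40; 46]; [:: 1; 2; 4; 6; 8; 19; 25; 33; 41; 49];
    [:: 1; 2; 4; 6; 8; 20; 25; 32; 40; 46]; [:: 1; 2; 4; 6; 8; 20; 25; 32; 41; 49];
    [:: 1; 2; 4; 6; 14; 28; 35; 37; 38; 44]; [:: 1; 2; 4; 6; 14; 28; 35; 37; 40; 43];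
    [:: 1; 2; 4; 6; 14; 29; 35; 37; 39; 44]; [:: 1; 2; 4; 6; 14; 29; 35; 37; 41; 43];
    [:: 1; 2; 4; 6; 15; 28; 35; 36; 38; 44]; [:: 1; 2; 4; 6; 15; 28; 35; 36; 40; 43];
    [:: 1; 2; 4; 6; 15; 29; 35; 36; 39; 44]; [:: 1; 2; 4; 6; 15; 29; 35; 36; 41; 43];
    [:: 1; 2; 4; 6; 19; 26; 35; 36; 39; 44]; [:: 1; 2; 4; 6; 19; 26; 35; 36; 41; 43];
    [:: 1; 2; 4; 6; 19; 27; 35; 36; 38; 44]; [:: 1; 2; 4; 6; 19; 27; 35; 36; 40; 43];
    [:: 1; 2; 4; 6; 20; 26; 35; 37; 39; 44]; [:: 1; 2; 4; 6; 20; 26; 35; 37; 41; 43];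
    [:: 1; 2; 4; 6; 20; 27; 35; 37; 38; 44]; [:: 1; 2; 4; 6; 20; 27; 35; 37; 40; 43];
    [:: 1; 2; 4; 7; 8; 12; 14; 32; 40; 51]; [:: 1; 2; 4; 7; 8; 12; 14; 32; 41; 50];
    [:: 1; 2; 4; 7; 8; 12; 15; 33; 40; 51]; [:: 1; 2; 4; 7; 8; 12; 15; 33; 41; 50];
    [:: 1; 2; 4; 7; 8; 13; 14; 32; 38; 51]; [:: 1; 2; 4; 7; 8; 13; 14; 32; 39; 50];
    [:: 1; 2; 4; 7; 8; 13; 15; 33; 38; 51]; [:: 1; 2; 4; 7; 8; 13; 15; 33; 39; 50];
    [:: 1; 2; 4; 7; 8; 16; 19; 33; 38; 51]; [:: 1; 2; 4; 7; 8; 16; 19; 33; 39; 50];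
    [:: 1; 2; 4; 7; 8; 16; 20; 32; 38; 51]; [:: 1; 2; 4; 7; 8; 16; 20; 32; 39; 50];
    [:: 1; 2; 4; 7; 8; 19; 25; 33; 40; 51]; [:: 1; 2; 4; 7; 8; 19; 25; 33; 41; 50];
    [:: 1; 2; 4; 7; 8; 20; 25; 32; 40; 51]; [:: 1; 2; 4; 7; 8; 20; 25; 32; 41; 50];
    [:: 1; 2; 4; 7; 14; 28; 34; 37; 38; 44]; [:: 1; 2; 4; 7; 14; 28; 34; 37; 40; 43];
    [:: 1; 2; 4; 7; 14; 29; 34; 37; 39; 44]; [:: 1; 2; 4; 7; 14; 29; 34; 37; 41; 43];
    [:: 1; 2; 4; 7; 15; 28; 34; 36; 38; 44]; [:: 1; 2; 4; 7; 15; 28; 34; 36; 40; 43];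
    [:: 1; 2; 4; 7; 15; 29; 34; 36; 39; 44]; [:: 1; 2; 4; 7; 15; 29; 34; 36; 41; 43];
    [:: 1; 2; 4; 7; 19; 26; 34; 36; 39; 44]; [:: 1; 2; 4; 7; 19; 26; 34; 36; 41; 43];
    [:: 1; 2; 4; 7; 19; 27; 34; 36; 38; 44]; [:: 1; 2; 4; 7; 19; 27; 34; 36; 40; 43];
    [:: 1; 2; 4; 7; 20; 26; 34; 37; 39; 44]; [:: 1; 2; 4; 7; 20; 26; 34; 37; 41; 43];
    [:: 1; 2; 4; 7; 20; 27; 34; 37; 38; 44]; [:: 1; 2; 4; 7; 20; 27; 34; 37; 40; 43];
    [:: 1; 2; 5; 6; 8; 12; 14; 32; 40; 47]; [:: 1; 2; 5; 6; 8; 12; 14; 32; 41; 54];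
    [:: 1; 2; 5; 6; 8; 12; 15; 33; 40; 47]; [:: 1; 2; 5; 6; 8; 12; 15; 33; 41; 54];
    [:: 1; 2; 5; 6; 8; 13; 14; 32; 38; 47]; [:: 1; 2; 5; 6; 8; 13; 14; 32; 39; 54];
    [:: 1; 2; 5; 6; 8; 13; 15; 33; 38; 47]; [:: 1; 2; 5; 6; 8; 13; 15; 33; 39; 54];
    [:: 1; 2; 5; 6; 8; 16; 19; 33; 38; 47]; [:: 1; 2; 5; 6; 8; 16; 19; 33; 39; 54];
    [:: 1; 2; 5; 6; 8; 16; 20; 32; 38; 47]; [:: 1; 2; 5; 6; 8; 16; 20; 32; 39; 54];
    [:: 1; 2; 5; 6; 8; 19; 25; 33; 40; 47]; [:: 1; 2; 5; 6; 8; 19; 25; 33; 41; 54];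
    [:: 1; 2; 5; 6; 8; 20; 25; 32; 40; 47]; [:: 1; 2; 5; 6; 8; 20; 25; 32; 41; 54];
    [:: 1; 2; 5; 6; 14; 28; 35; 37; 38; 45]; [:: 1; 2; 5; 6; 14; 28; 35; 37; 40; 42];
    [:: 1; 2; 5; 6; 14; 29; 35; 37; 39; 45]; [:: 1; 2; 5; 6; 14; 29; 35; 37; 41; 42];
    [:: 1; 2; 5; 6; 15; 28; 35; 36; 38; 45]; [:: 1; 2; 5; 6; 15; 28; 35; 36; 40; 42];
    [:: 1; 2; 5; 6; 15; 29; 35; 36; 39; 45]; [:: 1; 2; 5; 6; 15; 29; 35; 36; 41; 42];
    [:: 1; 2; 5; 6; 19; 26; 35; 36; 39; 45]; [:: 1; 2; 5; 6; 19; 26; 35; 36; 41; 42];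
    [:: 1; 2; 5; 6; 19; 27; 35; 36; 38; 45]; [:: 1; 2; 5; 6; 19; 27; 35; 36; 40; 42];
    [:: 1; 2; 5; 6; 20; 26; 35; 37; 39; 45]; [:: 1; 2; 5; 6; 20; 26; 35; 37; 41; 42];
    [:: 1; 2; 5; 6; 20; 27; 35; 37; 38; 45]; [:: 1; 2; 5; 6; 20; 27; 35; 37; 40; 42];
    [:: 1; 2; 5; 7; 8; 12; 14; 32; 40; 53]; [:: 1; 2; 5; 7; 8; 12; 14; 32; 41; 52];
    [:: 1; 2; 5; 7; 8; 12; 15; 33; 40; 53]; [:: 1; 2; 5; 7; 8; 12; 15; 33; 41; 52];
    [:: 1; 2; 5; 7; 8; 13; 14; 32; 38; 53]; [:: 1; 2; 5; 7; 8; 13; 14; 32; 39; 52];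
    [:: 1; 2; 5; 7; 8; 13; 15; 33; 38; 53]; [:: 1; 2; 5; 7; 8; 13; 15; 33; 39; 52];
    [:: 1; 2; 5; 7; 8; 16; 19; 33; 38; 53]; [:: 1; 2; 5; 7; 8; 16; 19; 33; 39; 52];
    [:: 1; 2; 5; 7; 8; 16; 20; 32; 38; 53]; [:: 1; 2; 5; 7; 8; 16; 20; 32; 39; 52];
    [:: 1; 2; 5; 7; 8; 19; 25; 33; 40; 53]; [:: 1; 2; 5; 7; 8; 19; 25; 33; 41; 52];
    [:: 1; 2; 5; 7; 8; 20; 25; 32; 40; 53]; [:: 1; 2; 5; 7; 8; 20; 25; 32; 41; 52];
    [:: 1; 2; 5; 7; 14; 28; 34; 37; 38; 45]; [:: 1; 2; 5; 7; 14; 28; 34; 37; 40; 42];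
    [:: 1; 2; 5; 7; 14; 29; 34; 37; 39; 45]; [:: 1; 2; 5; 7; 14; 29; 34; 37; 41; 42];
    [:: 1; 2; 5; 7; 15; 28; 34; 36; 38; 45]; [:: 1; 2; 5; 7; 15; 28; 34; 36; 40; 42];
    [:: 1; 2; 5; 7; 15; 29; 34; 36; 39; 45]; [:: 1; 2; 5; 7; 15; 29; 34; 36; 41; 42];
    [:: 1; 2; 5; 7; 19; 26; 34; 36; 39; 45]; [:: 1; 2; 5; 7; 19; 26; 34; 36; 41; 42];
    [:: 1; 2; 5; 7; 19; 27; 34; 36; 38; 45]; [:: 1; 2; 5; 7; 19; 27; 34; 36; 40; 42];
    [:: 1; 2; 5; 7; 20; 26; 34; 37; 39; 45]; [:: 1; 2; 5; 7; 20; 26; 34; 37; 41; 42];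
    [:: 1; 2; 5; 7; 20; 27; 34; 37; 38; 45]; [:: 1; 2; 5; 7; 20; 27; 34; 37; 40; 42];
    [:: 3; 4; 9; 10; 12; 21; 24; 26; 31; 51]; [:: 3; 4; 9; 10; 12; 21; 24; 27; 31; 50];
    [:: 3; 4; 9; 10; 12; 22; 24; 26; 31; 46]; [:: 3; 4; 9; 10; 12; 22; 24; 27; 31; 49];
    [:: 3; 4; 9; 10; 13; 21; 23; 26; 31; 51]; [:: 3; 4; 9; 10; 13; 21; 23; 27; 31; 50];
    [:: 3; 4; 9; 10; 13; 22; 23; 26; 31; 46]; [:: 3; 4; 9; 10; 13; 22; 23; 27; 31; 49];
    [:: 3; 4; 9; 10; 16; 21; 23; 28; 31; 50]; [:: 3; 4; 9; 10; 16; 21; 23; 29; 31; 51];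
    [:: 3; 4; 9; 10; 16; 22; 23; 28; 31; 49]; [:: 3; 4; 9; 10; 16; 22; 23; 29; 31; 46];
    [:: 3; 4; 9; 10; 21; 24; 25; 28; 31; 50]; [:: 3; 4; 9; 10; 21; 24; 25; 29; 31; 51];
    [:: 3; 4; 9; 10; 22; 24; 25; 28; 31; 49]; [:: 3; 4; 9; 10; 22; 24; 25; 29; 31; 46];
    [:: 3; 4; 9; 11; 12; 21; 24; 26; 30; 51]; [:: 3; 4; 9; 11; 12; 21; 24; 27; 30; 50];
    [:: 3; 4; 9; 11; 12; 22; 24; 26; 30; 46]; [:: 3; 4; 9; 11; 12; 22; 24; 27; 30; 49];
    [:: 3; 4; 9; 11; 13; 21; 23; 26; 30; 51]; [:: 3; 4; 9; 11; 13; 21; 23; 27; 30; 50];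
    [:: 3; 4; 9; 11; 13; 22; 23; 26; 30; 46]; [:: 3; 4; 9; 11; 13; 22; 23; 27; 30; 49];
    [:: 3; 4; 9; 11; 16; 21; 23; 28; 30; 50]; [:: 3; 4; 9; 11; 16; 21; 23; 29; 30; 51];
    [:: 3; 4; 9; 11; 16; 22; 23; 28; 30; 49]; [:: 3; 4; 9; 11; 16; 22; 23; 29; 30; 46];
    [:: 3; 4; 9; 11; 21; 24; 25; 28; 30; 50]; [:: 3; 4; 9; 11; 21; 24; 25; 29; 30; 51];
    [:: 3; 4; 9; 11; 22; 24; 25; 28; 30; 49]; [:: 3; 4; 9; 11; 22; 24; 25; 29; 30; 46];
    [:: 3; 5; 9; 10; 12; 21; 24; 26; 31; 53]; [:: 3; 5; 9; 10; 12; 21; 24; 27; 31; 52];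
    [:: 3; 5; 9; 10; 12; 22; 24; 26; 31; 47]; [:: 3; 5; 9; 10; 12; 22; 24; 27; 31; 54];
    [:: 3; 5; 9; 10; 13; 21; 23; 26; 31; 53]; [:: 3; 5; 9; 10; 13; 21; 23; 27; 31; 52];
    [:: 3; 5; 9; 10; 13; 22; 23; 26; 31; 47]; [:: 3; 5; 9; 10; 13; 22; 23; 27; 31; 54];
    [:: 3; 5; 9; 10; 16; 21; 23; 28; 31; 52]; [:: 3; 5; 9; 10; 16; 21; 23; 29; 31; 53];
    [:: 3; 5; 9; 10; 16; 22; 23; 28; 31; 54]; [:: 3; 5; 9; 10; 16; 22; 23; 29; 31; 47];
    [:: 3; 5; 9; 10; 21; 24; 25; 28; 31; 52]; [:: 3; 5; 9; 10; 21; 24; 25; 29; 31; 53];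
    [:: 3; 5; 9; 10; 22; 24; 25; 28; 31; 54]; [:: 3; 5; 9; 10; 22; 24; 25; 29; 31; 47];
    [:: 3; 5; 9; 11; 12; 21; 24; 26; 30; 53]; [:: 3; 5; 9; 11; 12; 21; 24; 27; 30; 52];
    [:: 3; 5; 9; 11; 12; 22; 24; 26; 30; 47]; [:: 3; 5; 9; 11; 12; 22; 24; 27; 30; 54];
    [:: 3; 5; 9; 11; 13; 21; 23; 26; 30; 53]; [:: 3; 5; 9; 11; 13; 21; 23; 27; 30; 52];
    [:: 3; 5; 9; 11; 13; 22; 23; 26; 30; 47]; [:: 3; 5; 9; 11; 13; 22; 23; 27; 30; 54];
    [:: 3; 5; 9; 11; 16; 21; 23; 28; 30; 52]; [:: 3; 5; 9; 11; 16; 21; 23; 29; 30; 53];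
    [:: 3; 5; 9; 11; 16; 22; 23; 28; 30; 54]; [:: 3; 5; 9; 11; 16; 22; 23; 29; 30; 47];
    [:: 3; 5; 9; 11; 21; 24; 25; 28; 30; 52]; [:: 3; 5; 9; 11; 21; 24; 25; 29; 30; 53];
    [:: 3; 5; 9; 11; 22; 24; 25; 28; 30; 54]; [:: 3; 5; 9; 11; 22; 24; 25; 29; 30; 47];
    [:: 3; 6; 10; 12; 14; 17; 18; 44; 47; 48]; [:: 3; 6; 10; 12; 14; 17; 18; 44; 54; 55];
    [:: 3; 6; 10; 12; 14; 17; 18; 45; 46; 48]; [:: 3; 6; 10; 12; 14; 17; 18; 45; 49; 55];
    [:: 3; 6; 10; 13; 14; 17; 18; 42; 46; 48]; [:: 3; 6; 10; 13; 14; 17; 18; 42; 49; 55];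
    [:: 3; 6; 10; 13; 14; 17; 18; 43; 47; 48]; [:: 3; 6; 10; 13; 14; 17; 18; 43; 54; 55];
    [:: 3; 6; 10; 16; 17; 18; 20; 42; 46; 48]; [:: 3; 6; 10; 16; 17; 18; 20; 43; 47; 48];
    [:: 3; 6; 11; 12; 15; 17; 18; 44; 47; 48]; [:: 3; 6; 11; 12; 15; 17; 18; 44; 54; 55];
    [:: 3; 6; 11; 12; 15; 17; 18; 45; 46; 48]; [:: 3; 6; 11; 12; 15; 17; 18; 45; 49; 55];
    [:: 3; 6; 11; 13; 15; 17; 18; 42; 46; 48]; [:: 3; 6; 11; 13; 15; 17; 18; 42; 49; 55];
    [:: 3; 6; 11; 13; 15; 17; 18; 43; 47; 48]; [:: 3; 6; 11; 13; 15; 17; 18; 43; 54; 55];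
    [:: 3; 6; 11; 16; 17; 18; 19; 42; 46; 48]; [:: 3; 6; 11; 16; 17; 18; 19; 43; 47; 48];
    [:: 3; 7; 10; 12; 14; 17; 18; 44; 48; 53]; [:: 3; 7; 10; 12; 14; 17; 18; 44; 52; 55];
    [:: 3; 7; 10; 12; 14; 17; 18; 45; 48; 51]; [:: 3; 7; 10; 12; 14; 17; 18; 45; 50; 55];
    [:: 3; 7; 10; 13; 14; 17; 18; 42; 48; 51]; [:: 3; 7; 10; 13; 14; 17; 18; 42; 50; 55];
    [:: 3; 7; 10; 13; 14; 17; 18; 43; 48; 53]; [:: 3; 7; 10; 13; 14; 17; 18; 43; 52; 55];
    [:: 3; 7; 11; 12; 15; 17; 18; 44; 48; 53]; [:: 3; 7; 11; 12; 15; 17; 18; 44; 52; 55];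
    [:: 3; 7; 11; 12; 15; 17; 18; 45; 48; 51]; [:: 3; 7; 11; 12; 15; 17; 18; 45; 50; 55];
    [:: 3; 7; 11; 13; 15; 17; 18; 42; 48; 51]; [:: 3; 7; 11; 13; 15; 17; 18; 42; 50; 55];
    [:: 3; 7; 11; 13; 15; 17; 18; 43; 48; 53]; [:: 3; 7; 11; 13; 15; 17; 18; 43; 52; 55]] |}.

Definition batch17 := {|
  aut_order := 12; ncore := 1; tau := 132; depth := 3;
  generators := [::
    [::
      1; 0; 2; 3; 4; 29; 24; 35; 34; 27; 36; 32; 33; 31; 26; 28; 25; 22; 23; 30; 21; 20; 17; 18; 6;
      16; 14; 9; 15; 5; 19; 13; 11; 12; 8; 7; 10; 76; 38; 67; 51; 65; 73; 43; 44; 54; 56; 62; 58;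
      72; 71; 40; 52; 63; 45; 55; 46; 61; 48; 59; 60; 57; 47; 53; 69; 41; 66; 39; 74; 64; 70; 50;
      49; 42; 68; 75; 37];
    [::
      0; 37; 42; 44; 47; 45; 40; 46; 38; 6; 48; 23; 41; 21; 8; 24; 5; 22; 43; 39; 7; 61; 71; 55; 67;
      69; 34; 19; 30; 12; 51; 74; 18; 25; 66; 31; 10; 76; 14; 27; 9; 29; 63; 32; 52; 16; 20; 72; 36;
      60; 50; 28; 3; 75; 65; 11; 68; 56; 58; 59; 62; 13; 49; 2; 54; 64; 26; 15; 57; 33; 70; 17; 4;
      53; 35; 73; 1]];
  keys := [::
    (true, 0); (false, 20); (false, 25); (false, 14); (false, 41); (false, 35); (false, 71);
    (false, 13); (false, 45); (false, 0); (false, 1); (false, 2); (false, 21)];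
  reps := [::
    0x2618a1400262b40901a4; 0x200b25a5820948022131; 0x2268561020a01a542105; 0x2041298003c65154cc00;
    0x200b64a54208c8020931; 0x205428400b94c9064a20; 0x204129080ac740d8c600; 0x20514259452418070015;
    0x204c0c8c6004559188a0; 0x2070342a7081050b0007; 0x20462980218075548d00; 0x2143e0004c62482a840a;
    0x20183283261206568042; 0x2178026c123101006055; 0x204c2c0428850d2da020; 0x20591259c40410830207;
    0x20440c0c68855c1d00a0; 0x21cb900030a904282446; 0x2060152231a9441b0005; 0x205608886108354c0f00;
    0x2149b04110a043506806; 0x205428c802958182c260; 0x204440e7442831198009; 0x20462908288164d88700;
    0x20784211472608060216; 0x204c0c8442842d989880; 0x20249a03307620048292; 0x2011843096102e9c8840;
    0x200d303b205a40040178; 0x26038c2880b020a54809; 0x200b31248a1948022521; 0x2001b104893d0303a420;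
    0x20209605c885a20b0282; 0x2208082b66370005280a; 0x2002c113b012c604c340; 0x220281133413c2048b40;
    0x20051e50847a20084851; 0x21080b46852f00026109; 0x2080c270540a90cc4a40; 0x211c103c4244016d2018;
    0x20088b64852b00866009; 0x202b90300ad040bc040c; 0x210acc08e0220680650a; 0x2002c053d0101f0c7100;
    0x230a8c08642302802d0a; 0x2029728090c01472c00c; 0x2288cb20212804c43809; 0x23884b02212c04403909;
    0x2080e170140249c4e880; 0x200b93048a15480224a1; 0x201c110497410e12a018; 0x26a08a0205a52092088a;
    0x208ca33448820184105c; 0x24a0ca0281a42492408a; 0x200bc6854204c80208b1; 0x202b84b102c040bc001c;
    0x200ac80be0320604610a; 0x220a880b64330204290a; 0x20004133b216c405c240; 0x200bd2044a14c8020ca1;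
    0x23080b06a12d04023109; 0x2000a17494034986e080; 0x20a9620498c01430c01c; 0x22088b24a12904863009;
    0x2001a585812d0303a030; 0x2003a485c28d800a0232; 0x2003a184833d0102a430; 0x2001e485412c83038830;
    0x202224a5c289a00a0312; 0x20123682248215570401; 0x2009970588054a0320a1; 0x2196980050601a262112;
    0x2000e0745402c986c880; 0x20a9508490c81430c08c; 0x2208ca24612884861809; 0x2029943108c042bd000c;
    0x210ac849c0300680710a; 0x230a884944310280390a; 0x2002c412f0021f0c6500; 0x21800352940f10486340;
    0x2008ca64452a80864809; 0x21084a46452e80024909; 0x20808370940b10cc6240; 0x208c91b4408a018410cc;
    0x21b0ca0081a42426408a; 0x23b08a0005a52026088a; 0x201c500457408e128818; 0x23080c28662700812c0a;
    0x20004073d2141d0d7000; 0x220000735615190d3800; 0x20055a51046b20084451; 0x27208a0405a52054088a;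
    0x209c510017400e50a818; 0x200cb3b0408201c6104c; 0x2520ca0481a42454408a; 0x2105bc00306e00808632;
    0x220e10403e9188002e0c; 0x2005b05301dc010c1038; 0x2211c82902a122944409; 0x20229204ca95a00a0682;
    0x2003b004ca9d800a0622; 0x2084ab64780010848017; 0x2096500854c094510a18; 0x20161914846145132011;
    0x200491f8610840ce008c; 0x200e5100da920c00560c; 0x2603c82900a120a54409; 0x21249e00306620808692;
    0x2011c03116012e9c8440; 0x200445c9f1001601c01c; 0x2013c82904a124950409; 0x20328430941055950a20;
    0x20065950ea1044084407; 0x2681a80205ad0092082a; 0x2111e014900c056cc220; 0x208ca27428808184205c;
    0x22141914826143126011; 0x2004a378690040ce001c; 0x201658144460c5130811; 0x2096110894c114512218;
    0x208499e4700810848087; 0x2391a80005ad0026082a; 0x218c10d6208c810021cc; 0x208c90f42088818420cc;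
    0x2191e80081ac0426402a; 0x21249a41107420809292; 0x2030c43016110e9c8060; 0x200c5501d8820e01520c;
    0x2622cc2800b100a54029; 0x20008274d40b908e4240; 0x21884b42052e00406909; 0x209c103a424401ab2018;
    0x2088cb60052a00c46809; 0x220004327607190d2c00; 0x20245e50047b00084071; 0x2308086946350081380a;
    0x20004432f2061d0d6400; 0x20045d51e80046094007; 0x20138031940075950e00; 0x200641c8f3101400c41c;
    0x2032cc2804b104950029; 0x20064dd1e20044084017; 0x2032c031140155950620; 0x20045148f9101601c40c;
    0x20138c2884b024950809; 0x200e44c1b2808c00621c; 0x22118c2882b022944809; 0x2005b803307e00048232;
    0x220e04c1368188002a1c; 0x2005b41221ce010c0438; 0x2230cc2802b102944029; 0x2105b841107c00809232;
    0x220c14413c818a012a0c; 0x2701a80405ad0054082a; 0x2091e012900c05aac220; 0x200cb2f0208081c6204c;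
    0x22945910026043506811; 0x2016100cd4c194130218; 0x2004bbe0700010c68007; 0x20965910046045512811;
    0x2084817c6908408c009c]%positive;
  systems := [::
    [:: 1; 2; 3; 79; 80; 111; 112]; [:: 1; 2; 3; 81; 82; 109; 110]; [:: 1; 2; 3; 87; 88; 117; 118];
    [:: 1; 2; 3; 89; 90; 119; 120]; [:: 1; 5; 11; 129; 130; 139; 140];
    [:: 1; 5; 11; 131; 132; 137; 138]; [:: 1; 5; 11; 133; 134; 157; 158];
    [:: 1; 5; 11; 135; 136; 159; 160]; [:: 1; 6; 17; 129; 130; 139; 140];
    [:: 1; 6; 17; 131; 132; 137; 138]; [:: 1; 6; 17; 133; 134; 157; 158];
    [:: 1; 6; 17; 135; 136; 159; 160]; [:: 1; 7; 8; 45; 46; 151; 152];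
    [:: 1; 7; 8; 47; 48; 149; 150]; [:: 1; 7; 8; 75; 76; 153; 154]; [:: 1; 7; 8; 77; 78; 155; 156];
    [:: 1; 9; 10; 41; 42; 121; 122]; [:: 1; 9; 10; 43; 44; 123; 124]; [:: 1; 9; 10; 71; 72; 97; 98];
    [:: 1; 9; 10; 73; 74; 95; 96]; [:: 1; 15; 16; 41; 42; 121; 122];
    [:: 1; 15; 16; 43; 44; 123; 124]; [:: 1; 15; 16; 71; 72; 97; 98];
    [:: 1; 15; 16; 73; 74; 95; 96]; [:: 1; 20; 21; 79; 80; 111; 112];
    [:: 1; 20; 21; 81; 82; 109; 110]; [:: 1; 20; 21; 87; 88; 117; 118];
    [:: 1; 20; 21; 89; 90; 119; 120]; [:: 1; 22; 23; 45; 46; 151; 152];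
    [:: 1; 22; 23; 47; 48; 149; 150]; [:: 1; 22; 23; 75; 76; 153; 154];
    [:: 1; 22; 23; 77; 78; 155; 156]; [:: 2; 3; 4; 37; 38; 109; 110];
    [:: 2; 3; 4; 39; 40; 111; 112]; [:: 2; 3; 4; 87; 88; 103; 104]; [:: 2; 3; 4; 89; 90; 101; 102];
    [:: 2; 3; 26; 27; 39; 40; 59]; [:: 2; 3; 26; 27; 49; 79; 80]; [:: 2; 3; 28; 29; 37; 38; 59];
    [:: 2; 3; 28; 29; 49; 81; 82]; [:: 2; 3; 30; 33; 34; 117; 118]; [:: 2; 3; 30; 35; 36; 119; 120];
    [:: 2; 3; 30; 79; 80; 141; 142]; [:: 2; 3; 30; 81; 82; 143; 144]; [:: 2; 3; 33; 34; 49; 83; 84];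
    [:: 2; 3; 33; 34; 52; 53; 59]; [:: 2; 3; 35; 36; 49; 85; 86]; [:: 2; 3; 35; 36; 50; 51; 59];
    [:: 2; 3; 37; 38; 54; 105; 106]; [:: 2; 3; 39; 40; 54; 107; 108]; [:: 2; 3; 50; 51; 54; 89; 90];
    [:: 2; 3; 52; 53; 54; 87; 88]; [:: 4; 9; 10; 41; 42; 113; 114]; [:: 4; 9; 10; 43; 44; 115; 116];
    [:: 4; 9; 10; 60; 61; 97; 98]; [:: 4; 9; 10; 62; 63; 95; 96]; [:: 4; 13; 14; 41; 42; 157; 158];
    [:: 4; 13; 14; 43; 44; 159; 160]; [:: 4; 13; 14; 45; 46; 111; 112];
    [:: 4; 13; 14; 47; 48; 109; 110]; [:: 4; 15; 16; 41; 42; 113; 114];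
    [:: 4; 15; 16; 43; 44; 115; 116]; [:: 4; 15; 16; 60; 61; 97; 98];
    [:: 4; 15; 16; 62; 63; 95; 96]; [:: 4; 18; 19; 87; 88; 155; 156];
    [:: 4; 18; 19; 89; 90; 153; 154]; [:: 4; 18; 19; 95; 96; 131; 132];
    [:: 4; 18; 19; 97; 98; 129; 130]; [:: 4; 20; 21; 37; 38; 109; 110];
    [:: 4; 20; 21; 39; 40; 111; 112]; [:: 4; 20; 21; 87; 88; 103; 104];
    [:: 4; 20; 21; 89; 90; 101; 102]; [:: 5; 11; 12; 37; 38; 139; 140];
    [:: 5; 11; 12; 39; 40; 137; 138]; [:: 5; 11; 12; 101; 102; 133; 134];
    [:: 5; 11; 12; 103; 104; 135; 136]; [:: 5; 11; 26; 27; 39; 40; 69];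
    [:: 5; 11; 26; 27; 70; 131; 132]; [:: 5; 11; 28; 29; 37; 38; 69];
    [:: 5; 11; 28; 29; 70; 129; 130]; [:: 5; 11; 32; 33; 34; 103; 104];
    [:: 5; 11; 32; 35; 36; 101; 102]; [:: 5; 11; 32; 37; 38; 143; 144];
    [:: 5; 11; 32; 39; 40; 141; 142]; [:: 5; 11; 33; 34; 52; 53; 69];
    [:: 5; 11; 33; 34; 70; 93; 94]; [:: 5; 11; 35; 36; 50; 51; 69]; [:: 5; 11; 35; 36; 70; 91; 92];
    [:: 5; 11; 37; 38; 68; 127; 128]; [:: 5; 11; 39; 40; 68; 125; 126];
    [:: 5; 11; 50; 51; 68; 133; 134]; [:: 5; 11; 52; 53; 68; 135; 136];
    [:: 6; 12; 17; 37; 38; 139; 140]; [:: 6; 12; 17; 39; 40; 137; 138];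
    [:: 6; 12; 17; 101; 102; 133; 134]; [:: 6; 12; 17; 103; 104; 135; 136];
    [:: 6; 17; 26; 27; 39; 40; 69]; [:: 6; 17; 26; 27; 70; 131; 132];
    [:: 6; 17; 28; 29; 37; 38; 69]; [:: 6; 17; 28; 29; 70; 129; 130];
    [:: 6; 17; 32; 33; 34; 103; 104]; [:: 6; 17; 32; 35; 36; 101; 102];
    [:: 6; 17; 32; 37; 38; 143; 144]; [:: 6; 17; 32; 39; 40; 141; 142];
    [:: 6; 17; 33; 34; 52; 53; 69]; [:: 6; 17; 33; 34; 70; 93; 94]; [:: 6; 17; 35; 36; 50; 51; 69];
    [:: 6; 17; 35; 36; 70; 91; 92]; [:: 6; 17; 37; 38; 68; 127; 128];
    [:: 6; 17; 39; 40; 68; 125; 126]; [:: 6; 17; 50; 51; 68; 133; 134];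
    [:: 6; 17; 52; 53; 68; 135; 136]; [:: 7; 8; 12; 60; 61; 149; 150];
    [:: 7; 8; 12; 62; 63; 151; 152]; [:: 7; 8; 12; 75; 76; 113; 114];
    [:: 7; 8; 12; 77; 78; 115; 116]; [:: 7; 8; 26; 27; 45; 46; 66]; [:: 7; 8; 28; 29; 47; 48; 66];
    [:: 7; 8; 31; 45; 46; 125; 126]; [:: 7; 8; 31; 47; 48; 127; 128]; [:: 7; 8; 31; 75; 76; 91; 92];
    [:: 7; 8; 31; 77; 78; 93; 94]; [:: 7; 8; 32; 55; 56; 113; 114]; [:: 7; 8; 32; 57; 58; 115; 116];
    [:: 7; 8; 32; 60; 61; 145; 146]; [:: 7; 8; 32; 62; 63; 147; 148]; [:: 7; 8; 50; 51; 65; 75; 76];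
    [:: 7; 8; 52; 53; 65; 77; 78]; [:: 7; 8; 55; 56; 66; 91; 92]; [:: 7; 8; 57; 58; 66; 93; 94];
    [:: 7; 8; 60; 61; 65; 127; 128]; [:: 7; 8; 62; 63; 65; 125; 126];
    [:: 9; 10; 26; 27; 62; 63; 67]; [:: 9; 10; 26; 27; 64; 73; 74]; [:: 9; 10; 28; 29; 60; 61; 67];
    [:: 9; 10; 28; 29; 64; 71; 72]; [:: 9; 10; 30; 55; 56; 121; 122];
    [:: 9; 10; 30; 57; 58; 123; 124]; [:: 9; 10; 30; 71; 72; 145; 146];
    [:: 9; 10; 30; 73; 74; 147; 148]; [:: 9; 10; 31; 41; 42; 85; 86];
    [:: 9; 10; 31; 43; 44; 83; 84]; [:: 9; 10; 31; 71; 72; 105; 106];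
    [:: 9; 10; 31; 73; 74; 107; 108]; [:: 9; 10; 50; 51; 55; 56; 67];
    [:: 9; 10; 52; 53; 57; 58; 67]; [:: 9; 10; 55; 56; 64; 85; 86]; [:: 9; 10; 57; 58; 64; 83; 84];
    [:: 12; 13; 14; 41; 42; 119; 120]; [:: 12; 13; 14; 43; 44; 117; 118];
    [:: 12; 13; 14; 71; 72; 109; 110]; [:: 12; 13; 14; 73; 74; 111; 112];
    [:: 12; 18; 19; 79; 80; 95; 96]; [:: 12; 18; 19; 81; 82; 97; 98];
    [:: 12; 18; 19; 87; 88; 123; 124]; [:: 12; 18; 19; 89; 90; 121; 122];
    [:: 12; 22; 23; 60; 61; 149; 150]; [:: 12; 22; 23; 62; 63; 151; 152];
    [:: 12; 22; 23; 75; 76; 113; 114]; [:: 12; 22; 23; 77; 78; 115; 116];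
    [:: 13; 14; 26; 27; 45; 46; 59]; [:: 13; 14; 28; 29; 47; 48; 59];
    [:: 13; 14; 41; 42; 54; 91; 92]; [:: 13; 14; 41; 42; 68; 85; 86];
    [:: 13; 14; 43; 44; 54; 93; 94]; [:: 13; 14; 43; 44; 68; 83; 84];
    [:: 13; 14; 45; 46; 54; 107; 108]; [:: 13; 14; 47; 48; 54; 105; 106];
    [:: 13; 14; 55; 56; 59; 91; 92]; [:: 13; 14; 55; 56; 99; 119; 120];
    [:: 13; 14; 57; 58; 59; 93; 94]; [:: 13; 14; 57; 58; 99; 117; 118];
    [:: 13; 14; 68; 71; 72; 105; 106]; [:: 13; 14; 68; 73; 74; 107; 108];
    [:: 13; 14; 71; 72; 99; 143; 144]; [:: 13; 14; 73; 74; 99; 141; 142];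
    [:: 15; 16; 26; 27; 62; 63; 67]; [:: 15; 16; 26; 27; 64; 73; 74];
    [:: 15; 16; 28; 29; 60; 61; 67]; [:: 15; 16; 28; 29; 64; 71; 72];
    [:: 15; 16; 30; 55; 56; 121; 122]; [:: 15; 16; 30; 57; 58; 123; 124];
    [:: 15; 16; 30; 71; 72; 145; 146]; [:: 15; 16; 30; 73; 74; 147; 148];
    [:: 15; 16; 31; 41; 42; 85; 86]; [:: 15; 16; 31; 43; 44; 83; 84];
    [:: 15; 16; 31; 71; 72; 105; 106]; [:: 15; 16; 31; 73; 74; 107; 108];
    [:: 15; 16; 50; 51; 55; 56; 67]; [:: 15; 16; 52; 53; 57; 58; 67];
    [:: 15; 16; 55; 56; 64; 85; 86]; [:: 15; 16; 57; 58; 64; 83; 84];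
    [:: 18; 19; 26; 27; 67; 131; 132]; [:: 18; 19; 26; 27; 79; 80; 100];
    [:: 18; 19; 28; 29; 67; 129; 130]; [:: 18; 19; 28; 29; 81; 82; 100];
    [:: 18; 19; 33; 34; 67; 93; 94]; [:: 18; 19; 33; 34; 83; 84; 100];
    [:: 18; 19; 33; 34; 99; 123; 124]; [:: 18; 19; 35; 36; 67; 91; 92];
    [:: 18; 19; 35; 36; 85; 86; 100]; [:: 18; 19; 35; 36; 99; 121; 122];
    [:: 18; 19; 65; 79; 80; 107; 108]; [:: 18; 19; 65; 81; 82; 105; 106];
    [:: 18; 19; 65; 83; 84; 87; 88]; [:: 18; 19; 65; 85; 86; 89; 90];
    [:: 18; 19; 79; 80; 99; 147; 148]; [:: 18; 19; 81; 82; 99; 145; 146];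
    [:: 20; 21; 26; 27; 39; 40; 59]; [:: 20; 21; 26; 27; 49; 79; 80];
    [:: 20; 21; 28; 29; 37; 38; 59]; [:: 20; 21; 28; 29; 49; 81; 82];
    [:: 20; 21; 30; 33; 34; 117; 118]; [:: 20; 21; 30; 35; 36; 119; 120];
    [:: 20; 21; 30; 79; 80; 141; 142]; [:: 20; 21; 30; 81; 82; 143; 144];
    [:: 20; 21; 33; 34; 49; 83; 84]; [:: 20; 21; 33; 34; 52; 53; 59];
    [:: 20; 21; 35; 36; 49; 85; 86]; [:: 20; 21; 35; 36; 50; 51; 59];
    [:: 20; 21; 37; 38; 54; 105; 106]; [:: 20; 21; 39; 40; 54; 107; 108];
    [:: 20; 21; 50; 51; 54; 89; 90]; [:: 20; 21; 52; 53; 54; 87; 88];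
    [:: 22; 23; 26; 27; 45; 46; 66]; [:: 22; 23; 28; 29; 47; 48; 66];
    [:: 22; 23; 31; 45; 46; 125; 126]; [:: 22; 23; 31; 47; 48; 127; 128];
    [:: 22; 23; 31; 75; 76; 91; 92]; [:: 22; 23; 31; 77; 78; 93; 94];
    [:: 22; 23; 32; 55; 56; 113; 114]; [:: 22; 23; 32; 57; 58; 115; 116];
    [:: 22; 23; 32; 60; 61; 145; 146]; [:: 22; 23; 32; 62; 63; 147; 148];
    [:: 22; 23; 50; 51; 65; 75; 76]; [:: 22; 23; 52; 53; 65; 77; 78];
    [:: 22; 23; 55; 56; 66; 91; 92]; [:: 22; 23; 57; 58; 66; 93; 94];
    [:: 22; 23; 60; 61; 65; 127; 128]; [:: 22; 23; 62; 63; 65; 125; 126];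
    [:: 24; 25; 41; 42; 66; 157; 158]; [:: 24; 25; 41; 42; 69; 113; 114];
    [:: 24; 25; 41; 42; 70; 153; 154]; [:: 24; 25; 43; 44; 66; 159; 160];
    [:: 24; 25; 43; 44; 69; 115; 116]; [:: 24; 25; 43; 44; 70; 155; 156];
    [:: 24; 25; 45; 46; 49; 151; 152]; [:: 24; 25; 45; 46; 64; 137; 138];
    [:: 24; 25; 45; 46; 66; 111; 112]; [:: 24; 25; 45; 46; 70; 95; 96];
    [:: 24; 25; 47; 48; 49; 149; 150]; [:: 24; 25; 47; 48; 64; 139; 140];
    [:: 24; 25; 47; 48; 66; 109; 110]; [:: 24; 25; 47; 48; 70; 97; 98];
    [:: 24; 25; 49; 75; 76; 153; 154]; [:: 24; 25; 49; 77; 78; 155; 156];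
    [:: 24; 25; 60; 61; 69; 97; 98]; [:: 24; 25; 60; 61; 100; 139; 140];
    [:: 24; 25; 62; 63; 69; 95; 96]; [:: 24; 25; 62; 63; 100; 137; 138];
    [:: 24; 25; 64; 75; 76; 157; 158]; [:: 24; 25; 64; 77; 78; 159; 160];
    [:: 24; 25; 75; 76; 100; 101; 102]; [:: 24; 25; 77; 78; 100; 103; 104]] |}.

Definition batch18 := {|
  aut_order := 12; ncore := 1; tau := 242; depth := 2;
  generators := [::
    [::
      9; 15; 8; 3; 18; 12; 2; 13; 6; 14; 7; 1; 17; 10; 0; 11; 16; 5; 19; 4; 20; 58; 41; 30; 60; 64;
      37; 32; 26; 71; 75; 74; 76; 54; 24; 57; 46; 28; 40; 49; 63; 50; 42; 51; 59; 29; 61; 62; 21;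
      66; 22; 53; 52; 43; 65; 67; 31; 68; 48; 70; 34; 36; 73; 38; 69; 33; 39; 72; 35; 25; 44; 45;
      55; 47; 56; 23; 27];
    [::
      0; 1; 4; 3; 2; 25; 30; 31; 34; 27; 21; 26; 22; 35; 32; 28; 29; 33; 23; 24; 36; 10; 12; 18; 19;
      5; 11; 9; 15; 16; 6; 7; 14; 17; 8; 13; 20; 37; 55; 51; 67; 69; 47; 66; 44; 71; 61; 42; 74; 49;
      54; 39; 52; 53; 50; 38; 57; 56; 68; 59; 75; 46; 73; 63; 65; 64; 43; 40; 58; 41; 70; 45; 72;
      62; 48; 60; 76]];
  keys := [::
    (false, 3); (true, 1); (false, 6); (false, 53); (false, 24); (false, 72); (false, 0);
    (false, 56); (false, 12); (false, 42); (false, 1); (false, 5)];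
  reps := [::
    0x2008b27028c0c0ce200c; 0x20d8118012c27100cc84; 0x20d8118012c3340884c4; 0x244e100458990c081264;
    0x244e1004589849005a24; 0x200a48c9c0501680f108; 0x20044d00ab868c054608; 0x20b44a0089842c264288;
    0x2124f4401472080080ba; 0x2012108b243a44570280; 0x20bc4a0888002ca24388; 0x220a08c944511280b908;
    0x200c4d08aa028c814708; 0x200248c1c1d41604f008; 0x200b87858205480220b1; 0x200114a8c23c284b2880;
    0x20a44d008981a8820f08; 0x211a06c5060a006c4211; 0x2009488dc0551044a828; 0x20021e948c3841034811;
    0x20021e948c39040b0051; 0x200ec3454200a228c111; 0x2000c15392109d0d5100; 0x20051e50847a20084851;
    0x20862520e28454112032; 0x20161914846145132011; 0x20b3e60000c40d0030b1; 0x202471282038645181a0;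
    0x25094645024288805451; 0x2091e01290081d2e4120; 0x223a8305024183003311; 0x2191603090085c264160;
    0x203320a9e00864020386; 0x2091e012900c05aac220; 0x2000c15392148589d200; 0x2002c412f0021f0c6500;
    0x20045043613a222ec400; 0x2422d78001084a4241a1; 0x201130a9c20c244b0282; 0x20169348440036590181;
    0x2091f3080814064180e1; 0x2002c113b012c604c340; 0x2511150481430a462441; 0x200c2361062a70114130;
    0x20339240054e03006681; 0x200862254a262301e410; 0x213060349008256cc300; 0x200264a142a8ac0b1110;
    0x2003d1c10308ca024581; 0x231015c1030902ca1601; 0x272214c4010900ea0681; 0x20b04a8081c43426c088;
    0x220608414d950a043a08; 0x20dc11001a832c0806c4; 0x2154a8c0023481828262]%positive;
  systems := [::
    [:: 1; 3; 5; 6; 9; 14; 33]; [:: 1; 3; 5; 6; 15; 17; 33]; [:: 1; 3; 5; 6; 19; 26; 27];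
    [:: 1; 3; 5; 6; 23; 37; 38]; [:: 1; 3; 5; 6; 23; 40; 49]; [:: 1; 3; 7; 8; 9; 14; 34];
    [:: 1; 3; 7; 8; 15; 17; 34]; [:: 1; 3; 7; 8; 19; 21; 24]; [:: 1; 3; 7; 8; 39; 41; 42];
    [:: 1; 3; 9; 10; 11; 14; 35]; [:: 1; 3; 10; 11; 15; 17; 35]; [:: 1; 3; 10; 11; 19; 28; 36];
    [:: 1; 3; 12; 13; 19; 30; 32]; [:: 1; 3; 12; 13; 25; 37; 38]; [:: 1; 3; 12; 13; 25; 40; 49];
    [:: 1; 3; 12; 13; 39; 42; 46]; [:: 1; 3; 16; 18; 21; 24; 33]; [:: 1; 3; 16; 18; 26; 27; 34];
    [:: 1; 3; 16; 18; 30; 32; 35]; [:: 2; 4; 5; 6; 9; 14; 29]; [:: 2; 4; 5; 6; 15; 17; 29];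
    [:: 2; 4; 5; 6; 20; 26; 27]; [:: 2; 4; 5; 6; 43; 44; 46]; [:: 2; 4; 7; 8; 9; 14; 22];
    [:: 2; 4; 7; 8; 15; 17; 22]; [:: 2; 4; 7; 8; 20; 21; 24]; [:: 2; 4; 7; 8; 25; 45; 48];
    [:: 2; 4; 7; 8; 25; 47; 50]; [:: 2; 4; 9; 12; 13; 14; 31]; [:: 2; 4; 10; 11; 20; 28; 36];
    [:: 2; 4; 10; 11; 23; 45; 48]; [:: 2; 4; 10; 11; 23; 47; 50]; [:: 2; 4; 10; 11; 41; 43; 44];
    [:: 2; 4; 12; 13; 15; 17; 31]; [:: 2; 4; 12; 13; 20; 30; 32]; [:: 2; 4; 16; 18; 21; 24; 29];
    [:: 2; 4; 16; 18; 22; 26; 27]; [:: 2; 4; 16; 18; 28; 31; 36]; [:: 9; 14; 22; 51; 52; 53; 54]] |}.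

Definition batch19 := {|
  aut_order := 168; ncore := 1; tau := 136; depth := 1;
  generators := [::
    [::
      24; 44; 43; 6; 38; 54; 76; 58; 18; 17; 29; 65; 35; 51; 56; 20; 67; 73; 1; 34; 62; 41; 46; 37;
      8; 22; 5; 45; 48; 39; 0; 21; 7; 47; 23; 40; 42; 3; 64; 71; 74; 15; 26; 57; 30; 75; 9; 32; 60;
      52; 69; 33; 59; 70; 16; 25; 50; 12; 13; 63; 11; 28; 66; 72; 10; 68; 31; 36; 61; 27; 49; 4; 53;
      55; 2; 14; 19];
    [::
      44; 8; 39; 23; 40; 73; 1; 62; 76; 50; 66; 36; 55; 57; 33; 68; 64; 13; 19; 30; 16; 38; 43; 24;
      6; 42; 48; 22; 21; 5; 37; 47; 45; 46; 0; 7; 41; 34; 17; 58; 54; 56; 51; 20; 18; 29; 65; 67;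
      35; 53; 26; 10; 70; 63; 14; 71; 2; 75; 11; 49; 27; 25; 9; 52; 60; 4; 74; 12; 32; 31; 72; 69;
      59; 15; 61; 28; 3];
    [::
      19; 8; 16; 1; 13; 66; 30; 55; 44; 73; 50; 36; 68; 39; 33; 62; 40; 64; 76; 23; 57; 10; 12; 0;
      18; 14; 17; 2; 4; 15; 6; 11; 20; 7; 3; 9; 5; 34; 71; 42; 47; 67; 69; 74; 37; 31; 51; 61; 25;
      63; 22; 75; 53; 70; 58; 48; 26; 38; 54; 49; 35; 27; 46; 59; 43; 32; 45; 60; 21; 28; 52; 65;
      72; 41; 56; 29; 24]];
  keys := [::
    (true, 22); (false, 34); (false, 63); (false, 16); (false, 49); (false, 39); (false, 56);
    (false, 10); (false, 17); (false, 48); (false, 2); (false, 0); (false, 3); (false, 1)];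
  reps := [::
    0x2001e053819c050c5028; 0x2006104324b368162480]%positive;
  systems := [::
    [:: 1]] |}.

Definition batch20 := {|
  aut_order := 24; ncore := 1; tau := 136; depth := 1;
  generators := [::
    [::
      1; 44; 62; 76; 73; 17; 18; 20; 6; 65; 29; 54; 35; 38; 58; 56; 43; 51; 34; 24; 67; 16; 13; 8;
      19; 33; 50; 64; 57; 66; 23; 36; 68; 39; 30; 55; 40; 3; 12; 5; 7; 11; 2; 10; 0; 15; 14; 4; 9;
      70; 41; 25; 52; 59; 69; 22; 71; 45; 61; 72; 75; 32; 47; 49; 48; 74; 21; 31; 46; 26; 63; 28;
      53; 42; 27; 60; 37];
    [::
      44; 76; 62; 1; 73; 67; 34; 51; 18; 20; 38; 29; 43; 54; 35; 17; 58; 65; 6; 24; 56; 55; 66; 30;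
      19; 40; 16; 36; 33; 68; 8; 39; 13; 64; 23; 50; 57; 0; 61; 71; 74; 12; 47; 69; 37; 31; 10; 42;
      25; 63; 32; 45; 52; 72; 14; 46; 27; 9; 11; 53; 4; 21; 60; 70; 15; 28; 41; 48; 26; 22; 49; 7;
      59; 75; 5; 2; 3]];
  keys := [::
    (false, 49); (false, 1); (false, 37); (false, 41); (false, 8); (false, 34); (false, 62);
    (false, 10); (false, 28); (false, 40); (false, 43); (false, 0); (false, 3)];
  reps := [::
    0x2263c00a02b101384409; 0x210126a7908520028059; 0x200fd30140044c2310a1; 0x2001e0710c404adca008;
    0x20041520c2ae22596200; 0x2a30549086428802028b]%positive;
  systems := [::
    [:: 1; 2; 3; 4; 5]] |}.

Definition batch21 := {|
  aut_order := 21; ncore := 1; tau := 144; depth := 1;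
  generators := [::
    [::
      69; 46; 73; 4; 49; 64; 29; 70; 5; 18; 60; 26; 56; 43; 31; 13; 42; 72; 14; 23; 55; 54; 59; 22;
      16; 75; 15; 30; 35; 67; 6; 68; 10; 39; 27; 63; 47; 3; 71; 41; 44; 17; 65; 52; 45; 25; 12; 50;
      33; 58; 24; 76; 74; 57; 9; 37; 32; 8; 20; 62; 1; 34; 38; 51; 7; 36; 48; 61; 21; 28; 53; 19;
      66; 40; 11; 2; 0];
    [::
      51; 49; 50; 21; 9; 5; 27; 53; 57; 56; 55; 26; 37; 11; 1; 52; 38; 39; 10; 25; 54; 60; 40; 2;
      59; 42; 13; 29; 28; 6; 61; 12; 58; 41; 30; 63; 62; 31; 73; 72; 65; 48; 19; 15; 47; 24; 20; 71;
      33; 14; 23; 69; 43; 64; 46; 18; 4; 70; 68; 45; 3; 34; 75; 76; 7; 22; 66; 67; 32; 0; 8; 44; 17;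
      16; 74; 36; 35]];
  keys := [::
    (false, 5); (false, 29); (false, 36); (false, 27); (false, 7); (false, 15); (false, 10);
    (false, 26); (false, 54); (false, 11); (false, 22); (false, 37)];
  reps := [::
    0x20d1c3080d040e0180c9; 0x200788c00e4898980708; 0x202c58a142550200a06a; 0x2002c412f0060788e600]%positive;
  systems := [::
    [:: 1; 2; 3]] |}.

Definition batches := [::
  batch0; batch1; batch2; batch3; batch4; batch5; batch6; batch7; batch8; batch9; batch10; batch11;
  batch12; batch13; batch14; batch15; batch16; batch17; batch18; batch19; batch20; batch21].

Definition nbr := Eval vm_compute in neighbours stars.

Lemma starsP : stars_ok stars. Proof. by vm_compute. Qed.

Lemma nbrP : nbr = neighbours stars. Proof. by vm_compute. Qed.

Lemma batches_verified : verified stars nbr batches.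
Proof. vm_cast_no_check (erefl true). Qed.

Theorem theorem4p4 :
  exists D : 'I_1410 -> {set {set 'I_56}},
    (forall i, is_design 56 16 6 (D i) /\ quasi_symmetric 4 6 (D i)) /\
    (forall i j, i != j -> ~ isomorphic (D i) (D j)) /\
    #|[set i | #|design_aut (D i)| == 168]| = 1 /\
    #|[set i | #|design_aut (D i)| == 48]| = 876 /\
    #|[set i | #|design_aut (D i)| == 24]| = 1 /\
    #|[set i | #|design_aut (D i)| == 21]| = 1 /\
    #|[set i | #|design_aut (D i)| == 16]| = 228 /\
    #|[set i | #|design_aut (D i)| == 12]| = 303.
Proof.
set cat := catalogue batch0 batches.
have size_cat : size cat = 1410 by vm_compute.
have catP (i : 'I_1410) : nth (0, [::]) cat i \in cat by rewrite mem_nth ?size_cat.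
exists (fun i => design (catalogued nbr batch0 batches (nth (0, [::]) cat i))).
have countP m : #|[set i : 'I_1410 | #|design_aut (design (catalogued nbr batch0 batches
    (nth (0, [::]) cat i)))| == m]| =
    count (fun kc => aut_order (nth batch0 batches kc.1) == m) cat.
  rewrite -(card_count (0, [::]) _ size_cat); apply: eq_card => i.
  by rewrite !inE (catalogued_aut starsP nbrP batches_verified (catP i)).
rewrite !countP; split=> [i|].
  exact: (residual_design starsP (catalogued_residual starsP batches_verified (catP i))).
split=> [i j ij /(catalogued_isomorphic starsP nbrP batches_verified (catP i) (catP j))/eqP|].
  by rewrite nth_uniq ?size_cat ?(uniq_catalogue _ batches_verified) // (inj_eq val_inj) (negPf ij).
by split; [|split; [|split; [|split; [|split]]]]; vm_compute.
Qed.
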